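(* Suppose that for each $n$ we are given a sequence $(d_i)_{i=1}^n=(d_i^{(n)})_{i=1}^n$ of non-negative integers with $\sum_{i=1}^n d_i$ even, and that there is a probability distribution $(p_k)_{k\ge 0}$ not depending on $n$ such that: $n_k/n\to p_k$ for every $k\ge0$, where $n_k:=\#\{i:d_i=k\}$; $\lambda:=\sum_k kp_k\in(0,\infty)$; $\sum_{i=1}^n d_i^2=O(n)$; and $p_1>0$. Let $D$ be a random variable with $\mathbb P(D=k)=p_k$ and suppose $\mathbb E D(D-2)=\sum_k k(k-2)p_k=0$. Assume further that $\alpha_n:=\sum_{i=1}^n d_i(d_i-2)/n>0$, that $n^{1/3}\alpha_n\to\infty$, and that $\sum_{i=1}^n d_i^{4+\eta}=O(n)$ for some $\eta>0$. Let $\beta:=\mathbb E D(D-1)(D-2)$, and let $\mathcal C_1,\mathcal C_2$ be the largest and second largest components of $G(n,(d_i)_1^n)$. Then $\beta>0$ and, as $n\to\infty$, $v(\mathcal C_1)=\frac{2\lambda}{\beta}n\alpha_n+o_p(n\alpha_n)$, $v_k(\mathcal C_1)=\frac{2}{\beta}kp_kn\alpha_n+o_p(n\alpha_n)$ for every $k\ge0$, $e(\mathcal C_1)=\frac{2\lambda}{\beta}n\alpha_n+o_p(n\alpha_n)$, while $v(\mathcal C_2)=o_p(n\alpha_n)$ and $e(\mathcal C_2)=o_p(n\alpha_n)$. The same results hold with $G(n,(d_i)_1^n)$ replaced by $G^*(n,(d_i)_1^n)$.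
   Context: $G(n,(d_i)_1^n)$ is a uniformly random simple graph on $\{1,\dots,n\}$ with vertex $i$ of degree $d_i$. $G^*(n,(d_i)_1^n)$ is the configuration-model multigraph: vertex $i$ receives $d_i$ half-edges, which are paired by a uniformly random perfect matching. $v(G)$, $e(G)$, $v_k(G)$ denote numbers of vertices, edges, and vertices of degree $k$. $X_n=o_p(a_n)$ means $X_n/a_n\to0$ in probability. *)

(* Defs.v *)
From HB Require Import structures.
From mathcomp Require Import all_boot all_order all_algebra.

Set Implicit Arguments.
Unset Strict Implicit.
Unset Printing Implicit Defensive.

(* A finite multigraph on [V] is the list of its edges, each edge being the set
   of its endpoints: a loop is a singleton, a multiple edge is repeated in the
   list. The order of the list is irrelevant to all notions below. *)
Definition mgraph (V : finType) := seq {set V}.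

Section MultiGraph.
Variables (V : finType) (G : mgraph V).

Definition adj : rel V := fun u v => [set u; v] \in G.

Definition degree (v : V) : nat :=
  \sum_(e <- G) (if e == [set v] then 2 else (v \in e : nat)).

Definition components : {set {set V}} :=
  equivalence_partition (connect adj) [set: V].

Definition nvertices (C : {set V}) : nat := #|C|.

Definition nvertices_deg (k : nat) (C : {set V}) : nat :=
  #|[set v in C | degree v == k]|.

Definition nedges (C : {set V}) : nat :=
  count (fun e : {set V} => e \subset C) G.

End MultiGraph.

(* [C] has the most vertices among the members of [P]; by convention it is empty
   if [P] is. Ties may be broken in any way. *)
Definition is_largest (V : finType) (P : {set {set V}}) (C : {set V}) : Prop :=
  if P == set0 then C = set0
  else C \in P /\ forall B, B \in P -> #|B| <= #|C|.

Definition simple_graphs (n : nat) (d : 'I_n -> nat) : {set {set {set 'I_n}}} :=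
  [set E : {set {set 'I_n}} |
    [forall e in E, #|e| == 2] && [forall i, degree (enum E) i == d i]].

Definition graph_of_edges (n : nat) (E : {set {set 'I_n}}) : mgraph 'I_n :=
  enum E.

Definition half_edge (n : nat) (d : 'I_n -> nat) : finType :=
  {i : 'I_n & 'I_(d i)}.

Definition matchings (n : nat) (d : 'I_n -> nat) :
    {set {set {set half_edge d}}} :=
  [set M : {set {set half_edge d}} |
    partition M [set: half_edge d] && [forall e in M, #|e| == 2]].

Definition graph_of_matching (n : nat) (d : 'I_n -> nat)
    (M : {set {set half_edge d}}) : mgraph 'I_n :=
  [seq [set tag h | h in e] | e : {set half_edge d} <- enum M].

Definition ndeg (n : nat) (d : 'I_n -> nat) (k : nat) : nat :=
  #|[set i | d i == k]|.

(* Required only here because it shadows the finite-set notations. *)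
From mathcomp Require Import all_classical all_reals all_analysis.

Import Order.TTheory GRing.Theory Num.Theory.
Import numFieldNormedType.Exports.

Local Open Scope ring_scope.
Local Open Scope classical_set_scope.

Section Asymptotics.
Variable R : realType.

(* Probability of [E] for a uniformly random element of [A]; it is 0 when [A] is
   empty (for instance if no simple graph has the given degrees). *)
Definition unif_prob (T : finType) (A : {set T}) (E : pred T) : R :=
  #|[pred w in A | E w]|%:R / #|A|%:R.

(* [X n = o_p(a n)], where [X n] is a function of a uniformly random element of
   [Om n]. *)
Definition littleo_p (T : nat -> finType) (Om : forall n, {set T n})
    (X : forall n, T n -> R) (a : nat -> R) : Prop :=
  forall eps : R, 0 < eps ->
    unif_prob (Om n) (fun w => eps < `|X n w / a n|) @[n --> \oo] --> (0 : R).

(* [E f(D)] for [D] with law [p], as a sum in [\bar R]. The limit defining the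
   sum exists as soon as [f] is nonnegative up to finitely many arguments, which
   is the case for every [f] this is applied to. *)
Definition expect_pmf (p : nat -> R) (f : nat -> R) : \bar R :=
  (\sum_(0 <= k <oo) (f k * p k)%:E)%E.

Definition is_pmf (p : nat -> R) : Prop :=
  (forall k, 0 <= p k) /\ expect_pmf p (fun=> 1) = 1%E.

Definition alpha (d : forall n, 'I_n -> nat) (n : nat) : R :=
  (\sum_(i < n) (d n i)%:R * ((d n i)%:R - 2)) / n%:R.

(* The asymptotics of the two largest components of the random multigraph
   [G n w], [w] uniform in [Om n], for every way of breaking ties. *)
Definition giant_component (T : nat -> finType) (Om : forall n, {set T n})
    (G : forall n, T n -> mgraph 'I_n)
    (p : nat -> R) (lambda beta : R) (a : nat -> R) : Prop :=
  forall C1 C2 : forall n, T n -> {set 'I_n},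
  (forall n w, w \in Om n ->
     is_largest (components (G n w)) (C1 n w) /\
     is_largest (components (G n w) :\ C1 n w)%SET (C2 n w)) ->
  let na := fun n : nat => n%:R * a n in
  [/\ littleo_p Om (fun n w =>
        (nvertices (C1 n w))%:R - 2 * lambda / beta * na n) na,
      forall k, littleo_p Om (fun n w =>
        (nvertices_deg (G n w) k (C1 n w))%:R
          - 2 / beta * k%:R * p k * na n) na,
      littleo_p Om (fun n w =>
        (nedges (G n w) (C1 n w))%:R - 2 * lambda / beta * na n) na,
      littleo_p Om (fun n w => (nvertices (C2 n w))%:R) na &
      littleo_p Om (fun n w => (nedges (G n w) (C2 n w))%:R) na].

End Asymptotics.

(* Main.v *)
Require Import Defs.
From HB Require Import structures.
From mathcomp Require Import all_boot all_order all_fingroup all_algebra.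
From mathcomp Require Import ring lra zify.

Set Implicit Arguments.
Unset Strict Implicit.
Unset Printing Implicit Defensive.

Import Order.TTheory GRing.Theory Num.Theory.

Local Open Scope ring_scope.

(** Reveal the pairs of a uniform perfect matching of the half-edges one by one,
    always matching a half-edge of an already discovered vertex if there is one,
    and otherwise restarting at a fresh vertex of degree 1.  The partner is uniform
    among the remaining half-edges, so sums of weights over discovered vertices are
    martingales up to explicit compensators, and an L^2 maximal inequality controls
    them at all times [t = O(n alpha)].  Writing [a = n alpha], the number of active
    half-edges minus the (negligible) number of restarts is
    [(a t - beta t^2 / (2 lambda)) / (lambda n) + o(n alpha^2)]; the error is
    negligible because [n alpha^3] tends to infinity.  Hence one component is
    explored between times [o(a)] and [2 lambda a / beta + o(a)].  What is left
    afterwards is subcritical with drift of order [- alpha]: the component of a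
    half-edge [h] has at least [J] edges with probability [O(deg h / (alpha J))],
    and weighing by half-edges excludes every other component with a positive
    fraction of [a] edges.

    The simple graph is the configuration model conditioned on having no loop and
    no multiple edge.  A lopsided local lemma for matchings bounds the probability
    of this event away from 0, and every simple graph comes from the same number
    of matchings. *)

(** * Exploring a uniform perfect matching *)

(** Over [O(a)] steps of bounded variance the degree walk fluctuates by the square root of [a],
    while the parabola that it follows has height of order [a * al]; second moments therefore
    suffice once [a * al ^+ 2 = n * al ^+ 3] is large. Two obstacles shape the rest. The drift
    depends on the number of restarts, which depends on the walk: a crude bound on the walk first
    bounds the restarts, and that bound then gives the fine estimate. Restarting at leaves makes
    every restart add the same known amount to any weight that depends on the degree. Secondly, the
    rule itself chooses where it restarts, so following it says little about an arbitrary component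
    left after the giant. Hence each half-edge [e] gets an exploration of its own, altered to
    restart at [e] at a late zero; a large component makes the explorations from all its half-edges
    survive, and this multiplicity beats the bound for a single one. Only counting is involved
    before the limit: probabilities are ratios of cardinals of sets of involutions. *)

Section Involutions.
Variable H : finType.

(** Perfect matchings of [H], encoded as permutations so that conjugation by a transposition is
    available: it exchanges the partners of two half-edges. *)
Definition fpf : {set {perm H}} :=
  [set m : {perm H} | [forall h, (m (m h) == h) && (m h != h)]].

Lemma fpfP (m : {perm H}) :
  reflect (forall h, m (m h) = h /\ m h != h) (m \in fpf).
Proof.
rewrite inE; apply: (iffP forallP) => mP h.
  by have /andP[/eqP] := mP h.
by have [-> ->] := mP h; rewrite eqxx.
Qed.

Lemma fpfK (m : {perm H}) : m \in fpf -> involutive m.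
Proof. by move=> /fpfP mP h; have [] := mP h. Qed.

Lemma fpf_neq (m : {perm H}) h : m \in fpf -> m h != h.
Proof. by move=> /fpfP mP; have [] := mP h. Qed.

Lemma conj_tpermE (m : {perm H}) v y z :
  (m ^ tperm v y)%g z = tperm v y (m (tperm v y z)).
Proof. by rewrite -[z in LHS](tpermK v y) permJ. Qed.

Lemma fpf_conj (m : {perm H}) v y : m \in fpf -> (m ^ tperm v y)%g \in fpf.
Proof.
move=> mP; apply/fpfP => h; rewrite !conj_tpermE tpermK fpfK // tpermK.
split=> //; apply/eqP => /(congr1 (tperm v y)); rewrite tpermK => /eqP.
by rewrite (negPf (fpf_neq _ mP)).
Qed.

Section Exploration.
Variable c : {set H} -> H.
Hypothesis c_notin : forall C, C != setT -> c C \notin C.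

Fixpoint cov (p : seq (H * H)) : {set H} :=
  if p is (u, x) :: p' then u |: (x |: cov p') else set0.

(** The history up to time [t], latest pair first. Once everything is covered the rule is
    unconstrained, whence the bounds of [2 * t] by [#|H|] in what follows. *)
Fixpoint pref (t : nat) (m : {perm H}) : seq (H * H) :=
  if t is t'.+1 then
    let p := pref t' m in (c (cov p), m (c (cov p))) :: p
  else [::].

Lemma size_pref t m : size (pref t m) = t.
Proof. by elim: t => //= t ->. Qed.

Lemma cov_closed m t h :
  m \in fpf -> (m h \in cov (pref t m)) = (h \in cov (pref t m)).
Proof.
move=> mP; elim: t h => [|t IH] h /=; first by rewrite !inE.
rewrite !inE IH (inj_eq perm_inj) (can2_eq (fpfK mP) (fpfK mP)).
by rewrite orbCA.
Qed.

Lemma cov_sub m t s : (t <= s)%N -> cov (pref t m) \subset cov (pref s m).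
Proof.
elim: s => [|s IH]; first by rewrite leqn0 => /eqP ->.
rewrite leq_eqVlt => /predU1P[-> //|/IH/subset_trans]; apply=> /=.
by apply/subsetP => h; rewrite !inE => ->; rewrite !orbT.
Qed.

Lemma cov_neqT m t : (#|cov (pref t m)| < #|H|)%N -> cov (pref t m) != setT.
Proof. by apply: contraTneq => ->; rewrite cardsT ltnn. Qed.

Lemma card_cov m t : m \in fpf -> (2 * t <= #|H|)%N ->
  #|cov (pref t m)| = (2 * t)%N.
Proof.
move=> mP; elim: t => [|t IH] tH; first by rewrite cards0.
have IH' : #|cov (pref t m)| = (2 * t)%N.
  by apply: IH; apply: leq_trans tH; rewrite leq_mul2l leqnSn.
have uP : c (cov (pref t m)) \notin cov (pref t m).
  by apply/c_notin/cov_neqT; rewrite IH'; apply: leq_trans tH; rewrite mulnS.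
rewrite /= !cardsU1 !inE eq_sym (negPf (fpf_neq _ mP)) cov_closed // uP /=.
by rewrite IH' mulnS !add1n.
Qed.

Lemma rule_notin m t : m \in fpf -> (2 * t < #|H|)%N ->
  c (cov (pref t m)) \notin cov (pref t m).
Proof.
by move=> mP tH; apply/c_notin/cov_neqT; rewrite card_cov // ltnW.
Qed.

(** The rule looks only at covered half-edges, so a history is determined by the partners of what it
    covers. This lets the unrevealed part of a matching be modified freely. *)
Lemma pref_agree (m m' : {perm H}) t :
  {in cov (pref t m), m =1 m'} -> pref t m' = pref t m.
Proof.
elim: t => //= t IH mm'; rewrite IH => [|h hC]; last first.
  by apply: mm'; rewrite !inE hC !orbT.
by rewrite mm' // !inE eqxx.
Qed.

Definition candidates (p : seq (H * H)) : {set H} :=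
  [set y | (y \notin cov p) && (y != c (cov p))].

Lemma card_candidates m t : m \in fpf -> (2 * t < #|H|)%N ->
  #|candidates (pref t m)| = (#|H| - 2 * t - 1)%N.
Proof.
move=> mP tH.
have -> : candidates (pref t m) = ~: (c (cov (pref t m)) |: cov (pref t m)).
  by apply/setP => y; rewrite !inE negb_or andbC.
rewrite cardsCs setCK cardsU1 rule_notin // card_cov ?(ltnW tH) //.
by rewrite add1n subnS subn1.
Qed.

Variable R : realFieldType.

(* Conjugating by the transposition of [m u] and [y] is an involution on the
   pairs [(m, y)] which preserves the history up to time [t]. *)
Lemma exchange t (F : seq (H * H) -> H -> R) : (2 * t < #|H|)%N ->
  (\sum_(m in fpf) F (pref t m) (m (c (cov (pref t m)))))
     *+ (#|H| - 2 * t - 1) =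
  \sum_(m in fpf) \sum_(y in candidates (pref t m)) F (pref t m) y.
Proof.
move=> tH; rewrite -sumrMnl.
transitivity (\sum_(m in fpf) \sum_(y in candidates (pref t m))
    F (pref t m) (m (c (cov (pref t m))))).
  by apply: eq_bigr => m mP; rewrite sumr_const card_candidates.
rewrite !pair_big_dep /=.
pose io (i : {perm H} * H) :=
  let v := i.1 (c (cov (pref t i.1))) in ((i.1 ^ tperm v i.2)%g, v).
pose P (i : {perm H} * H) := (i.1 \in fpf) && (i.2 \in candidates (pref t i.1)).
have ioP i : P i -> [/\ P (io i), io (io i) = i &
    pref t (io i).1 = pref t i.1].
  case: i => m y; rewrite /P /io /= => /andP[mP]; rewrite inE => /andP[yC yu].
  set u := c _ in yu *; set v := m u; have uC := rule_notin mP tH.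
  have vC : v \notin cov (pref t m) by rewrite cov_closed.
  have uv : u != v by rewrite eq_sym fpf_neq.
  have E : pref t (m ^ tperm v y)%g = pref t m.
    apply: pref_agree => h hC; rewrite conj_tpermE.
    have mhC : m h \in cov (pref t m) by rewrite cov_closed.
    have neqC z : z \in cov (pref t m) -> tperm v y z = z.
      by move=> zC; apply: tpermD; apply: contraTneq zC => <-.
    by rewrite !neqC.
  rewrite E -/u; have -> : (m ^ tperm v y)%g u = y.
    by rewrite conj_tpermE (tpermD (z := u)) ?tpermL // eq_sym.
  by rewrite fpf_conj // inE vC eq_sym uv tpermC -conjgM tperm2 conjg1.
rewrite (reindex_onto io io) => [|i /ioP[]//].
apply: eq_big => [i|i /andP[Pi /eqP ioi]].
  apply/andP/idP => [[Pi /eqP ioi]|/ioP[Pi -> _]//].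
  by have [] := ioP _ Pi; rewrite ioi.
have [_ _ E] := ioP _ Pi; rewrite ioi in E; rewrite E.
by congr F; rewrite -[RHS](congr1 snd ioi).
Qed.

(** * Kolmogorov's maximal inequality along the exploration *)

Section Maximal.
Variables (xi : seq (H * H) -> H -> R) (T : nat) (v b : R).
Hypothesis TH : (2 * T <= #|H|)%N.
Hypothesis v_ge0 : 0 <= v.
Hypothesis b_gt0 : 0 < b.
Hypothesis xi_mean : forall t m, m \in fpf -> (t < T)%N ->
  \sum_(y in candidates (pref t m)) xi (pref t m) y = 0.
Hypothesis xi_var : forall t m, m \in fpf -> (t < T)%N ->
  \sum_(y in candidates (pref t m)) xi (pref t m) y ^+ 2
    <= v *+ (#|H| - 2 * t - 1).

(** The walk frozen once its absolute value reaches [b]: its final value remembers an early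
    excursion, which reduces a maximal inequality to a bound at one time. *)
Fixpoint stopped (p : seq (H * H)) : R :=
  if p is (_, x) :: p' then
    if b <= `|stopped p'| then stopped p' else stopped p' + xi p' x
  else 0.

Definition walk t m : R :=
  \sum_(s < t) xi (pref s m) (m (c (cov (pref s m)))).

Lemma stopped_walk t m :
  (exists2 s, (s <= t)%N & b <= `|walk s m|) -> b <= `|stopped (pref t m)|.
Proof.
suff: b <= `|stopped (pref t m)| \/
    stopped (pref t m) = walk t m /\
    forall s, (s <= t)%N -> `|walk s m| < b.
  by move=> [//|[_ lt_b]] [s /lt_b]; rewrite ltNge => /negbTE ->.
have lt_walk s : ~~ (b <= `|walk s m|) -> `|walk s m| < b by rewrite -ltNge.
elim: t => [|t IH] /=.
  rewrite -[0](_ : walk 0 m = 0); last by rewrite /walk big_ord0.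
  case: (boolP (b <= `|walk 0 m|)); [by left|move=> /lt_walk lt0; right].
  by split=> // s; rewrite leqn0 => /eqP ->.
have [le_b|lt_b] := boolP (b <= `|stopped (pref t m)|); first by left.
case: IH => [le_b|[-> IH]]; first by rewrite le_b in lt_b.
have -> : walk t m + xi (pref t m) (m (c (cov (pref t m)))) = walk t.+1 m.
  by rewrite /walk big_ord_recr.
case: (boolP (b <= `|walk t.+1 m|)); [by left|move=> /lt_walk lt1; right].
by split=> // s; rewrite leq_eqVlt => /predU1P[->//|]; exact: IH.
Qed.

(** Orthogonality of increments: [exchange] averages the last increment over the candidates, where
    the cross term vanishes by [xi_mean] and the square costs at most [v]. A frozen walk costs
    nothing. *)
Lemma stopped_sqr t : (t <= T)%N ->
  \sum_(m in fpf) stopped (pref t m) ^+ 2 <= (v *+ t) *+ #|fpf|.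
Proof.
elim: t => [|t IH] tT.
  by rewrite big1 // => [|m _]; rewrite ?mulr0n ?mul0rn // expr0n.
have tH : (2 * t.+1 <= #|H|)%N by apply: leq_trans TH; rewrite leq_mul2l.
have L_gt0 : (0 < #|H| - 2 * t - 1)%N.
  by rewrite -subnDA subn_gt0 addn1; rewrite mulnS in tH.
rewrite -(ler_pMn2r L_gt0).
pose F p y := (if b <= `|stopped p| then stopped p
               else stopped p + xi p y) ^+ 2.
rewrite (exchange F); last by rewrite mulnS in tH; apply: ltnW.
apply: (@le_trans _ _ (\sum_(m in fpf)
    (stopped (pref t m) ^+ 2 + v) *+ (#|H| - 2 * t - 1))); last first.
  rewrite sumrMnl ler_pMn2r // big_split /= sumr_const.
  by rewrite mulrSr mulrnDl lerD2r IH // ltnW.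
apply: ler_sum => m mP; rewrite /F.
have tH' : (2 * t < #|H|)%N by rewrite mulnS in tH; apply: ltnW.
case: (b <= `|stopped (pref t m)|).
  by rewrite sumr_const card_candidates // ler_pMn2r // lerDl.
under eq_bigr do rewrite sqrrD -mulrnAl.
rewrite !big_split /= sumr_const card_candidates // -mulr_sumr xi_mean // mulr0.
by rewrite addr0 mulrnDl lerD2l xi_var.
Qed.

(** Chebyshev's inequality for the stopped walk at time [T]. *)
Lemma maximal_ineq :
  #|[set m in fpf | [exists t : 'I_T.+1, b <= `|walk t m|]]|%:R * b ^+ 2
    <= (v *+ T) *+ #|fpf|.
Proof.
apply: le_trans (stopped_sqr (leqnn T)).
rewrite mulrC mulr_natr -sumr_const big_mkcond [X in _ <= X]big_mkcond /=.
apply: ler_sum => m _; rewrite inE; case: (m \in fpf) => //=.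
case: ifP => [/existsP[t bt]|_]; last exact: sqr_ge0.
have le_b : b <= `|stopped (pref T m)|.
  by apply: stopped_walk; exists t; rewrite // -ltnS.
by rewrite -[X in _ <= X]real_normK ?num_real // ler_sqr ?nnegrE // ltW.
Qed.

End Maximal.
End Exploration.
End Involutions.

(** * Discovered vertices, their weights, and components *)

Section Vertices.
Variables (H V : finType) (vtx : H -> V).

Definition deg (i : V) : nat := #|[set h | vtx h == i]|.
Lemma degE i : deg i = #|[set h | vtx h == i]|.
Proof. by []. Qed.

Definition disc (C : {set H}) : {set V} := vtx @: C.
Definition act (C : {set H}) : {set H} :=
  [set h | (h \notin C) && (vtx h \in disc C)].

(** Passing from half-edges to vertices size-biases a weight; every additional factor [deg] below
    comes from here. *)
Lemma sum_deg (M : nmodType) (D : pred V) (w : V -> M) :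
  \sum_(h | D (vtx h)) w (vtx h) = \sum_(i | D i) w i *+ deg i.
Proof.
rewrite (partition_big vtx D) //=; apply: eq_bigr => i Di.
rewrite -sumr_const; apply: eq_big => [h|h /andP[_ /eqP ->]//].
by rewrite inE; case: eqP => [->|]; rewrite ?andbT ?andbF.
Qed.

Lemma sum_deg_nat (D : pred V) :
  (\sum_(i | D i) deg i = #|[set h | D (vtx h)]|)%N.
Proof.
have := sum_deg D (fun=> 1%N : nat); rewrite sum1_card -[RHS]/(\sum_(i | D i) _)%N.
move=> E; rewrite cardsE [RHS]E; apply: eq_bigr => i _.
by rewrite -mulr_natl mulr1 natn.
Qed.

Lemma deg_disc (C : {set H}) :
  (\sum_(i in disc C) deg i = #|C| + #|act C|)%N.
Proof.
rewrite sum_deg_nat -cardsUI.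
have -> : C :&: act C = set0.
  by apply/setP => h; rewrite !inE; case: (h \in C).
rewrite cards0 addn0; apply: eq_card => h; rewrite !inE.
by case hC: (h \in C) => //=; rewrite imset_f.
Qed.

Section Process.
Variable c : {set H} -> H.
Hypothesis c_notin : forall C, C != setT -> c C \notin C.
Hypothesis c_act : forall C, act C != set0 -> c C \in act C.

Notation pref := (pref c).
Notation candidates := (candidates c).
Local Notation covt t m := (cov (pref t m)).

Lemma kickE C : C != setT -> (vtx (c C) \in disc C) = (act C != set0).
Proof.
move=> /c_notin cC; apply/idP/idP => [uD|/c_act]; last first.
  by rewrite inE => /andP[].
by apply/set0Pn; exists (c C); rewrite inE cC.
Qed.

Section Weights.
Variable R : realFieldType.
Implicit Type w : V -> R.

(** Besides the discovered vertices this contains the vertex of the half-edge about to be matched,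
    which is new at a restart. *)
Definition seen (p : seq (H * H)) : {set V} := disc (c (cov p) |: cov p).

Definition gain w (p : seq (H * H)) (y : H) : R :=
  if vtx y \in seen p then 0 else w (vtx y).

Definition rest w (p : seq (H * H)) : R := \sum_(i | i \notin seen p) w i *+ deg i.

Definition compensator w (p : seq (H * H)) : R :=
  rest w p / (#|H| - 2 * size p - 1)%:R.

(** [Yw] collects the weights of vertices met as random partners, which [compensator] centres; [Kw]
    collects those of vertices selected by the rule at a restart. *)
Definition Yw w t m : R :=
  \sum_(s < t) gain w (pref s m) (m (c (covt s m))).

Definition Kw w t m : R :=
  \sum_(s < t) (if vtx (c (covt s m)) \in disc (covt s m) then 0
                else w (vtx (c (covt s m)))).

(** A half-edge that is not a candidate sits at a seen vertex and gains nothing, so the sum may run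
    over all half-edges. Divided by the number of candidates, it is the conditional mean of the
    gain. *)
Lemma sum_gain w p : \sum_(y in candidates p) gain w p y = rest w p.
Proof.
rewrite /rest -sum_deg [RHS]big_mkcond [LHS]big_mkcond /=.
apply: eq_bigr => y _; rewrite /gain inE.
case: ifP => [|/negbT]; first by case: (vtx y \in seen p).
rewrite negb_and !negbK => yC; case: ifPn => // /negP[].
by apply: imset_f; rewrite !inE; case/orP: yC => ->; rewrite ?orbT.
Qed.

Lemma gain_sqr w p y : gain w p y ^+ 2 = gain (fun i => w i ^+ 2) p y.
Proof. by rewrite /gain; case: ifP; rewrite ?expr0n. Qed.

Lemma disc_sum w t m :
  \sum_(i in disc (covt t m)) w i = Yw w t m + Kw w t m.
Proof.
elim: t => [|t IH]; first by rewrite /Yw /Kw !big_ord0 addr0 /disc imset0 big_set0.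
rewrite /Yw /Kw !big_ord_recr /= -/(Yw w t m) -/(Kw w t m) addrACA -IH.
rewrite /gain /seen /=; set C := cov _; set u := c C; set x := m u.
have -> : disc (u |: (x |: C)) = vtx x |: (vtx u |: disc C).
  by rewrite /disc setUCA !imsetU !imset_set1.
have E : disc (u |: C) = vtx u |: disc C by rewrite /disc imsetU imset_set1.
have bigU i (B : {set V}) : \sum_(j in i |: B) w j =
    \sum_(j in B) w j + (if i \in B then 0 else w i).
  case: ifPn => iB; last by rewrite big_setU1 // addrC.
  by rewrite addr0; apply: eq_bigl => j; rewrite !inE; case: eqP => [->|].
by rewrite !bigU E -addrA [X in _ + X]addrC.
Qed.

Lemma rest_le w p : (forall i, 0 <= w i) -> rest w p <= \sum_i w i *+ deg i.
Proof.
move=> w_ge0; rewrite /rest big_mkcond /=; apply: ler_sum => i _.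
by case: ifP => // _; apply: mulrn_wge0.
Qed.

(** Centring does not increase the second moment, and that moment is at most the size-biased sum of
    [w ^+ 2] over all vertices, seen or not. *)
Lemma weight_maximal w T (v b : R) : (2 * T <= #|H|)%N -> 0 < b ->
  (forall t, (t < T)%N -> \sum_i w i ^+ 2 *+ deg i <= v *+ (#|H| - 2 * t - 1)) ->
  0 <= v ->
  #|[set m in fpf H | [exists t : 'I_T.+1,
       b <= `|Yw w t m - \sum_(s < t) compensator w (pref s m)|]]|%:R * b ^+ 2
    <= (v *+ T) *+ #|fpf H|.
Proof.
move=> TH b_gt0 vP v_ge0.
pose xi p y := gain w p y - compensator w p.
have LP t : (t < T)%N -> (2 * t < #|H|)%N /\ (0 < #|H| - 2 * t - 1)%N by lia.
have := @maximal_ineq H c c_notin R xi T v b TH v_ge0 b_gt0.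
have -> : [set m in fpf H | [exists t : 'I_T.+1, b <= `|walk c xi t m|]] =
  [set m in fpf H | [exists t : 'I_T.+1,
     b <= `|Yw w t m - \sum_(s < t) compensator w (pref s m)|]].
  by apply/setP => m; rewrite !inE; congr (_ && _); apply: eq_existsb => t;
     rewrite /walk /xi sumrB.
have compL t m : (t < T)%N -> compensator w (pref t m) * (#|H| - 2 * t - 1)%:R =
    rest w (pref t m).
  move=> /LP[_ L0]; rewrite /compensator size_pref divfK //.
  by rewrite pnatr_eq0 -lt0n.
apply=> t m mP tT; have [tH L0] := LP _ tT.
  by rewrite /xi sumrB sum_gain sumr_const card_candidates // -mulr_natr compL // subrr.
apply: le_trans (vP t tT).
apply: (@le_trans _ _ (rest (fun i => w i ^+ 2) (pref t m))); last first.
  by apply: rest_le => i; apply: sqr_ge0.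
rewrite /xi; under eq_bigr do rewrite sqrrB gain_sqr -mulrnAr.
rewrite big_split sumrB /= sum_gain -mulr_suml sum_gain sumr_const card_candidates //.
rewrite -(compL t m tT) -addrA gerDl -mulr_natr -(mulr_natr (compensator _ _)).
have : 0 <= compensator w (pref t m) ^+ 2 * (#|H| - 2 * t - 1)%:R.
  by rewrite mulr_ge0 ?sqr_ge0.
lra.
Qed.

Lemma weight_mean w T (v : R) : (2 * T <= #|H|)%N ->
  (forall i, 0 <= w i) ->
  (forall t, (t < T)%N -> \sum_i w i *+ deg i <= v *+ (#|H| - 2 * t - 1)) ->
  \sum_(m in fpf H) Yw w T m <= (v *+ T) *+ #|fpf H|.
Proof.
move=> TH w_ge0 vP; rewrite /Yw exchange_big /= mulrnAC.
rewrite -[in leRHS](card_ord T) -sumr_const; apply: ler_sum => t _.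
have tT := ltn_ord t; have L0 : (0 < #|H| - 2 * t - 1)%N by lia.
rewrite -(ler_pMn2r L0) (exchange c_notin (gain w)); last by lia.
rewrite mulrnAC -sumr_const; apply: ler_sum => m _.
by rewrite sum_gain; apply: le_trans (vP t tT); apply: rest_le.
Qed.

Lemma Yw_homo w m t s : (forall i, 0 <= w i) -> (t <= s)%N ->
  Yw w t m <= Yw w s m.
Proof.
move=> w_ge0 /subnK <-; elim: (s - t)%N => [|k IH] //.
rewrite addSn {2}/Yw big_ord_recr /= -/(Yw w (k + t) m).
by apply: le_trans IH _; rewrite lerDl /gain; case: ifP.
Qed.

Lemma Yw_ge0 w m t : (forall i, 0 <= w i) -> 0 <= Yw w t m.
Proof.
by move=> w_ge0; apply: sumr_ge0 => s _; rewrite /gain; case: ifP.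
Qed.

End Weights.

Definition madj (m : {perm H}) : rel V :=
  fun i j => [exists h, (vtx h == i) && (vtx (m h) == j)].

Lemma madj_sym m : m \in fpf H -> symmetric (madj m).
Proof.
move=> mP i j; apply/existsP/existsP => -[h /andP[/eqP hi /eqP hj]];
  by exists (m h); rewrite fpfK // hi hj !eqxx.
Qed.

Definition mclosed (m : {perm H}) (B : {set V}) :=
  forall h, vtx h \in B -> vtx (m h) \in B.

Lemma mclosed_connect m B i j : mclosed m B -> connect (madj m) i j ->
  i \in B -> j \in B.
Proof.
move=> Bc /connectP[q]; elim: q i => [|k q IH] i /=; first by move=> _ ->.
move=> /andP[/existsP[h /andP[/eqP hi /eqP hk]] kq] jE iB.
by apply: IH kq jE _; rewrite -hk; apply: Bc; rewrite hi.
Qed.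

Lemma mclosedC m B : m \in fpf H -> mclosed m B -> mclosed m (~: B).
Proof.
move=> mP Bc h; rewrite !inE; apply: contra => /Bc.
by rewrite fpfK.
Qed.

(** With no active half-edge, all half-edges of discovered vertices are covered, and covered
    half-edges are matched among themselves. *)
Lemma disc_mclosed m t : m \in fpf H -> act (covt t m) = set0 ->
  mclosed m (disc (covt t m)).
Proof.
move=> mP A0 h hD; have := in_set0 h; rewrite -A0 inE hD andbT => /negbFE hC.
by apply: imset_f; rewrite cov_closed.
Qed.

(** Between zeros the rule picks a half-edge of a discovered vertex. That vertex was found after
    [t1], since all half-edges of older vertices were covered by then; so the new pair attaches to
    the piece that grew from the restart vertex. *)
Lemma disc_connect m t1 t : m \in fpf H ->
  act (covt t1 m) = set0 ->
  (forall s, (t1 < s < t)%N -> act (covt s m) != set0) -> (t1 < t)%N ->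
  forall i, i \in disc (covt t m) -> i \notin disc (covt t1 m) ->
  connect (madj m) (vtx (c (covt t1 m))) i.
Proof.
move=> mP A1; elim: t => // t IH Apos t1t i.
have adjm h : madj m (vtx h) (vtx (m h)) by apply/existsP; exists h; rewrite !eqxx.
case/imsetP => h /=; rewrite !inE.
have [->|t1t'] := eqVneq t1 t.
  case/or3P => [/eqP->|/eqP->|hC] -> //; last by rewrite imset_f.
  by move=> _; apply/connect1/adjm.
have {t1t'}t1t' : (t1 < t)%N by lia.
have {}IH := IH _ t1t'.
have At : act (covt t m) != set0 by apply: Apos; rewrite t1t' /=.
have uconn : connect (madj m) (vtx (c (covt t1 m))) (vtx (c (covt t m))).
  have := c_act At; set u := c (covt t m); rewrite inE => /andP[uC uD].
  apply: IH => // [s /andP[ts st]|]; first by apply: Apos; rewrite ts ltnW.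
  apply/negP => uD1; have := in_set0 u; rewrite -A1 inE uD1 andbT.
  move/negbFE => uC1; case/negP: uC.
  by apply: subsetP uC1; apply: cov_sub; apply: ltnW.
case/or3P => [/eqP->|/eqP->|hC] -> // nD.
  by apply: connect_trans uconn _; apply/connect1/adjm.
apply: IH => // [s /andP[ts st]|]; last by rewrite imset_f.
by apply: Apos; rewrite ts ltnW.
Qed.

(** At both zeros the discovered set is a union of components, and everything new is connected to
    the restart vertex: consecutive zeros delimit one component. *)
Lemma disc_component m t1 t2 : m \in fpf H -> (t1 < t2)%N ->
  (2 * t2 <= #|H|)%N ->
  act (covt t1 m) = set0 -> act (covt t2 m) = set0 ->
  (forall s, (t1 < s < t2)%N -> act (covt s m) != set0) ->
  disc (covt t2 m) :\: disc (covt t1 m) =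
    [set i | connect (madj m) (vtx (c (covt t1 m))) i].
Proof.
move=> mP t12 tH A1 A2 Apos; apply/setP => i; rewrite !inE.
apply/andP/idP => [[i1 i2]|conn]; first exact: (disc_connect mP A1 Apos).
split.
  have := mclosed_connect (mclosedC mP (disc_mclosed mP A1)) conn.
  rewrite !inE; apply; rewrite kickE ?A1 ?eqxx //.
  by apply: cov_neqT; rewrite card_cov //; lia.
apply: (mclosed_connect (disc_mclosed mP A2) conn).
apply: imset_f; apply: (subsetP (cov_sub c m t12)).
by rewrite /= !inE eqxx.
Qed.

Lemma deg_disc_zero m t : m \in fpf H -> (2 * t <= #|H|)%N ->
  act (covt t m) = set0 -> (\sum_(i in disc (covt t m)) deg i = 2 * t)%N.
Proof. by move=> mP tH A0; rewrite deg_disc A0 cards0 addn0 card_cov. Qed.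

Lemma disc_sub m t s : (t <= s)%N -> disc (covt t m) \subset disc (covt s m).
Proof. by move=> ts; apply/imsetS/cov_sub. Qed.

Lemma card_disc m t : m \in fpf H -> (2 * t <= #|H|)%N ->
  (#|disc (covt t m)| <= 2 * t)%N.
Proof. by move=> mP tH; apply: leq_trans (leq_imset_card _ _) _; rewrite card_cov. Qed.

End Process.

(** Serves to identify an exploration altered at a late time with the unaltered one before that
    time. *)
Lemma pref_rule (c c' : {set H} -> H) m t :
  (forall s, (s < t)%N -> c' (cov (pref c s m)) = c (cov (pref c s m))) ->
  pref c' t m = pref c t m.
Proof.
elim: t => //= t IH cc'; rewrite IH => [|s st]; last by apply: cc'; apply: ltnW.
by rewrite cc'.
Qed.

End Vertices.

(** * The subcritical remainder *)

Section Remainder.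
Variables (H V : finType) (vtx : H -> V).
Variable c0 : {set H} -> H.
Hypothesis c0_notin : forall C, C != setT -> c0 C \notin C.
Hypothesis c0_act : forall C, act vtx C != set0 -> c0 C \in act vtx C.
Variables (R : realFieldType) (eta : R) (t2 t3 J : nat).
Hypothesis eta_ge0 : 0 <= eta.
Hypothesis eta_le2 : eta <= 2.
Hypothesis tJH : (2 * (t3 + J) <= #|H|)%N.

Notation deg := (deg vtx).
Notation disc := (disc vtx).
Notation act := (act vtx).

(** During the next [J] steps at least [#|H| - #|C| - 2 * J] candidates remain, so this forces the
    mean degree gained per step to be at most [2 - eta], against two half-edges used up. *)
Definition subcritical (C : {set H}) : bool :=
  \sum_(i | i \notin disc C) ((deg i)%:R : R) ^+ 2
    <= (2 - eta) * (#|H| - #|C| - 2 * J)%:R.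

Lemma act_neqT (C : {set H}) : act C != set0 -> C != setT.
Proof.
by apply: contra_neq => ->; apply/setP => h; rewrite !inE.
Qed.

Section FromHalfEdge.
Variable e : H.

(** A condition on [C] alone, as a rule must be. It holds at most once along a history: afterwards
    [vtx e] is discovered. *)
Definition restart (C : {set H}) : bool :=
  [&& act C == set0, (2 * t2 <= #|C|)%N & vtx e \notin disc C].

Definition rule_from (C : {set H}) : H := if restart C then e else c0 C.

Lemma rule_from_notin C : C != setT -> rule_from C \notin C.
Proof.
rewrite /rule_from; case: ifP => [/and3P[_ _ eD] _|_]; last exact: c0_notin.
by apply: contra eD; apply: imset_f.
Qed.

Lemma rule_from_act C : act C != set0 -> rule_from C \in act C.
Proof.
by rewrite /rule_from /restart => A0; rewrite (negPf A0) /=; apply: c0_act.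
Qed.

Notation pref := (pref rule_from).

(** The exploration restarted at [e] at time [tau] in a subcritical state and has had an active
    half-edge at every later time. Being a function of the history, it can be used in [exchange]. *)
Fixpoint alive (tau : nat) (p : seq (H * H)) : bool :=
  (size p == tau) && (restart (cov p) && subcritical (cov p)) ||
  (if p is _ :: p' then alive tau p' && (act (cov p) != set0) else false).

Lemma alive_size tau p : alive tau p -> (tau <= size p)%N.
Proof.
elim: p => [|x p IH] /=; first by rewrite orbF => /andP[/eqP <-].
by case/orP => [/andP[/eqP <-]//|/andP[/IH ? _]]; apply: leqW.
Qed.

Lemma alive_act tau t s m : alive tau (pref t m) -> (tau < s <= t)%N ->
  act (cov (pref s m)) != set0.
Proof.
elim: t => [|t IH]; first by move=> _ /andP[? ?]; lia.
rewrite [alive _ _]/=; case/orP => [/andP[/eqP E _]|/andP[al A0]].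
  by rewrite size_pref in E; lia.
case/andP => ts; rewrite leq_eqVlt => /predU1P[->//|st].
by apply: IH => //; rewrite ts -ltnS.
Qed.

Lemma alive_sum tau t m : m \in fpf H -> (2 * t <= #|H|)%N ->
  alive tau (pref t m) ->
  \sum_(i | i \notin disc (cov (pref t m))) ((deg i)%:R : R) ^+ 2
    <= (2 - eta) * (#|H| - 2 * tau - 2 * J)%:R.
Proof.
move=> mP; elim: t => [|t IH] tH; first by rewrite /= orbF => /and3P[/eqP<- _]; rewrite /subcritical cards0.
rewrite [alive _ _]/=; case/orP => [/and3P[/eqP tE _]|/andP[al _]].
  rewrite /subcritical; have := card_cov rule_from_notin mP tH.
  by rewrite /= => ->; rewrite size_pref in tE; rewrite -tE.
apply: le_trans (IH _ al); last by lia.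
rewrite big_mkcond [leRHS]big_mkcond /=; apply: ler_sum => i _.
case: ifPn => iD; last by case: ifP => _ //; apply: sqr_ge0.
rewrite ifT //; apply: contra iD; apply/subsetP.
by apply: (disc_sub vtx rule_from m (leqnSn t)).
Qed.

(* The active half-edges at the current step, counting those of a vertex about
   to be explored afresh. *)
Definition avail (p : seq (H * H)) : R :=
  (\sum_(i in seen vtx rule_from p) (deg i)%:R) - #|cov p|%:R.

Lemma act_cardE (C : {set H}) :
  #|act C|%:R = \sum_(i in disc C) (deg i)%:R - #|C|%:R :> R.
Proof. by rewrite -natr_sum deg_disc natrD addrC addKr. Qed.

Lemma act_next p y : y \in candidates rule_from p -> rule_from (cov p) \notin cov p ->
  #|act (cov ((rule_from (cov p), y) :: p))|%:R =
    avail p + gain vtx rule_from (fun i => (deg i)%:R) p y - 2 :> R.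
Proof.
rewrite inE => /andP[yC yu] uC; rewrite act_cardE /= /avail.
set u := rule_from _ in yu uC *.
have -> : #|u |: (y |: cov p)|%:R = #|cov p|%:R + 2 :> R.
  rewrite !cardsU1 yC !inE eq_sym (negPf yu) (negPf uC) !natrD /=; lra.
have -> : disc (u |: (y |: cov p)) = vtx y |: seen vtx rule_from p.
  by rewrite /seen /disc -/u setUCA [in LHS]imsetU imset_set1.
rewrite /gain; case: ifPn => yS; last by rewrite big_setU1 //=; lra.
have -> : \sum_(i in vtx y |: seen vtx rule_from p) ((deg i)%:R : R) =
    \sum_(i in seen vtx rule_from p) (deg i)%:R.
  by apply: eq_bigl => i; rewrite !inE; case: eqP => [->|].
lra.
Qed.

Lemma avail_active p : cov p != setT -> act (cov p) != set0 ->
  avail p = #|act (cov p)|%:R.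
Proof.
move=> CT A0; rewrite /avail act_cardE; congr (_ - _); apply: eq_bigl => i.
rewrite /seen /disc imsetU imset_set1 !inE.
by case: eqP => [->|]//=; rewrite (kickE rule_from_notin rule_from_act CT) A0.
Qed.

Lemma avail_restart p : restart (cov p) -> avail p = (deg (vtx e))%:R.
Proof.
move=> rp; rewrite /avail /seen /rule_from rp.
case/and3P: rp => /eqP A0 _ eD.
rewrite {1}/disc imsetU imset_set1 big_setU1 //= -/(disc _).
by rewrite -natr_sum deg_disc A0 cards0 addn0 addrK.
Qed.

(** A supermartingale step: two half-edges leave and at most [2 - eta] arrive on average. Discarding
    the histories that die loses nothing, as they have no active half-edge left. *)
Lemma alive_step tau j : (tau <= t3)%N -> (j < J)%N ->
  \sum_(m in fpf H | alive tau (pref (tau + j).+1 m))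
      avail (pref (tau + j).+1 m)
  <= \sum_(m in fpf H | alive tau (pref (tau + j) m))
      (avail (pref (tau + j) m) - eta).
Proof.
move=> tau3 jJ; set t := (tau + j)%N.
have tH1 : (2 * t.+1 <= #|H|)%N by lia.
pose F p y : R := if alive tau p then
   #|act (cov ((rule_from (cov p), y) :: p))|%:R else 0.
apply: (@le_trans _ _ (\sum_(m in fpf H)
   F (pref t m) (m (rule_from (cov (pref t m)))))).
  rewrite big_mkcondr /=; apply: ler_sum => m mP.
  rewrite /F -/(pref t.+1 m); case: ifP => [|_]; last by case: ifP.
  rewrite [alive _ _]/=; case/orP => [/andP[/eqP E _]|/andP[al A0]].
    by rewrite size_pref in E; lia.
  by rewrite al avail_active // act_neqT.
have L0 : (0 < #|H| - 2 * t - 1)%N by lia.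
rewrite -(ler_pMn2r L0) (exchange rule_from_notin F); last by lia.
rewrite [X in _ <= X *+ _]big_mkcondr /= -sumrMnl; apply: ler_sum => m mP.
rewrite /F; case: ifP => al; last by rewrite big1 ?mul0rn.
have tH0 : (2 * t < #|H|)%N by lia.
have uC := rule_notin rule_from_notin mP tH0.
rewrite (eq_bigr _ (fun y yF => act_next yF uC)).
rewrite !big_split /= sum_gain !sumr_const !(card_candidates rule_from_notin) //.
have : rest vtx rule_from (fun i => (deg i)%:R : R) (pref t m) <=
    (2 - eta) *+ (#|H| - 2 * t - 1).
  apply: (@le_trans _ _ ((2 - eta) * (#|H| - 2 * tau - 2 * J)%:R)).
    apply: le_trans (alive_sum mP _ al); last by lia.
    rewrite /rest big_mkcond [leRHS]big_mkcond /=; apply: ler_sum => i _.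
    case: ifPn => iD; last by case: ifP => _ //; apply: sqr_ge0.
    rewrite ifT; first by rewrite expr2 mulr_natr.
    by apply: contra iD; apply/subsetP/imsetS/subsetUr.
  by rewrite -[leRHS]mulr_natr ler_wpM2l ?subr_ge0 // ler_nat; lia.
set L := (#|H| - 2 * t - 1)%N; set r := rest _ _ _ _.
have [l E] : exists l, forall z : R, z *+ L = z * l.
  by exists L%:R => z; rewrite mulr_natr.
by rewrite !E /avail; set k := #|_|%:R; lra.
Qed.

(** Telescoping [alive_step]: [avail] starts at [deg (vtx e)], stays nonnegative in total and pays
    [eta] per step for each alive matching. Alive sets shrink, so those surviving [J] steps have
    paid [eta * J] each. *)
Lemma alive_bound tau : (t2 <= tau <= t3)%N ->
  eta * J%:R * #|[set m in fpf H | alive tau (pref (tau + J) m)]|%:R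
   <= (deg (vtx e))%:R *
      #|[set m in fpf H | restart (cov (pref tau m)) &&
                          subcritical (cov (pref tau m))]|%:R.
Proof.
move=> /andP[t2tau taut3].
pose a j : R := #|[set m in fpf H | alive tau (pref (tau + j) m)]|%:R.
pose b j : R := \sum_(m in fpf H | alive tau (pref (tau + j) m))
   avail (pref (tau + j) m).
have aE j : \sum_(m in fpf H | alive tau (pref (tau + j) m)) eta = eta * a j.
  rewrite sumr_const /a mulr_natr; congr (_ *+ _).
  by apply: eq_card => m; rewrite [RHS]inE.
have a_step j : a j.+1 <= a j.
  rewrite ler_nat subset_leq_card //; apply/subsetP => m; rewrite !inE addnS.
  move=> /andP[-> /=]; case/orP => [/andP[/eqP E _]|/andP[]//].
  by rewrite size_pref in E; lia.
have b_step j : (j < J)%N -> b j.+1 <= b j - eta * a j.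
  move=> jJ; rewrite /b addnS; apply: le_trans (alive_step taut3 jJ) _.
  by rewrite sumrB aE.
have b_ge0 : (0 < J)%N -> 0 <= b J.
  move=> J0; apply: sumr_ge0 => m /andP[mP]; rewrite -(prednK J0) addnS.
  rewrite [alive _ _]/=; case/orP => [/andP[/eqP E _]|/andP[al A0]].
    by rewrite size_pref in E; lia.
  by rewrite avail_active // act_neqT.
have tot j : (j <= J)%N -> b j + eta * (a J *+ j) <= b 0%N.
  elim: j => [|j IH] jJ; first by rewrite mulr0n mulr0 addr0.
  have := IH (ltnW jJ); have := b_step j jJ.
  have aJ : a J <= a j.
    rewrite -(subnK (ltnW jJ)); elim: (J - j)%N => // k; apply: le_trans.
    by rewrite addSn.
  have := ler_wpM2l eta_ge0 aJ.
  by rewrite mulrSr mulrDr; lra.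
have b0 : b 0%N = (deg (vtx e))%:R *
      #|[set m in fpf H | restart (cov (pref tau m)) &&
                          subcritical (cov (pref tau m))]|%:R.
  have E m : alive tau (pref tau m) = restart (cov (pref tau m)) &&
                          subcritical (cov (pref tau m)).
    case Ep: (pref tau m) => [|x p].
      by have /= := size_pref rule_from tau m; rewrite Ep /= => <-; rewrite eqxx orbF.
    have := size_pref rule_from tau m; rewrite Ep /= => Es.
    rewrite Es eqxx /=; case al: (alive tau p); last by rewrite orbF.
    by have := alive_size al; lia.
  rewrite /b addn0 mulr_natr -sumr_const.
  apply: eq_big => [m|m /andP[_]]; first by rewrite !inE E.
  by rewrite E => /andP[/avail_restart].
have [J0|J0] := posnP J.
  by rewrite J0 mulr0 mul0r mulr_ge0.
rewrite -b0; apply: le_trans (tot J (leqnn J)).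
by rewrite -[a J *+ J]mulr_natl mulrA lerDr b_ge0.
Qed.

(** Restarting at [tau] covers [e], so restarts at different times are disjoint events and the sum
    over [tau] costs no factor. *)
Lemma alive_total :
  eta * J%:R * #|[set m in fpf H | [exists tau : 'I_t3.+1,
      (t2 <= tau)%N && alive tau (pref (tau + J) m)]]|%:R
  <= (deg (vtx e))%:R * #|fpf H|%:R.
Proof.
pose A (tau : 'I_t3.+1) := [set m in fpf H | alive tau (pref (tau + J) m)].
pose K (tau : 'I_t3.+1) := [set m in fpf H | restart (cov (pref tau m)) &&
                          subcritical (cov (pref tau m))].
apply: (@le_trans _ _ (\sum_(tau < t3.+1 | (t2 <= tau)%N)
    eta * J%:R * #|A tau|%:R)).
  rewrite -mulr_sumr ler_wpM2l ?mulr_ge0 // -natr_sum ler_nat.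
  apply: leq_trans (_ : #|\bigcup_(tau < t3.+1 | (t2 <= tau)%N) A tau| <= _)%N.
    apply/subset_leq_card/subsetP => m; rewrite inE => /andP[mP].
    case/existsP => tau /andP[t2tau al]; apply/bigcupP; exists tau => //.
    by rewrite inE mP.
  elim/big_rec2: _ => [|tau n B _ IH]; first by rewrite cards0.
  by apply: leq_trans (leq_card_setU _ _) _; rewrite leq_add2l.
apply: (@le_trans _ _ (\sum_(tau < t3.+1 | (t2 <= tau)%N)
    (deg (vtx e))%:R * #|K tau|%:R)).
  apply: ler_sum => tau t2tau; apply: alive_bound.
  by rewrite t2tau -ltnS /=.
rewrite -mulr_sumr ler_wpM2l // -natr_sum ler_nat.
have -> : (\sum_(tau < t3.+1 | (t2 <= tau)%N) #|K tau| =
   \sum_(m in fpf H) \sum_(tau < t3.+1 | (t2 <= tau)%N) (m \in K tau))%N.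
  rewrite exchange_big /=; apply: eq_bigr => tau _.
  rewrite -sum1_card big_mkcond [RHS]big_mkcond /=; apply: eq_bigr => m _.
  case mP: (m \in fpf H); first by case: (m \in K tau).
  by rewrite [m \in K tau]inE mP.
rewrite -sum1_card; apply: leq_sum => m mP.
have KE tau tau' : m \in K tau -> m \in K tau' -> tau = tau'.
  wlog tt: tau tau' / (tau < tau')%N.
    move=> W k k'; case: (ltngtP tau tau') => [l|l|/val_inj//].
      exact: W. by apply/esym/W.
  rewrite inE => /andP[_ /andP[r _]]; rewrite inE => /andP[_ /andP[r' _]].
  case/and3P: r' => _ _ /negP[]; apply: imset_f.
  apply: (subsetP (cov_sub rule_from m tt)).
  by rewrite /= {1}/rule_from r !inE eqxx.
have [tau0 tau0K|noK] := pickP (fun tau => m \in K tau); last first.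
  by rewrite big1 // => tau _; rewrite noK.
apply: leq_trans (_ : \sum_(tau < t3.+1 | (t2 <= tau)%N) (tau == tau0) <= _)%N.
  apply: leq_sum => tau _; case tauK: (m \in K tau) => //.
  by rewrite (KE _ _ tauK tau0K) eqxx.
rewrite big_mkcond (bigD1 tau0) //= big1; first by case: ifP; rewrite ?eqxx.
by move=> tau /negPf ->; rewrite if_same.
Qed.

End FromHalfEdge.

Notation pref0 := (pref c0).

(** Here [tau] is the first zero from [t2] on of the unaltered exploration, and a degree sum above
    [2 * J] stands for more than [J] edges. *)
Definition late_big (m : {perm H}) : bool :=
  [exists tau : 'I_t3.+1,
    [&& (t2 <= tau)%N, act (cov (pref0 tau m)) == set0,
        [forall s : 'I_tau, (t2 <= s)%N ==> (act (cov (pref0 s m)) != set0)],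
        subcritical (cov (pref0 tau m)) &
        [exists i, (i \notin disc (cov (pref0 tau m))) &&
          (2 * J < \sum_(k | connect (madj vtx m) i k) deg k)%N]]].

(** For [e] in the big component, the altered rule agrees with [c0] before [tau] and restarts at [e]
    there. A zero after [j.+1 <= J] more steps would have exhausted the component with degree sum
    [2 * j.+1], too small. *)
Lemma late_big_alive m : m \in fpf H -> late_big m ->
  exists i, (2 * J < \sum_(k | connect (madj vtx m) i k) deg k)%N /\
   forall e, connect (madj vtx m) i (vtx e) ->
    [exists tau : 'I_t3.+1, (t2 <= tau)%N &&
       alive e tau (pref (rule_from e) (tau + J) m)].
Proof.
move=> mP /existsP[tau /and5P[t2tau /eqP A0 /forallP nz sc /existsP[i]]].
move=> /andP[iD bigi]; exists i; split=> // e ie.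
have tau3 : (tau <= t3)%N by rewrite -ltnS.
apply/existsP; exists tau; rewrite t2tau /=.
have tauH : (2 * tau <= #|H|)%N by lia.
have Cs s : (s <= tau)%N -> #|cov (pref0 s m)| = (2 * s)%N.
  by move=> st; apply: card_cov => //; lia.
have E : pref (rule_from e) tau m = pref0 tau m.
  apply: pref_rule => s st; rewrite /rule_from /restart Cs ?(ltnW st) //.
  rewrite leq_mul2l /=; case: leqP => t2s; last by rewrite andbF.
  by have := nz (Ordinal st); rewrite t2s /= => /negPf ->.
have eD : vtx e \notin disc (cov (pref0 tau m)).
  have := mclosed_connect (mclosedC mP (disc_mclosed mP A0)) ie.
  by rewrite !inE; apply.
have rs : restart e (cov (pref (rule_from e) tau m)).
  by rewrite E /restart A0 eqxx Cs // leq_mul2l t2tau eD.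
have csm := sym_connect_sym (madj_sym vtx mP).
elim: {-2}J (leqnn J) => [|j IH] jJ.
  rewrite addn0; have := size_pref (rule_from e) tau m.
  case Ep: (pref _ _ _) => [|x p] /= <-; rewrite eqxx; move: rs sc;
    by rewrite -E Ep /= => -> ->.
have {}IH := IH (ltnW jJ); rewrite addnS [alive _ _ _]/= IH.
set A1 := (X in _ || X); suff -> : A1 by rewrite orbT.
rewrite {}/A1 /= -/(pref (rule_from e) (tau + j).+1 m).
apply/eqP => A1.
have rn := @rule_from_notin e; have ra := @rule_from_act e.
have E1 : cov (pref (rule_from e) tau m) = cov (pref0 tau m) by rewrite E.
have tjH : (2 * (tau + j).+1 <= #|H|)%N by lia.
have tlt : (tau < (tau + j).+1)%N by lia.
have A1' : act (cov (pref (rule_from e) (tau + j).+1 m)) = set0 by [].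
have A0' : act (cov (pref (rule_from e) tau m)) = set0 by rewrite E1.
have nz' s : (tau < s < (tau + j).+1)%N ->
    act (cov (pref (rule_from e) s m)) != set0.
  by move=> sP; apply: (alive_act IH); rewrite -ltnS.
have comp := disc_component rn ra mP tlt tjH A0' A1' nz'.
have d0 := deg_disc_zero rn mP tauH A0'.
have d1 := deg_disc_zero rn mP tjH A1'.
rewrite (big_setID (disc (cov (pref (rule_from e) tau m)))) /= in d1.
rewrite (setIidPr (disc_sub vtx _ m (ltnW tlt))) d0 comp in d1.
rewrite {1}/rule_from rs in d1.
have d2 : (\sum_(k in [set k | connect (madj vtx m) (vtx e) k]) deg k =
    \sum_(k | connect (madj vtx m) i k) deg k)%N.
  apply: eq_bigl => k; rewrite inE; apply/idP/idP; apply: connect_trans => //.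
  by rewrite csm.
move: d1; rewrite d2; lia.
Qed.

(** Double counting of half-edges against matchings: a late big matching is counted by more than
    [2 * J] half-edges, those of its big component, whereas [alive_total] bounds the count for each
    half-edge by its degree. *)
Lemma late_big_bound :
  eta * J%:R * (2 * J)%:R * #|[set m in fpf H | late_big m]|%:R
    <= (\sum_i (deg i)%:R ^+ 2) * #|fpf H|%:R :> R.
Proof.
pose bad e := [set m in fpf H | [exists tau : 'I_t3.+1, (t2 <= tau)%N &&
       alive e tau (pref (rule_from e) (tau + J) m)]].
apply: (@le_trans _ _ (\sum_e eta * J%:R * #|bad e|%:R)); last first.
  apply: le_trans (ler_sum _ (fun e _ => alive_total e)) _.
  rewrite -mulr_suml ler_wpM2r //.
  have := sum_deg vtx xpredT (fun i => (deg i)%:R : R) => /= ->.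
  by apply: ler_sum => i _; rewrite expr2 mulr_natr.
rewrite -mulr_sumr -mulrA ler_wpM2l ?mulr_ge0 // -natr_sum -natrM ler_nat.
have -> : (\sum_e #|bad e| = \sum_m \sum_e (m \in bad e))%N.
  rewrite exchange_big /=; apply: eq_bigr => e _.
  by rewrite -sum1_card big_mkcond; apply: eq_bigr => m _; case: (m \in _).
rewrite mulnC -sum_nat_const [X in (_ <= X)%N](bigID (mem [set m in fpf H | late_big m])) /=.
apply: leq_trans (leq_addr _ _); apply: leq_sum => m.
rewrite inE => /andP[mP /(late_big_alive mP)[i [bigi iP]]].
apply: leq_trans (ltnW bigi) _; rewrite sum_deg_nat.
rewrite -sum1_card big_mkcond /=; apply: leq_sum => e _.
by rewrite inE; case: ifP => // /iP ex; rewrite inE mP ex.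
Qed.

End Remainder.

(** * Simplicity by the local lemma *)

Section LocalLemma.
Variables (H I : finType) (ev : I -> seq (H * H)).
Variable R : realFieldType.

Definition holds (m : {perm H}) (F : seq (H * H)) : bool :=
  all (fun q => m q.1 == q.2) F.

Definition supp (F : seq (H * H)) : seq H := flatten [seq [:: q.1; q.2] | q <- F].

Lemma mem_supp F (q : H * H) : q \in F -> q.1 \in supp F /\ q.2 \in supp F.
Proof.
by move=> qF; split; apply/flattenP; exists [:: q.1; q.2];
  rewrite ?map_f ?inE ?eqxx ?orbT.
Qed.

Lemma size_supp F : size (supp F) = (2 * size F)%N.
Proof. by elim: F => //= q F ->; rewrite mulnS. Qed.

Definition avoid (S : {set I}) : {set {perm H}} :=
  [set m in fpf H | [forall j in S, ~~ holds m (ev j)]].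

Lemma in_avoid S m :
  (m \in avoid S) = (m \in fpf H) && [forall j in S, ~~ holds m (ev j)].
Proof. by rewrite in_set. Qed.

(** The inverse of the probability that [r] given disjoint pairs all belong to a uniform
    matching. *)
Fixpoint den (r : nat) : nat := if r is r'.+1 then ((#|H| - 1 - 2 * r') * den r')%N else 1%N.

(* Conjugation by the transposition of [v] and [x] moves the partner of [u]
   from [v] to [x] without creating any event whose support avoids [u] and [v]. *)
Lemma negative_correlation (F : seq (H * H)) (S : {set I}) :
  uniq (supp F) ->
  (forall j, j \in S -> ~~ has (mem (supp F)) (supp (ev j))) ->
  (#|[set m in avoid S | holds m F]| * den (size F) <= #|avoid S|)%N.
Proof.
elim: F => [|[u v] F IH] /=.
  by move=> _ _; rewrite muln1; apply: subset_leq_card; apply/subsetP => m;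
     rewrite inE => /andP[].
rewrite inE negb_or => /and3P[/andP[uv uF] vF FU] Sd.
have {}IH : (#|[set m in avoid S | holds m F]| * den (size F) <= #|avoid S|)%N.
  apply: IH => // j /Sd; apply: contra => /hasP[h hj hF]; apply/hasP; exists h => //.
  by rewrite /= !inE; move: hF => /= ->; rewrite !orbT.
rewrite mulnA; apply: leq_trans IH; rewrite leq_mul2r; apply/orP; right.
(* The sets [B x] are disjoint, and conjugation embeds [B v] in every [B x] with [x] in [X]; this
   yields the new factor of [den]. *)
pose B x := [set m in avoid S | holds m F && (m u == x)].
pose X : {set H} := [set x | (x != u) && (x \notin supp F)].
have cX : (#|H| - 1 - 2 * size F <= #|X|)%N.
  have -> : X = ~: [set x in u :: supp F] by apply/setP => x; rewrite !inE negb_or.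
  rewrite cardsCs setCK -subnDA leq_sub2l // cardsE.
  by apply: leq_trans (card_size _) _; rewrite /= size_supp add1n.
apply: leq_trans (_ : \sum_(x in X) #|B x| <= _)%N; last first.
  rewrite [X in (_ <= X)%N](_ : _ = \sum_x #|B x|)%N; last first.
    rewrite -sum1_card (partition_big (fun m : {perm H} => m u) xpredT) //=.
    apply: eq_bigr => x _; rewrite -sum1_card; apply: eq_bigl => m.
    by rewrite !inE !andbA.
  by rewrite [X in (_ <= X)%N](bigID (mem X)) /= leq_addr.
rewrite mulnC; apply: leq_trans (leq_mul cX (leqnn _)) _; rewrite -sum_nat_const.
apply: leq_sum => x; rewrite inE => /andP[xu xF].
rewrite -(card_imset _ (conjg_inj (tperm v x))).
apply/subset_leq_card/subsetP => m' /imsetP[m]; rewrite inE => /andP[mA].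
case/andP => /= /eqP muv mF ->.
move: mA; rewrite inE => /andP[mP /forall_inP mS].
have uE : tperm v x u = u by rewrite tpermD // eq_sym.
have mv : m v = u by rewrite -muv fpfK.
have pairE a b : a != u -> a != v -> b != u -> b != v ->
    (m ^ tperm v x)%g a = b -> m a = b.
  move=> au av bu bv; rewrite conj_tpermE.
  have [->|ax] := eqVneq a x.
    by rewrite tpermR mv uE => ub; rewrite ub eqxx in bu.
  rewrite (tpermD (z := a)) 1?eq_sym // => E.
  move: (congr1 (tperm v x) E); rewrite tpermK.
  have [->|bx] := eqVneq b x.
    by rewrite tpermR -muv => /perm_inj au'; rewrite au' eqxx in au.
  by rewrite tpermD // eq_sym.
rewrite [_ \in B x]inE in_avoid -andbA.
apply/and4P; split; first exact: fpf_conj.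
- apply/forall_inP => j jS; apply: contra (mS j jS) => /allP hj; apply/allP => -[a b] ab /=.
  have [aj bj] := mem_supp ab; apply/eqP; have /= /eqP := hj _ ab.
  have nuv h : h \in supp (ev j) -> (h != u) && (h != v).
    move=> hj'; have := Sd _ jS; move/hasPn/(_ _ hj'); rewrite /= !inE !negb_or.
    by case/and3P => -> ->.
  have /andP[??] := nuv _ aj; have /andP[??] := nuv _ bj; exact: pairE.
- apply/allP => -[a b] ab; have [aF bF] /= := mem_supp ab.
  have /= /eqP mab := allP mF _ ab; rewrite conj_tpermE.
  have nd h : h \in supp F -> tperm v x h = h.
    by move=> hF; apply: tpermD; apply: contraTneq hF => <-.
  by rewrite (nd a) // mab nd.
- by rewrite conj_tpermE uE muv tpermL.
Qed.

Definition qw (j : I) : R := (den (size (ev j)))%:R^-1.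
Definition conf (i j : I) : bool := has (mem (supp (ev i))) (supp (ev j)).

Variable E0 : {set I}.
Hypothesis ev_uniq : forall j, j \in E0 -> uniq (supp (ev j)).
Hypothesis den_gt0 : forall j, j \in E0 -> (0 < den (size (ev j)))%N.
Hypothesis conf_small : forall i, i \in E0 ->
  \sum_(j in E0 | conf i j) qw j <= 4^-1.

Lemma avoidU (S : {set I}) j : j \in S ->
  (#|avoid (S :\ j)| = #|avoid S| + #|[set m in avoid (S :\ j) | holds m (ev j)]|)%N.
Proof.
move=> jS; rewrite -(cardsID [set m | holds m (ev j)] (avoid (S :\ j))) addnC.
congr (_ + _)%N; apply: eq_card => m; last by rewrite in_setI !in_set.
rewrite in_setD !in_avoid in_set andbCA; congr (_ && _).
apply/andP/forall_inP => [[mj /forall_inP mS] i iS|mS].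
  by have [->//|ij] := eqVneq i j; apply: mS; rewrite !inE ij.
split; first exact: mS.
by apply/forall_inP => i; rewrite !inE => /andP[_]; apply: mS.
Qed.

Lemma avoidS (S S' : {set I}) : S \subset S' -> avoid S' \subset avoid S.
Proof.
move=> SS; apply/subsetP => m; rewrite !inE => /andP[-> /forall_inP mS] /=.
by apply/forall_inP => j jS; apply: mS; apply: (subsetP SS).
Qed.

Lemma qw_ge0 j : 0 <= qw j. Proof. by rewrite invr_ge0. Qed.

(** The usual induction on [#|S|]: events of [S2], not in conflict with [i], are handled by
    [negative_correlation], and adding back the conflicting ones [S1] at most halves the number of
    matchings, whence the factor 2. *)
Lemma local_lemma_cond (S : {set I}) i : S \subset E0 -> i \in E0 ->
  #|[set m in avoid S | holds m (ev i)]|%:R <= 2 * qw i * #|avoid S|%:R.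
Proof.
have [k] := ubnP #|S|; elim: k S i => // k IH S i Sk SE iE.
pose S1 := [set j in S | conf i j]; pose S2 := S :\: S1.
have S2S : S2 \subset S by apply: subsetDl.
have S2E : S2 \subset E0 by apply: subset_trans SE.
have nc : #|[set m in avoid S2 | holds m (ev i)]|%:R <= qw i * #|avoid S2|%:R.
  rewrite /qw mulrC ler_pdivlMr ?ltr0n ?den_gt0 // -natrM ler_nat.
  apply: negative_correlation; first exact: ev_uniq.
  by move=> j; rewrite !inE => /andP[+ jS]; rewrite jS.
have sub : #|[set m in avoid S | holds m (ev i)]|%:R
    <= #|[set m in avoid S2 | holds m (ev i)]|%:R :> R.
  rewrite ler_nat; apply/subset_leq_card/subsetP => m.
  rewrite inE => /andP[mS mi]; rewrite inE mi andbT.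
  by apply: (subsetP _ _ mS); apply: avoidS.
apply: le_trans sub _; apply: le_trans nc _.
rewrite [2 * _]mulrC -mulrA ler_wpM2l ?qw_ge0 //.
have [S10|S1n] := eqVneq S1 set0.
  have -> : S2 = S by rewrite /S2 S10 setD0.
  have := ler0n R #|avoid S|; lra.
have S2k : (#|S2| < k)%N.
  rewrite -ltnS; apply: leq_trans Sk; rewrite ltnS; apply: proper_card.
  rewrite properE S2S; case/set0Pn: S1n => j jS1; apply/subsetPn; exists j.
    by move: jS1; rewrite inE => /andP[].
  by rewrite in_setD jS1.
have split : (#|avoid S2| <= #|avoid S| +
    \sum_(j in S1) #|[set m in avoid S2 | holds m (ev j)]|)%N.
  apply: leq_trans (_ : #|avoid S :|: \bigcup_(j in S1) [set m in avoid S2 | holds m (ev j)]| <= _)%N.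
    apply/subset_leq_card/subsetP => m mS2; rewrite inE.
    case mS: (m \in avoid S) => //=; apply/bigcupP.
    move: mS; rewrite inE; have := mS2; rewrite inE => /andP[-> /forall_inP mS2'] /=.
    move/negbT/forallPn => [j]; rewrite negb_imply negbK => /andP[jS hj].
    exists j; last by rewrite inE mS2.
    by apply: contraLR hj => jS1; apply: mS2'; rewrite in_setD jS1.
  apply: leq_trans (leq_card_setU _ _) _; rewrite leq_add2l.
  elim/big_rec2: _ => [|j n B _ IHj]; first by rewrite cards0.
  by apply: leq_trans (leq_card_setU _ _) _; rewrite leq_add2l.
(* The induction hypothesis for [S2] costs [2 * qw j] per conflicting event, in total at most
   [2 * 4^-1]. *)
have : \sum_(j in S1) #|[set m in avoid S2 | holds m (ev j)]|%:R
    <= 2^-1 * #|avoid S2|%:R :> R.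
  apply: (@le_trans _ _ (\sum_(j in S1) 2 * qw j * #|avoid S2|%:R)).
    apply: ler_sum => j; rewrite inE => /andP[jS _].
    by apply: IH => //; apply: (subsetP SE).
  rewrite -mulr_suml -mulr_sumr ler_wpM2r //.
  have : \sum_(j in S1) qw j <= 4^-1.
    apply: le_trans (conf_small iE); rewrite big_mkcond [leRHS]big_mkcond /=.
    apply: ler_sum => j _; rewrite !inE; case jS: (j \in S) => /=.
      by rewrite (subsetP SE _ jS).
    by case: ifP => // _; apply: qw_ge0.
  lra.
have : #|avoid S2|%:R <= #|avoid S|%:R +
    \sum_(j in S1) #|[set m in avoid S2 | holds m (ev j)]|%:R :> R.
  by rewrite -natr_sum -natrD ler_nat.
lra.
Qed.

(** Forbidding one more event keeps a fraction at least [1 - 2 * q], and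
    [(1 + 4 * q) * (1 - 2 * q) >= 1] for [0 <= q <= 4^-1]. The product form is suited to a later
    bound by an exponential. *)
Lemma local_lemma (S : {set I}) : S \subset E0 ->
  (forall j, j \in E0 -> qw j <= 4^-1) ->
  #|fpf H|%:R <= (\prod_(j in S) (1 + 4 * qw j)) * #|avoid S|%:R.
Proof.
move=> + q4; have [k] := ubnP #|S|; elim: k S => // k IH S Sk SE.
have [->|/set0Pn[j jS]] := eqVneq S set0.
  rewrite big_set0 mul1r ler_nat; apply/subset_leq_card/subsetP => m mP.
  by rewrite inE mP; apply/forall_inP => j; rewrite inE.
have Sjk : (#|S :\ j| < k)%N by rewrite (cardsD1 j S) jS in Sk.
have SjE : S :\ j \subset E0 by apply: subset_trans SE; apply: subD1set.
apply: le_trans (IH _ Sjk SjE) _.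
rewrite [X in _ <= X * _](big_setD1 j) //= [X in _ <= X * _]mulrC -mulrA ler_wpM2l //.
  by apply: prodr_ge0 => i _; rewrite addr_ge0 // mulr_ge0 // qw_ge0.
have := local_lemma_cond SjE (subsetP SE _ jS).
have E : #|avoid (S :\ j)|%:R = #|avoid S|%:R +
   #|[set m in avoid (S :\ j) | holds m (ev j)]|%:R :> R.
  by rewrite -natrD -avoidU.
move: E; set a := #|avoid (S :\ j)|%:R; set b := #|avoid S|%:R; set h := #|_|%:R.
have q0 := qw_ge0 j; have q1 := q4 _ (subsetP SE _ jS).
have a0 : 0 <= a := ler0n R _; have b0 : 0 <= b := ler0n R _.
move=> E hq; have ab : (1 - 2 * qw j) * a <= b by lra.
have : a <= (1 + 4 * qw j) * ((1 - 2 * qw j) * a).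
  rewrite mulrA -[X in X <= _]mul1r ler_wpM2r //; nra.
move=> H1; apply: le_trans H1 _; rewrite ler_wpM2l //; lra.
Qed.

End LocalLemma.

(** * Loops and double edges as bad events *)

Section Simple.
Variables (H V : finType) (vtx : H -> V).
Variable R : realFieldType.
Local Notation deg := (deg vtx).

Definition simple_m (m : {perm H}) : bool :=
  [forall h, vtx (m h) != vtx h] &&
  [forall h, forall h', (vtx h == vtx h') && (vtx (m h) == vtx (m h')) ==> (h == h')].

Definition bad_ev (j : (H * H) + (H * H) * (H * H)) : seq (H * H) :=
  match j with inl q => [:: q] | inr q => [:: q.1; q.2] end.

Definition bad_set : {set (H * H) + (H * H) * (H * H)} :=
  [set j | match j with
     | inl q => (q.1 != q.2) && (vtx q.1 == vtx q.2)
     | inr q => [&& vtx q.1.1 == vtx q.2.1, vtx q.1.2 == vtx q.2.2 &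
                    uniq [:: q.1.1; q.1.2; q.2.1; q.2.2]] end].

(** A failure of simplicity names its own bad event. Loops are excluded first, which makes the four
    half-edges of a double edge distinct. *)
Lemma avoid_simple m : m \in avoid bad_ev bad_set -> simple_m m.
Proof.
rewrite inE => /andP[mP /forall_inP ma].
have L h : vtx (m h) != vtx h.
  apply/negP => /eqP vE; have := ma (inl (h, m h)).
  by rewrite in_set /= vE !eqxx andbT eq_sym fpf_neq //= => /(_ isT).
apply/andP; split; first by apply/forallP.
apply/forallP => h; apply/forallP => h'; apply/implyP => /andP[/eqP vE /eqP vmE].
apply: contraT => hh'; have := ma (inr ((h, m h), (h', m h'))).
rewrite inE /= vE vmE !eqxx /= !inE !negb_or (inj_eq perm_inj) hh' !andbT /=.
have n1 a : a != m a by rewrite eq_sym fpf_neq.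
have n2 : h != m h' by apply: contraNneq (L h') => <-; rewrite vE.
have n3 : m h != h' by apply: contraNneq (L h) => ->; rewrite vE.
by rewrite !n1 n2 n3 => /(_ isT).
Qed.

Let e (a b : H) : nat := (vtx a == vtx b).
Let Q := (\sum_i (deg i) ^ 2)%N.
Variable Delta : nat.
Hypothesis deg_le : forall i, (deg i <= Delta)%N.

Lemma sum_e a : (\sum_b e a b = deg (vtx a))%N.
Proof.
rewrite /deg -sum1_card [RHS]big_mkcond /=; apply: eq_bigr => b _.
by rewrite inE /e eq_sym; case: eqP.
Qed.

Lemma sum_ee : (\sum_a \sum_b e a b = Q)%N.
Proof.
under eq_bigr do rewrite sum_e.
have := sum_deg vtx xpredT (fun i => deg i : nat); rewrite /= => E.
rewrite [LHS]E; apply: eq_bigr => i _.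
by rewrite -mulr_natr natn -mulnn.
Qed.

Definition qbound : R := (#|H| - 1)%:R^-1 * (Q%:R + (Q ^ 2)%:R * (#|H| - 3)%:R^-1).

Let q1 : R := (#|H| - 1)%:R^-1.
Let q2 : R := (#|H| - 1)%:R^-1 * (#|H| - 3)%:R^-1.

Lemma qwE j : qw bad_ev R j = if j is inl _ then q1 else q2.
Proof.
rewrite /qw /q1 /q2; case: j => [q|q] /=; rewrite !muln1 !muln0 !subn0 //.
by rewrite natrM invfM mulrC -subnDA.
Qed.

(** [Q] counts ordered pairs of half-edges at a common vertex: there are at most [Q] potential loops
    and [Q ^ 2] potential double edges. *)
Lemma qw_sum : \sum_(j in bad_set) qw bad_ev R j <= qbound.
Proof.
have q10 : 0 <= q1 by rewrite invr_ge0.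
have q20 : 0 <= q2 by rewrite mulr_ge0 // invr_ge0.
rewrite big_mkcond big_sumType /= /qbound mulrDr; apply: lerD.
  apply: (@le_trans _ _ (\sum_(q : H * H) q1 * (e q.1 q.2)%:R)).
    apply: ler_sum => -[a b] _; rewrite in_set /= qwE /e.
    by case: (a == b) => /=; case: eqP; rewrite ?mulr1 ?mulr0.
  rewrite -mulr_sumr ler_wpM2l // -natr_sum ler_nat -sum_ee.
  by rewrite (pair_bigA _ e).
rewrite mulrCA -/q2 mulrC expnS expn1 natrM -{1}sum_ee.
apply: (@le_trans _ _ (\sum_(j : (H * H) * (H * H)) q2 * (e j.1.1 j.2.1 * e j.1.2 j.2.2)%:R)).
  apply: ler_sum => -[[a b] [a' b']] _; rewrite inE qwE /= /e.
  case: (vtx a == _) => /=; last by rewrite mul0n mulr0.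
  by case: (vtx b == _) => /=; rewrite ?mulr0 //; case: ifP; rewrite ?mulr1.
rewrite -mulr_sumr ler_wpM2l // -natr_sum -natrM ler_nat.
rewrite -sum_ee [X in (_ <= X)%N]big_distrl /= .
rewrite -(pair_bigA _ (fun x y : H * H => e x.1 y.1 * e x.2 y.2)%N) /=.
rewrite -(pair_bigA _ (fun a b => \sum_(y : H * H) e a y.1 * e b y.2)%N) /=.
apply: leq_sum => a _; rewrite big_distrr /=; apply: leq_sum => b _.
rewrite -(pair_bigA _ (fun a' b' => e a a' * e b b')%N) /=.
rewrite big_distrl /=; apply: leq_sum => a' _.
by rewrite big_distrr.
Qed.

(** The leading 4 is the largest number of half-edges in the support of an event; the other factor
    is the bound of [touch_sum]. *)
Definition confbound : R :=
  4 * ((2 * Delta)%:R * q1 + (4 * Delta * Q)%:R * q2).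

(** The half-edge [h] occupies one of two places in a loop, or of four in a double edge. The
    half-edge sharing its vertex has at most [Delta] choices, and the remaining pair of a double
    edge has [Q]. *)
Lemma touch_sum h : \sum_(j in bad_set | h \in supp (bad_ev j)) qw bad_ev R j
  <= (2 * Delta)%:R * q1 + (4 * Delta * Q)%:R * q2.
Proof.
have q10 : 0 <= q1 by rewrite invr_ge0.
have q20 : 0 <= q2 by rewrite mulr_ge0 // invr_ge0.
have le1 (q : R) (k : nat) (b : bool) : 0 <= q -> (b -> (0 < k)%N) ->
    (if b then q else 0) <= k%:R * q.
  move=> q0; case: b => [/(_ isT) k0|_]; last by rewrite mulr_ge0.
  by rewrite -[leLHS]mul1r ler_wpM2r // ler1n.
rewrite big_mkcond big_sumType /=; apply: lerD.
  apply: (@le_trans _ _ (\sum_(q : H * H)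
     (((q.1 == h) + (q.2 == h)) * e q.1 q.2)%:R * q1)).
    apply: ler_sum => -[a b] _; rewrite qwE in_set /=; apply: le1 => //.
    rewrite !inE ![h == _]eq_sym /e => /andP[/andP[_ ->] /orP[]->] //.
    by rewrite addn1.
  rewrite -mulr_suml ler_wpM2r // -natr_sum ler_nat.
  rewrite -(pair_bigA _ (fun a b => ((a == h) + (b == h)) * e a b)%N) /=.
  under eq_bigr do under eq_bigr do rewrite mulnDl.
  under eq_bigr do rewrite big_split /=.
  rewrite big_split /= mul2n -addnn; apply: leq_add.
    rewrite (bigD1 h) //= [X in (_ + X)%N]big1 ?addn0.
      by under eq_bigr do rewrite eqxx mul1n; rewrite sum_e.
    by move=> a /negPf ->; rewrite big1.
  rewrite exchange_big (bigD1 h) //= [X in (_ + X)%N]big1 ?addn0.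
    under eq_bigr do rewrite eqxx mul1n.
    by under eq_bigr do rewrite /e eq_sym; rewrite sum_e.
  by move=> a /negPf ->; rewrite big1.
apply: (@le_trans _ _ (\sum_(q : (H * H) * (H * H))
     (((q.1.1 == h) + (q.1.2 == h) + (q.2.1 == h) + (q.2.2 == h)) *
       (e q.1.1 q.2.1 * e q.1.2 q.2.2))%:R * q2)).
  apply: ler_sum => -[[a b] [a' b']] _; rewrite qwE in_set /=; apply: le1 => //.
  rewrite /e => /andP[/and3P[-> -> _]]; rewrite !inE ![h == _]eq_sym !muln1.
  by case/or4P => ->; rewrite ?addn1 ?addnS.
rewrite -mulr_suml ler_wpM2r // -natr_sum ler_nat.
have key (f : H -> H -> H -> H -> nat) :
  (\sum_(q : (H * H) * (H * H)) f q.1.1 q.1.2 q.2.1 q.2.2 =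
   \sum_a \sum_b \sum_a' \sum_b' f a b a' b')%N.
  rewrite -(pair_bigA _ (fun x y : H * H => f x.1 x.2 y.1 y.2)) /=.
  rewrite -(pair_bigA _ (fun a b => \sum_(y : H * H) f a b y.1 y.2)%N) /=.
  apply: eq_bigr => a _; apply: eq_bigr => b _.
  by rewrite -(pair_bigA _ (fun a' b' => f a b a' b')).
pose f a b a' b' := (((a == h) + (b == h) + (a' == h) + (b' == h)) *
       (e a a' * e b b'))%N.
rewrite (key f) /f.
have eC a b : e a b = e b a by rewrite /e eq_sym.
have one (g : H -> nat) : (\sum_a (a == h) * g a = g h)%N.
  rewrite (bigD1 h) //= eqxx mul1n big1 ?addn0 // => a /negPf ->.
  by rewrite mul0n.
have P1 : (\sum_a \sum_b \sum_a' \sum_b' (a == h) * (e a a' * e b b') <= Delta * Q)%N.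
  under eq_bigr => a _ do under eq_bigr => b _ do under eq_bigr => a' _ do
    rewrite -big_distrr -big_distrr sum_e /=.
  under eq_bigr => a _ do under eq_bigr => b _ do
    rewrite -big_distrr -big_distrl sum_e /=.
  under eq_bigr => a _ do rewrite -big_distrr -big_distrr /=.
  rewrite one -sum_ee; under [in leqRHS]eq_bigr do rewrite sum_e.
  by rewrite leq_mul2r deg_le orbT.
(* The other places of [h] reduce to the first by exchanging the two ends of the edges, or the two
   edges. *)
have P2 : (\sum_a \sum_b \sum_a' \sum_b' (b == h) * (e a a' * e b b') <= Delta * Q)%N.
  apply: leq_trans P1; rewrite exchange_big /=; apply: eq_leq.
  apply: eq_bigr => a _; apply: eq_bigr => b _; rewrite exchange_big /=.
  by apply: eq_bigr => a' _; apply: eq_bigr => b' _; rewrite [(e b b' * _)%N]mulnC.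
have P3 : (\sum_a \sum_b \sum_a' \sum_b' (a' == h) * (e a a' * e b b') <= Delta * Q)%N.
  apply: leq_trans P1; apply: eq_leq.
  under eq_bigr => a _ do rewrite exchange_big /=; rewrite exchange_big /=.
  under [in RHS]eq_bigr => a _ do rewrite exchange_big /=.
  apply: eq_bigr => a _; apply: eq_bigr => a' _; apply: eq_bigr => b _.
  by apply: eq_bigr => b' _; rewrite eC.
have P4 : (\sum_a \sum_b \sum_a' \sum_b' (b' == h) * (e a a' * e b b') <= Delta * Q)%N.
  apply: leq_trans P2; apply: eq_leq.
  apply: eq_bigr => a _.
  under eq_bigr => b _ do rewrite exchange_big /=; rewrite exchange_big /=.
  under [in RHS]eq_bigr => b _ do rewrite exchange_big /=.
  apply: eq_bigr => b _; apply: eq_bigr => b' _; apply: eq_bigr => a' _.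
  by rewrite [e b b']eC.
under eq_bigr do under eq_bigr do under eq_bigr do under eq_bigr do rewrite !mulnDl.
under eq_bigr do under eq_bigr do under eq_bigr do rewrite !big_split /=.
under eq_bigr do under eq_bigr do rewrite !big_split /=.
under eq_bigr do rewrite !big_split /=.
rewrite !big_split /= -mulnA; lia.
Qed.

Lemma simple_bound : (4 <= #|H|)%N -> confbound <= 4^-1 ->
  exists2 P : R, P = \prod_(j in bad_set) (1 + 4 * qw bad_ev R j) &
  #|fpf H|%:R <= P * #|[set m in fpf H | simple_m m]|%:R.
Proof.
move=> H4 cb; eexists; first reflexivity.
have q10 : 0 <= q1 by rewrite invr_ge0.
have q20 : 0 <= q2 by rewrite mulr_ge0 // invr_ge0.
have q0 j : 0 <= qw bad_ev R j by rewrite invr_ge0.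
have cs i : i \in bad_set ->
    \sum_(j in bad_set | conf bad_ev i j) qw bad_ev R j <= 4^-1.
  move=> iB; apply: le_trans cb.
  apply: (@le_trans _ _ (\sum_(h <- supp (bad_ev i))
     \sum_(j in bad_set | h \in supp (bad_ev j)) qw bad_ev R j)).
    under [leRHS]eq_bigr do rewrite big_mkcondr.
    rewrite big_mkcondr [leRHS]exchange_big /=; apply: ler_sum => j _.
    case: ifPn => [/hasP[h hj hi]|_]; last by apply: sumr_ge0 => h _; case: ifP.
    rewrite (big_rem h) //= hj lerDl; apply: sumr_ge0 => h' _.
    by case: ifP.
  apply: le_trans (ler_sum _ (fun h _ => touch_sum h)) _.
  rewrite big_const_seq count_predT iter_addr_0 /confbound [leRHS]mulr_natl.
  set B0 := (_ + _); have B00 : 0 <= B0 by apply: addr_ge0; apply: mulr_ge0.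
  have s4 : (size (supp (bad_ev i)) <= 4)%N by rewrite size_supp; case: (i).
  exact: (ler_wpMn2l B00 s4).
have den0 j : j \in bad_set -> (0 < den H (size (bad_ev j)))%N.
  move=> _; rewrite /den; move: #|H| H4 => N N4.
  by case: j => q /=; rewrite !muln_gt0 -!subnDA !subn_gt0 ?(leq_trans _ N4).
have uq j : j \in bad_set -> uniq (supp (bad_ev j)).
  case: j => q; rewrite in_set /=; last by case/and3P.
  by case/andP => q12 _; rewrite inE q12.
have q4 j : j \in bad_set -> qw bad_ev R j <= 4^-1.
  move=> jB; apply: le_trans (cs j jB); rewrite (bigD1 j) /=.
    by rewrite lerDl; apply: sumr_ge0.
  rewrite jB; apply/hasP; case: (j) => -[a b]; [exists a|exists a.1] => //;
  by rewrite /= !inE eqxx.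
apply: le_trans (local_lemma uq den0 cs (subxx _) q4) _.
rewrite ler_wpM2l ?prodr_ge0 // => [j _|]; first by rewrite addr_ge0 ?mulr_ge0.
rewrite ler_nat; apply/subset_leq_card/subsetP => m mA.
by rewrite inE (avoid_simple mA) andbT; move: mA; rewrite inE => /andP[].
Qed.

End Simple.

(** * Deterministic analysis of the exploration *)

Ltac nonneg := by repeat first
  [ done | apply: addr_ge0 | apply: mulr_ge0 | rewrite invr_ge0 | apply: exprn_ge0 ].

Section Fluid.
Variables (R : realFieldType) (n N a al lam Th eps : R) (T : nat).
Hypothesis n_gt0 : 0 < n.
Hypothesis aE : a = n * al.
Hypothesis al_gt0 : 0 < al.
Hypothesis al_eps : al <= eps.
Hypothesis eps_le1 : eps <= 1.
(** A single restart or a rounding is negligible on the scale [a * al] of the walk. *)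
Hypothesis one_le : 1 <= eps * (a * al).
Hypothesis lam_gt0 : 0 < lam.
Hypothesis N_approx : `|N - lam * n| <= eps * n.
Hypothesis Th_ge0 : 0 <= Th.
Hypothesis T_le : T%:R <= Th * a.
Hypothesis eps_small : (1 + 2 * Th) * eps <= lam / 2.

(** The number of candidates at step [s]: [2 * s] half-edges are matched and one is waiting for its
    partner. *)
Let den (s : nat) : R := N - (2 * s + 1)%:R.

Let eps_gt0 : 0 < eps. Proof. exact: lt_le_trans al_eps. Qed.
Let a_gt0 : 0 < a. Proof. by rewrite aE mulr_gt0. Qed.
Let lamn_gt0 : 0 < lam * n. Proof. by rewrite mulr_gt0. Qed.

Let n_ge0 : 0 <= n := ltW n_gt0.
Let lam_ge0 : 0 <= lam := ltW lam_gt0.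
Let al_ge0 : 0 <= al := ltW al_gt0.
Let eps_ge0 : 0 <= eps := ltW eps_gt0.
Let a_ge0 : 0 <= a := ltW a_gt0.
Let lamn_ge0 : 0 <= lam * n := ltW lamn_gt0.

Lemma a_le : a <= eps * n.
Proof. by rewrite aE mulrC ler_wpM2r //. Qed.

Lemma aal_le : a * al <= eps * a.
Proof. by rewrite mulrC ler_wpM2r //. Qed.

Lemma one_le_a : 1 <= eps * a.
Proof.
apply: le_trans one_le _; rewrite ler_wpM2l //.
by rewrite ler_piMr // (le_trans al_eps).
Qed.

Lemma den_approx s : (s < T)%N -> `|den s - lam * n| <= (1 + 2 * Th) * eps * n.
Proof.
move=> sT; have h1 : (2 * s + 1)%:R <= 2 * T%:R :> R.
  by rewrite -natrM ler_nat addn1 ltn_mul2l.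
have h2 : 2 * T%:R <= 2 * Th * eps * n.
  have := a_le; have := ler_wpM2l Th_ge0 a_le; have := T_le; lra.
have h0 : 0 <= (2 * s + 1)%:R :> R by [].
have := N_approx; rewrite /den !ler_norml => /andP[h3 h4].
apply/andP; split; lra.
Qed.

Lemma den_ge s : (s < T)%N -> lam * n / 2 <= den s.
Proof.
move=> /den_approx; rewrite ler_norml => /andP[h _].
have : (1 + 2 * Th) * eps * n <= lam / 2 * n by rewrite ler_wpM2r //.
lra.
Qed.

Lemma den_gt0 s : (s < T)%N -> 0 < den s.
Proof. by move=> /den_ge; apply: lt_le_trans; rewrite divr_gt0. Qed.

Lemma den_ge0 s : (s < T)%N -> 0 <= den s.
Proof. by move=> /den_gt0/ltW. Qed.

Lemma den_inv s : (s < T)%N -> (den s)^-1 <= 2 / lam / n.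
Proof.
move=> sT; have -> : 2 / lam / n = (lam * n / 2)^-1.
  by field; rewrite !gt_eqF.
by rewrite lef_pV2 ?posrE ?den_gt0 ?den_ge // divr_gt0.
Qed.

Lemma den_inv_diff s : (s < T)%N ->
  `|(den s)^-1 - (lam * n)^-1| <= 2 * (1 + 2 * Th) / lam ^+ 2 * eps / n.
Proof.
move=> sT; have d0 := den_gt0 sT.
have -> : (den s)^-1 - (lam * n)^-1 = (lam * n - den s) * ((den s)^-1 * (lam * n)^-1).
  by field; rewrite !gt_eqF.
rewrite normrM distrC [X in _ * X]ger0_norm; last by rewrite mulr_ge0 ?invr_ge0 ?den_ge0.
apply: (@le_trans _ _ ((1 + 2 * Th) * eps * n * (2 / lam / n * (lam * n)^-1))).
  apply: ler_pM => //; first by rewrite mulr_ge0 ?invr_ge0 ?den_ge0.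
    exact: den_approx.
  by apply: ler_wpM2r; rewrite ?invr_ge0 // den_inv.
have -> : (1 + 2 * Th) * eps * n * (2 / lam / n * (lam * n)^-1) =
  2 * (1 + 2 * Th) / lam ^+ 2 * eps / n by field; rewrite !gt_eqF.
by [].
Qed.

Lemma sum_bound (t : nat) (G : nat -> R) (B : R) : (t <= T)%N -> 0 <= B ->
  (forall s, (s < t)%N -> `|G s| <= B) -> `|\sum_(s < t) G s| <= Th * a * B.
Proof.
move=> tT B0 GB; apply: le_trans (ler_norm_sum _ _ _) _.
apply: (@le_trans _ _ (\sum_(s < t) B)); first by apply: ler_sum => s _; apply: GB.
rewrite sumr_const card_ord -mulr_natl ler_wpM2r //; apply: le_trans T_le.
by rewrite ler_nat.
Qed.

Definition drift_const (r cx : R) : R :=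
  1 + Th * (2 / lam) * (1 + cx + r * (1 + 2 * Th)).

(** As long as the weight [X s] already used is small compared with [n], the mean gain per step
    stays close to [L / (lam * n)], hence to [r], and the sum grows linearly. *)
Lemma drift_approx (L r cx : R) (X Y : nat -> R) : 0 <= r -> 0 <= cx ->
  `|L - r * (lam * n)| <= eps * n ->
  (forall s, (s < T)%N -> 0 <= X s <= cx * eps * n) ->
  (forall t, (t <= T)%N -> `|Y t - \sum_(s < t) (L - X s) / den s| <= eps * a) ->
  forall t, (t <= T)%N -> `|Y t - r * t%:R| <= drift_const r cx * (eps * a).
Proof.
move=> r0 cx0 LP XP YP t tT.
have h s : (s < t)%N -> `|(L - X s) / den s - r| <=
    (2 / lam) * (1 + cx + r * (1 + 2 * Th)) * eps.
  move=> st; have sT : (s < T)%N by apply: leq_trans tT.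
  have d0 := den_gt0 sT.
  have -> : (L - X s) / den s - r = (L - X s - r * den s) / den s.
    by field; rewrite gt_eqF.
  rewrite normrM [X in _ * X]ger0_norm ?invr_ge0 ?den_ge0 //.
  have -> : 2 / lam * (1 + cx + r * (1 + 2 * Th)) * eps =
     (1 + cx + r * (1 + 2 * Th)) * eps * n * (2 / lam / n).
    by field; rewrite !gt_eqF.
  apply: ler_pM => //; rewrite ?invr_ge0 ?den_ge0 //; last exact: den_inv.
  have /andP[x0 x1] := XP _ sT; have := den_approx sT.
  have -> : L - X s - r * den s = (L - r * (lam * n)) - X s - r * (den s - lam * n).
    by ring.
  move=> dd; apply: le_trans (ler_normB _ _) _.
  have : `|L - r * (lam * n) - X s| <= eps * n + cx * eps * n.
    by apply: le_trans (ler_normB _ _) _; rewrite (ger0_norm x0); lra.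
  rewrite normrM (ger0_norm r0); have := ler_wpM2l r0 dd; lra.
have -> : Y t - r * t%:R = (Y t - \sum_(s < t) (L - X s) / den s) +
   \sum_(s < t) ((L - X s) / den s - r).
  by rewrite sumrB sumr_const card_ord -mulr_natr; lra.
apply: le_trans (ler_normD _ _) _.
have := YP t tT; have := sum_bound tT _ h; set S := `|\sum_(s < t) _|.
set q := 2 / lam * (1 + cx + r * (1 + 2 * Th)).
have q0 : 0 <= q.
  by rewrite mulr_ge0 ?divr_ge0 ?addr_ge0 ?mulr_ge0 ?addr_ge0 ?mulr_ge0 //.
move=> /(_ (mulr_ge0 q0 (ltW eps_gt0))).
have -> : drift_const r cx = 1 + Th * q by rewrite /drift_const /q; ring.
lra.
Qed.

(** * The walk of active half-edges and its parabola *)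

Section Walk.
Variables (rho C1 : R) (Yd Yd2 K A : nat -> R).
Hypothesis rho_ge : 4 <= rho.
Hypothesis C1_ge0 : 0 <= C1.
Hypothesis Yd2_approx : forall t, (t <= T)%N -> `|Yd2 t - rho * t%:R| <= C1 * (eps * a).
Hypothesis Yd_approx : forall t, (t <= T)%N ->
  `|Yd t - \sum_(s < t) (2 * N + a - Yd2 s - K s.+1) / den s| <= eps * (a * al).
Hypothesis AE : forall t, A t = Yd t + K t - 2 * t%:R.
Hypothesis A_ge0 : forall t, (t <= T)%N -> 0 <= A t.
Hypothesis K0 : K 0%N = 0.
Hypothesis KS : forall t, (t < T)%N -> K t.+1 = K t + (A t == 0)%:R.

(** With [rho] the limiting ratio of the third moment to the first, this is [beta / lambda] at
    criticality. *)
Let kap := rho - 4.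
Let kap_ge0 : 0 <= kap. Proof. by rewrite subr_ge0. Qed.
Let W t := Yd t - 2 * t%:R.
(** The drift of [W]: the mean degree gained minus 2, reduced to the denominator [den s], where
    [2 * den s] contributes [4 * s + 2]. *)
Let g s := (a - Yd2 s - K s.+1 + 4 * s%:R + 2) / den s.

Lemma K_ge0 t : (t <= T)%N -> 0 <= K t.
Proof.
elim: t => [|t IH] tT; first by rewrite K0.
by rewrite KS // addr_ge0 // IH // ltnW.
Qed.

Lemma W_approx t : (t <= T)%N -> `|W t - \sum_(s < t) g s| <= eps * (a * al).
Proof.
move=> tT; apply: le_trans (Yd_approx tT); rewrite le_eqVlt; apply/orP; left.
apply/eqP; congr `|_|; suff -> : \sum_(s < t) (2 * N + a - Yd2 s - K s.+1) / den s =
  \sum_(s < t) g s + 2 * t%:R by rewrite /W; ring.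
have -> : 2 * t%:R = \sum_(s < t) (2 : R).
  by rewrite sumr_const card_ord mulr_natr.
rewrite -big_split; apply: eq_bigr => s _ /=.
have sT : (s < T)%N by apply: leq_trans tT.
have d0 : den s != 0 by rewrite gt_eqF // den_gt0.
rewrite /g; apply: (mulIf d0); rewrite divfK // [RHS]mulrDl divfK // /den natrD natrM; ring.
Qed.

Definition crude_const : R := 1 + Th * ((4 + C1 + kap * Th) * (2 / lam)).

Lemma W_crude t : (t <= T)%N -> (forall s, (s < t)%N -> K s.+1 <= a) ->
  `|W t| <= crude_const * (a * al).
Proof.
move=> tT Ka.
have h s : (s < t)%N -> `|g s| <= (4 + C1 + kap * Th) * (2 / lam) * al.
  move=> st; have sT : (s < T)%N by apply: leq_trans tT.
  rewrite /g normrM [X in _ * X]ger0_norm ?invr_ge0 ?den_ge0 //.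
  have -> : (4 + C1 + kap * Th) * (2 / lam) * al =
     (4 + C1 + kap * Th) * a * (2 / lam / n).
    by rewrite aE; field; rewrite !gt_eqF.
  apply: ler_pM => //; rewrite ?invr_ge0 ?den_ge0 //; last exact: den_inv.
  have := Yd2_approx (ltnW sT); have := Ka s st; have := K_ge0 sT.
  have s_le : s%:R <= Th * a by apply: le_trans T_le; rewrite ler_nat ltnW.
  have k1 : kap * s%:R <= kap * (Th * a) by rewrite ler_wpM2l.
  have k2 : 0 <= kap * s%:R by rewrite mulr_ge0.
  have e1 : eps * a <= a by rewrite ler_piMl //.
  have c1 : C1 * (eps * a) <= C1 * a by rewrite ler_wpM2l.
  have o1 := one_le_a.
  move: k1 k2; rewrite /kap => k1 k2.
  rewrite !ler_norml => ?? /andP[? ?]; apply/andP; split; lra.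
have B0 : 0 <= (4 + C1 + kap * Th) * (2 / lam) * al.
  by rewrite !mulr_ge0 ?addr_ge0 ?mulr_ge0 ?invr_ge0 //.
have := sum_bound tT B0 h; have := W_approx tT.
have : eps * (a * al) <= a * al by rewrite ler_piMl // mulr_ge0 //.
rewrite /crude_const.
have -> : W t = (W t - \sum_(s < t) g s) + \sum_(s < t) g s by ring.
move=> h1 h2 h3; apply: le_trans (ler_normD _ _) _.
rewrite subrK in h2 *.
move: h1 h2 h3; set x := `|_ - _|; set y := `|\sum_(s < t) _|.
set z := (4 + C1 + kap * Th) * (2 / lam); lra.
Qed.

Hypothesis eps_crude : (1 + crude_const) * eps <= 1.

Let crude_ge0 : 0 <= crude_const.
Proof.
by rewrite addr_ge0 // !mulr_ge0 ?addr_ge0 ?mulr_ge0 ?invr_ge0 //.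
Qed.

(** The bootstrap. [K] grows only when [A t = 0], and then [K t = - W t] is at most
    [crude_const * (a * al)] by [W_crude]. The premise of [W_crude], that earlier values are at most
    [a], comes from the induction hypothesis and [eps_crude]; the restart itself is absorbed since
    [1 <= a * al]. *)
Lemma K_small t : (t <= T)%N -> K t <= (1 + crude_const) * (a * al).
Proof.
have aal0 : 0 <= a * al by rewrite mulr_ge0 //.
elim/ltn_ind: t => -[|t] IH tT; first by rewrite K0 mulr_ge0 // addr_ge0.
rewrite KS //; case: eqP => At /=; last by rewrite addr0 IH // ltnW.
have Ka s : (s < t)%N -> K s.+1 <= a.
  move=> st; apply: le_trans (IH s.+1 _ _) _ => //.
    by apply: leq_trans tT; apply: leqW.
  have := ler_wpM2l (_ : 0 <= 1 + crude_const) aal_le; rewrite addr_ge0 // => /(_ isT).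
  have := ler_wpM2r (ltW a_gt0) eps_crude; rewrite mul1r; lra.
have := W_crude (ltnW tT) Ka; rewrite ler_norml => /andP[h _].
have := AE t; rewrite At; have o1 := one_le.
have : eps * (a * al) <= a * al by rewrite ler_piMl.
rewrite /W in h; lra.
Qed.

Lemma K_small_eps t : (t <= T)%N -> K t <= (1 + crude_const) * (eps * a).
Proof.
move=> tT; apply: le_trans (K_small tT) _; rewrite ler_wpM2l ?aal_le //.
by rewrite addr_ge0.
Qed.

(** The integral of the limiting drift [(a - kap * t) / (lam * n)]. Its positive root [2 * a / kap]
    predicts the number of edges of the giant. *)
Definition fluid (t : nat) : R := (a * t%:R - kap * t%:R ^+ 2 / 2) / (lam * n).

Definition walk_const : R :=
  1 + Th * ((C1 + crude_const + 3) * (2 / lam)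
           + (1 + kap * Th) * (2 * (1 + 2 * Th) / lam ^+ 2))
    + kap * Th / (2 * lam).

Lemma walk_const_ge0 : 0 <= walk_const.
Proof.
rewrite /walk_const; nonneg.
Qed.

Lemma W_fine t : (t <= T)%N -> `|W t - fluid t| <= walk_const * (eps * (a * al)).
Proof.
move=> tT.
pose B := ((C1 + crude_const + 3) * (2 / lam)
           + (1 + kap * Th) * (2 * (1 + 2 * Th) / lam ^+ 2)) * (eps * al).
have B0 : 0 <= B.
  rewrite /B; nonneg.
have h s : (s < t)%N -> `|g s - (a - kap * s%:R) / (lam * n)| <= B.
  move=> st; have sT : (s < T)%N by apply: leq_trans tT.
  have d0 := den_gt0 sT.
  pose e := a - Yd2 s - K s.+1 + 4 * s%:R + 2 - (a - kap * s%:R).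
  have -> : g s - (a - kap * s%:R) / (lam * n) =
     e / den s + (a - kap * s%:R) * ((den s)^-1 - (lam * n)^-1).
    by rewrite /g /e; ring.
  apply: le_trans (ler_normD _ _) _; rewrite /B [leRHS]mulrDl; apply: lerD.
    rewrite normrM [X in _ * X]ger0_norm ?invr_ge0 ?den_ge0 //.
    have -> : (C1 + crude_const + 3) * (2 / lam) * (eps * al) =
       (C1 + crude_const + 3) * (eps * a) * (2 / lam / n).
      by rewrite aE; field; rewrite !gt_eqF.
    apply: ler_pM => //; rewrite ?invr_ge0 ?den_ge0 //; last exact: den_inv.
    have := Yd2_approx (ltnW sT); have := K_small_eps sT; have := K_ge0 sT.
    have o1 := one_le_a.
    have : 0 <= crude_const * (eps * a) by rewrite mulr_ge0 // (le_trans _ o1).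
    have : 0 <= C1 * (eps * a) by rewrite mulr_ge0 // (le_trans _ o1).
    rewrite /e /kap !ler_norml => ???? /andP[? ?]; apply/andP; split; lra.
  rewrite normrM.
  have -> : (1 + kap * Th) * (2 * (1 + 2 * Th) / lam ^+ 2) * (eps * al) =
     (1 + kap * Th) * a * (2 * (1 + 2 * Th) / lam ^+ 2 * eps / n).
    by rewrite aE; field; rewrite !gt_eqF.
  apply: ler_pM => //; last exact: den_inv_diff.
  have s_le : s%:R <= Th * a by apply: le_trans T_le; rewrite ler_nat ltnW.
  have k1 : kap * s%:R <= kap * (Th * a) by rewrite ler_wpM2l.
  have k2 : 0 <= kap * s%:R by rewrite mulr_ge0.
  have a0 := ltW a_gt0.
  rewrite ler_norml; apply/andP; split; lra.
(* The sum of [s] over [s < t] falls short of [t ^+ 2 / 2] by [t / 2]; this discretization error is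
   bounded in [S2]. *)
have S1 : \sum_(s < t) (a - kap * s%:R) / (lam * n) =
    fluid t + kap * t%:R / 2 / (lam * n).
  rewrite /fluid -mulrDl -mulr_suml; congr (_ / _).
  elim: (t) => [|k IH]; first by rewrite big_ord0; ring.
  by rewrite big_ord_recr /= IH -[k.+1]addn1 natrD; field.
have S2 : `|kap * t%:R / 2 / (lam * n)| <= kap * Th / (2 * lam) * (eps * (a * al)).
  rewrite ger0_norm; last by rewrite !mulr_ge0 ?invr_ge0 ?mulr_ge0 //.
  apply: (@le_trans _ _ (kap * (Th * a) / 2 / (lam * n))).
    do 2 (apply: ler_wpM2r; first by rewrite invr_ge0).
    by apply: ler_wpM2l => //; apply: le_trans T_le; rewrite ler_nat.
  have -> : kap * (Th * a) / 2 / (lam * n) = kap * Th / (2 * lam) * al.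
    by rewrite aE; field; rewrite !gt_eqF.
  rewrite ler_wpM2l ?mulr_ge0 ?invr_ge0 ?mulr_ge0 //.
  by apply: le_trans one_le; apply: le_trans al_eps _.
have -> : W t - fluid t = (W t - \sum_(s < t) g s) +
   \sum_(s < t) (g s - (a - kap * s%:R) / (lam * n)) + kap * t%:R / 2 / (lam * n).
  by rewrite sumrB S1; ring.
apply: le_trans (ler_normD _ _) _.
have := ler_normD (W t - \sum_(s < t) g s)
  (\sum_(s < t) (g s - (a - kap * s%:R) / (lam * n))).
have := sum_bound tT B0 h; have := W_approx tT.
rewrite /walk_const.
have -> : Th * a * B = Th * ((C1 + crude_const + 3) * (2 / lam)
           + (1 + kap * Th) * (2 * (1 + 2 * Th) / lam ^+ 2)) * (eps * (a * al)).
  by rewrite /B; ring.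
move: S2; set x := `|_ + _|; set y := `|W t - _|; set z := `|\sum_(s < t) _|.
set u := `|kap * _ / _ / _|.
set k := _ * (2 / lam) + _; lra.
Qed.

Variables (del : R) (t2 : nat).
Hypothesis kap_gt0 : 0 < rho - 4.
Hypothesis del_gt0 : 0 < del.
Hypothesis t2_le : t2%:R <= (2 / (rho - 4) - del) * a.
Hypothesis t2T : (t2 <= T)%N.
Hypothesis T_ge : (2 / (rho - 4) + del / 2) * a <= T%:R.
Hypothesis eps_del : 2 * lam * ((2 * walk_const + 1) * eps) < del.
Hypothesis eps_del2 : lam * (walk_const * eps) < kap * del ^+ 2 / 2.

Let del_ge0 : 0 <= del := ltW del_gt0.

(** Factor the parabola as [t * (a - kap * t / 2)] and bound each factor below by its distance to
    its root. *)
Lemma fluid_window t : del * a <= t%:R -> t%:R <= (2 / (rho - 4) - del) * a ->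
  kap * del ^+ 2 / 2 / lam * (a * al) <= fluid t.
Proof.
move=> h1 h2; rewrite /fluid.
have -> : kap * del ^+ 2 / 2 / lam * (a * al) = (del * a) * (kap * (del * a) / 2) / (lam * n).
  by rewrite aE; field; rewrite !gt_eqF.
rewrite ler_pM2r ?invr_gt0 //.
have -> : a * t%:R - kap * t%:R ^+ 2 / 2 = t%:R * (a - kap * t%:R / 2).
  by ring.
apply: ler_pM; [nonneg|nonneg|done|].
have : kap * t%:R <= kap * ((2 / (rho - 4) - del) * a) by rewrite ler_wpM2l.
have -> : kap * ((2 / (rho - 4) - del) * a) = 2 * a - kap * (del * a).
  by rewrite /kap; field; rewrite gt_eqF.
lra.
Qed.

Lemma fluid_ge0 t : t%:R <= (2 / (rho - 4) - del) * a -> 0 <= fluid t.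
Proof.
move=> h2; rewrite /fluid divr_ge0 ?(ltW lamn_gt0) //.
have -> : a * t%:R - kap * t%:R ^+ 2 / 2 = t%:R * (a - kap * t%:R / 2).
  by ring.
rewrite mulr_ge0 //.
have : kap * t%:R <= kap * ((2 / (rho - 4) - del) * a) by rewrite ler_wpM2l.
have -> : kap * ((2 / (rho - 4) - del) * a) = 2 * a - kap * (del * a).
  by rewrite /kap; field; rewrite gt_eqF.
have : 0 <= kap * (del * a) by rewrite !mulr_ge0 //.
lra.
Qed.

Lemma active_window t : (t <= T)%N -> del * a <= t%:R ->
  t%:R <= (2 / (rho - 4) - del) * a -> 0 < A t.
Proof.
move=> tT h1 h2; have := fluid_window h1 h2; have := W_fine tT.
have := K_ge0 tT; rewrite AE ler_norml /W => ? /andP[? _].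
have aal : 0 < a * al by rewrite mulr_gt0.
have : walk_const * (eps * (a * al)) < kap * del ^+ 2 / 2 / lam * (a * al).
  by rewrite mulrA ltr_pM2r // ltr_pdivlMr // mulrC.
lra.
Qed.

(** Before [t2] the parabola is nonnegative, so at a zero of [A] the value [K t = - W t] is at most
    the error of [W_fine]. This gains a factor [eps] over [K_small]. *)
Lemma K_early t : (t <= t2)%N -> K t <= 1 + walk_const * (eps * (a * al)).
Proof.
have aal : 0 <= a * al by rewrite mulr_ge0.
have c0 : 0 <= walk_const * (eps * (a * al)).
  by rewrite mulr_ge0 ?walk_const_ge0 // mulr_ge0 //.
elim: t => [|t IH] tt2; first by rewrite K0 addr_ge0.
have tT : (t < T)%N by apply: leq_trans t2T.
rewrite KS //; case: eqP => At /=; last by rewrite addr0 IH // ltnW.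
have t_le : t%:R <= (2 / (rho - 4) - del) * a.
  by apply: le_trans t2_le; rewrite ler_nat ltnW.
have := fluid_ge0 t_le; have := W_fine (ltnW tT); rewrite ler_norml => /andP[h _].
have := AE t; rewrite At /W in h *; lra.
Qed.

(** Without a zero in this range [K] would keep its small value from [t2]; at [T], beyond the root
    of the parabola, [A] would then be negative by [eps_del]. *)
Lemma zero_window : exists t, [/\ (t2 <= t <= T)%N, A t = 0 &
  forall s, (t2 <= s < t)%N -> A s != 0].
Proof.
have [/existsP[t0 /andP[t0t2 /eqP A0]]|] :=
    boolP [exists t : 'I_T.+1, (t2 <= t)%N && (A t == 0)].
  have ex : exists t, (t2 <= t <= T)%N && (A t == 0).
    by exists t0; rewrite t0t2 -ltnS ltn_ord A0 eqxx.
  case: (ex_minnP ex) => t /andP[tP /eqP At] tmin; exists t; split=> // s /andP[s2 st].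
  apply/negP => As; have := tmin s; rewrite As s2 andbT /= => /(_ _).
  have /andP[_ tT] := tP; rewrite (leq_trans (ltnW st) tT) => /(_ isT).
  by rewrite leqNgt st.
move=> /existsPn nz; exfalso.
have KE t : (t2 <= t <= T)%N -> K t = K t2.
  elim: t => [|t IH]; first by rewrite leqn0 => /andP[/eqP -> _].
  case/andP; rewrite leq_eqVlt => /predU1P[-> //|]; rewrite ltnS => t2t tT.
  have := nz (Ordinal (ltnW tT : (t < T.+1)%N)); rewrite /= t2t /= => /negPf An.
  by rewrite KS // An addr0 IH // t2t ltnW.
have := A_ge0 (leqnn T); rewrite AE KE ?t2T ?leqnn //.
have := K_early (leqnn t2); have := W_fine (leqnn T); rewrite ler_norml /W => /andP[_ h1] h2.
suff h3 : fluid T <= - (del / (2 * lam) * (a * al)).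
  have aal : 0 < a * al by rewrite mulr_gt0.
  have h4 : (2 * walk_const + 1) * (eps * (a * al)) < del / (2 * lam) * (a * al).
    by rewrite mulrA ltr_pM2r // ltr_pdivlMr ?mulr_gt0 // mulrC.
  have := one_le; lra.
rewrite /fluid.
have -> : - (del / (2 * lam) * (a * al)) = - ((2 / kap * a) * (kap * (del * a) / 4)) / (lam * n).
  by rewrite aE /kap; field; rewrite !gt_eqF.
rewrite ler_pM2r ?invr_gt0 //.
have -> : a * T%:R - kap * T%:R ^+ 2 / 2 = - (T%:R * (kap * T%:R / 2 - a)) by ring.
rewrite lerN2; apply: ler_pM; [nonneg|nonneg| |].
  by apply: le_trans T_ge; rewrite ler_pM2r // lerDl divr_ge0.
have : kap * ((2 / (rho - 4) + del / 2) * a) <= kap * T%:R by rewrite ler_wpM2l.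
have -> : kap * ((2 / (rho - 4) + del / 2) * a) = 2 * a + kap * (del * a) / 2.
  by rewrite /kap; field; rewrite gt_eqF.
lra.
Qed.

End Walk.
End Fluid.

(** * Typical matchings *)

Section LeafRule.
Variables (H V : finType) (vtx : H -> V) (h0 : H).
Notation deg := (deg vtx).
Notation disc := (disc vtx).
Notation act := (act vtx).

(** Restarting at degree 1 gives each restart the weight [ph 1], whatever [ph] is. The last branches
    only make this a rule for every [C]. *)
Definition leaf_rule (C : {set H}) : H :=
  if [pick h in act C] is Some h then h
  else if [pick h | (h \notin C) && (deg (vtx h) == 1%N)] is Some h then h
  else if [pick h | h \notin C] is Some h then h else h0.

Lemma leaf_rule_notin C : C != setT -> leaf_rule C \notin C.
Proof.
move=> CT; rewrite /leaf_rule; case: pickP => [h|_]; first by rewrite inE => /andP[].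
case: pickP => [h /andP[]//|_]; case: pickP => // noh.
by case/negP: CT; apply/eqP/setP => h; have := noh h; rewrite inE => /negbFE.
Qed.

Lemma leaf_rule_act C : act C != set0 -> leaf_rule C \in act C.
Proof.
by case/set0Pn => h hA; rewrite /leaf_rule; case: pickP => // /(_ h); rewrite hA.
Qed.

Lemma leaf_rule_leaf C : act C = set0 ->
  (#|C| < #|[set i | deg i == 1%N]|)%N -> deg (vtx (leaf_rule C)) = 1%N.
Proof.
move=> A0 ltC; rewrite /leaf_rule; case: pickP => [h|_]; first by rewrite A0 inE.
case: pickP => [h /andP[_ /eqP]//|noh]; exfalso.
have sub : [set h | deg (vtx h) == 1%N] \subset C.
  apply/subsetP => h; rewrite inE => h1; have := noh h.
  by rewrite h1 andbT => /negbFE.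
have := subset_leq_card sub; rewrite leqNgt; case/negP; apply: leq_trans ltC _.
have := sum_deg_nat vtx (fun i => deg i == 1%N) => <-.
by rewrite -sum1_card big_mkcond [X in (_ <= X)%N]big_mkcond /=; apply: leq_sum => i _;
   rewrite inE; case: eqP => // ->.
Qed.

Variable R : realFieldType.
Notation pref := (pref leaf_rule).
Local Notation covt t m := (cov (pref t m)).
Notation Yw := (Yw vtx leaf_rule (R := R)).
Notation Kw := (Kw vtx leaf_rule (R := R)).

Definition kicks (t : nat) (m : {perm H}) : R :=
  \sum_(s < t) (act (covt s m) == set0)%:R.

Variable T : nat.
(** Fewer than [2 * T] half-edges are covered before time [T], so an uncovered leaf is still
    available; the positivity of [p 1] secures this bound. *)
Hypothesis T_leaves : (2 * T <= #|[set i | deg i == 1%N]|)%N.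

Lemma leaves_le : (#|[set i | deg i == 1%N]| <= #|H|)%N.
Proof.
apply: leq_trans (_ : #|[set h | deg (vtx h) == 1%N]| <= _)%N; last exact: max_card.
have := sum_deg_nat vtx (fun i => deg i == 1%N) => <-.
by rewrite -sum1_card big_mkcond [X in (_ <= X)%N]big_mkcond /=; apply: leq_sum => i _;
   rewrite inE; case: eqP => // ->.
Qed.

Let TH : (2 * T <= #|H|)%N := leq_trans T_leaves leaves_le.

Lemma covt_lt t m : m \in fpf H -> (t < T)%N ->
  #|covt t m| = (2 * t)%N /\ covt t m != setT.
Proof.
move=> mP tT; have cC : #|covt t m| = (2 * t)%N.
  by apply: (card_cov leaf_rule_notin) => //; apply: leq_trans TH; rewrite leq_mul2l ltnW.
split=> //; apply: cov_neqT; rewrite cC; apply: leq_trans TH.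
by rewrite ltn_mul2l.
Qed.

Lemma Kw_kicks (ph : nat -> R) t m : m \in fpf H -> (t <= T)%N ->
  Kw (fun i => ph (deg i)) t m = ph 1%N * kicks t m.
Proof.
move=> mP tT; rewrite /Kw /kicks mulr_sumr; apply: eq_bigr => s _.
have sT : (s < T)%N by apply: leq_trans tT.
have [cC CT] := covt_lt mP sT.
rewrite (kickE leaf_rule_notin leaf_rule_act CT).
have [A0|A0] := eqVneq (act (covt s m)) set0; rewrite ?mulr0 ?mulr1 //=.
rewrite leaf_rule_leaf // cC; apply: leq_trans T_leaves.
by rewrite ltn_mul2l.
Qed.

(** [Kw] runs one step ahead of [Yw] because [seen] already contains the restart vertex of the
    current step. *)
Lemma seen_sum (w : V -> R) s m :
  \sum_(i in seen vtx leaf_rule (pref s m)) w i = Yw w s m + Kw w s.+1 m.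
Proof.
rewrite /Kw big_ord_recr /= -/(Kw w s m) addrA -disc_sum /seen.
set C := cov _; set u := leaf_rule C.
have -> : disc (u |: C) = vtx u |: disc C by rewrite /disc imsetU imset_set1.
case: ifPn => uD; last by rewrite big_setU1 // addrC.
by rewrite addr0; apply: eq_bigl => i; rewrite !inE; case: eqP => [->|].
Qed.

Lemma rest_sum (ph : nat -> R) s m : m \in fpf H -> (s < T)%N ->
  rest vtx leaf_rule (fun i => ph (deg i)) (pref s m) =
  \sum_i ph (deg i) * (deg i)%:R -
    (Yw (fun i => ph (deg i) * (deg i)%:R) s m + ph 1%N * kicks s.+1 m).
Proof.
move=> mP sT; have := Kw_kicks (fun k => ph k * k%:R) mP sT.
rewrite mulr1 => <-; rewrite -seen_sum.
rewrite [in RHS](bigID (mem (seen vtx leaf_rule (pref s m)))) /= addrC addrK.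
by apply: eq_bigr => i _; rewrite mulr_natr.
Qed.

Lemma disc_kicks (ph : nat -> R) t m : m \in fpf H -> (t <= T)%N ->
  \sum_(i in disc (covt t m)) ph (deg i) =
    Yw (fun i => ph (deg i)) t m + ph 1%N * kicks t m.
Proof. by move=> mP tT; rewrite disc_sum Kw_kicks. Qed.

Lemma comp_sum (ph : nat -> R) s m : m \in fpf H -> (s < T)%N ->
  compensator vtx leaf_rule (fun i => ph (deg i)) (pref s m) =
  (\sum_i ph (deg i) * (deg i)%:R -
    (Yw (fun i => ph (deg i) * (deg i)%:R) s m + ph 1%N * kicks s.+1 m))
  / (#|H|%:R - (2 * s + 1)%:R).
Proof.
move=> mP sT; rewrite /compensator rest_sum // size_pref -subnDA natrB //.
by apply: leq_trans TH; rewrite addn1 ltn_mul2l.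
Qed.

Lemma act_kicks t m : m \in fpf H -> (t <= T)%N ->
  #|act (covt t m)|%:R = Yw (fun i => (deg i)%:R) t m + kicks t m - 2 * t%:R.
Proof.
move=> mP tT; have := disc_kicks (fun k => k%:R) mP tT; rewrite mul1r => <-.
rewrite -natr_sum deg_disc natrD (card_cov leaf_rule_notin) //.
  by rewrite natrM; ring.
by apply: leq_trans TH; rewrite leq_mul2l tT orbT.
Qed.

Variables (n a al lam rho del eps r : R) (t2 J : nat) (ph : nat -> R).
Hypothesis n_gt0 : 0 < n.
Hypothesis aE : a = n * al.
Hypothesis al_gt0 : 0 < al.
Hypothesis al_eps : al <= eps.
Hypothesis eps_le1 : eps <= 1.
Hypothesis one_le : 1 <= eps * (a * al).
Hypothesis lam_gt0 : 0 < lam.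
Hypothesis rho_gt4 : 4 < rho.
Hypothesis r_ge0 : 0 <= r.
Hypothesis ph_01 : forall k, 0 <= ph k <= 1.
Local Notation kap := (rho - 4).
Local Notation th := (2 / kap).
Local Notation Th := (2 / kap + 1).
Hypothesis N_approx : `|#|H|%:R - lam * n| <= eps * n.
Hypothesis cube_approx : `|\sum_i ((deg i)%:R : R) ^+ 3 - rho * (lam * n)| <= eps * n.
Hypothesis ph_approx : `|\sum_i ph (deg i) * (deg i)%:R - r * (lam * n)| <= eps * n.
Hypothesis sqrE : \sum_i ((deg i)%:R : R) ^+ 2 = 2 * #|H|%:R + a.
Hypothesis eps_small : (1 + 2 * Th) * eps <= lam / 2.
Local Notation C1 := (drift_const lam Th rho (1 + Th)).
Local Notation Cone := (drift_const lam Th 1 (1 + Th)).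
Local Notation Cph := (drift_const lam Th r (1 + Th)).
Local Notation Cc := (crude_const lam Th rho C1).
Local Notation Cw := (walk_const lam Th rho C1).
Hypothesis eps_crude : (1 + Cc) * eps <= 1.
Hypothesis eps_lam : eps <= lam.
Hypothesis eps_del : 2 * lam * ((2 * Cw + 1) * eps) < del.
Hypothesis eps_del2 : lam * (Cw * eps) < kap * del ^+ 2 / 2.
Hypothesis eps_del3 : (C1 + Cone + Cph + Cc + 3) * eps <= del.
Hypothesis del_gt0 : 0 < del.
Hypothesis del_small : (2 * kap + 5) * del <= 3 / 4.
Hypothesis t2_le : t2%:R <= (th - del) * a.
Hypothesis t2_ge : (th - del) * a - 1 <= t2%:R.
Hypothesis T_le : T%:R <= (th + del) * a.
Hypothesis T_ge : (th + del / 2) * a <= T%:R.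
Hypothesis J_le : J%:R <= del * a.
Hypothesis J_ge : del * a / 2 <= J%:R.
Hypothesis TJH : (2 * (T + J) <= #|H|)%N.

(** The drift deficit left after the giant is of order [al]; the factor 8 makes [eta] cost at most
    [a / 4] in [stop_subcritical]. *)
Local Notation eta := (al / (8 * lam)).
Local Notation deviates w b m := [exists t : 'I_T.+1,
  b <= `|Yw w t m - \sum_(s < t) compensator vtx leaf_rule w (pref s m)|].

(** Degrees need the precision [eps * (a * al)], the scale of the walk; for the other weights
    [eps * a] is enough. The bound on cubes says that the discovered vertices hardly deplete the
    sums that drive the drifts. *)
Definition atypical (m : {perm H}) : bool :=
  [|| deviates (fun i => (deg i)%:R) (eps * (a * al)) m,
      deviates (fun i => (deg i)%:R ^+ 2) (eps * a) m,
      deviates (fun=> 1) (eps * a) m,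
      deviates (fun i => ph (deg i)) (eps * a) m,
      eps * n <= Yw (fun i => (deg i)%:R ^+ 3) T m |
      late_big vtx leaf_rule eta t2 T J m].

Let kap_gt0 : 0 < kap. Proof. by rewrite subr_gt0. Qed.
Let a_gt0 : 0 < a. Proof. by rewrite aE mulr_gt0. Qed.
Let eps_gt0 : 0 < eps. Proof. exact: lt_le_trans al_eps. Qed.
Let th_ge0 : 0 <= th. Proof. by rewrite divr_ge0 // ltW. Qed.
Let Th_ge0 : 0 <= Th. Proof. by rewrite addr_ge0. Qed.
Let lam_ge0 : 0 <= lam. Proof. exact: ltW. Qed.
Let rho_ge0 : 0 <= rho. Proof. by apply: le_trans (ltW rho_gt4). Qed.
Let kap_ge0 : 0 <= kap. Proof. exact: ltW. Qed.
Let C1_ge0 : 0 <= C1. Proof. by rewrite /drift_const; nonneg. Qed.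
Let Cone_ge0 : 0 <= Cone. Proof. by rewrite /drift_const; nonneg. Qed.
Let Cph_ge0 : 0 <= Cph. Proof. by rewrite /drift_const; nonneg. Qed.
Let Cc_ge0 : 0 <= Cc. Proof. by rewrite /crude_const; nonneg. Qed.
Let del_le1 : del <= 1.
Proof.
have : 0 <= kap * del by rewrite mulr_ge0 // ltW.
by have := del_small; have := del_gt0; lra.
Qed.
Let T_le' : T%:R <= Th * a.
Proof.
by apply: le_trans T_le _; rewrite ler_pM2r // lerD2l.
Qed.
Let t2T : (t2 <= T)%N.
Proof.
rewrite -(ler_nat R); apply: le_trans t2_le _; apply: le_trans T_ge.
by rewrite ler_pM2r // lerD2l; have := del_gt0; lra.
Qed.
Let one_a : 1 <= eps * a := one_le_a n_gt0 aE al_gt0 al_eps eps_le1 one_le.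
Let eps_x (x : R) : 0 <= x -> x <= C1 + Cone + Cph + Cc + 3 ->
  x * (eps * a) <= del * a.
Proof.
move=> x0 xC; rewrite mulrA ler_pM2r //; apply: le_trans eps_del3.
by rewrite ler_pM2r.
Qed.

Section Typical.
Variable m : {perm H}.
Hypothesis mP : m \in fpf H.
Hypothesis typ : ~~ atypical m.

Let Yd t := Yw (fun i => (deg i)%:R) t m.
Let Yd2 t := Yw (fun i => (deg i)%:R ^+ 2) t m.
Let Yd3 t := Yw (fun i => (deg i)%:R ^+ 3) t m.
Let K t := kicks t m.
Let A t := Yd t + K t - 2 * t%:R.

Lemma deviatesN (w : V -> R) b : ~~ deviates w b m -> forall t, (t <= T)%N ->
  `|Yw w t m - \sum_(s < t) compensator vtx leaf_rule w (pref s m)| <= b.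
Proof.
move=> /existsPn dv t tT; apply/ltW; have := dv (Ordinal (tT : (t < T.+1)%N)).
by rewrite -ltNge.
Qed.

Lemma kicks_le t : K t <= t%:R.
Proof.
rewrite /K /kicks -[X in _ <= X%:R]card_ord -sumr_const.
by apply: ler_sum => s _; case: eqP.
Qed.

Lemma kicks_ge0 t : 0 <= K t.
Proof. by apply: sumr_ge0. Qed.

Lemma cube_seen s : (s < T)%N -> 0 <= Yd3 s + K s.+1 <= (1 + Th) * eps * n.
Proof.
move=> sT; have d0 : 0 <= Yd3 s by apply: Yw_ge0 => i; apply: exprn_ge0.
rewrite addr_ge0 ?kicks_ge0 //=.
have -> : (1 + Th) * eps * n = eps * n + Th * (eps * n) by ring.
apply: lerD.
  apply: (@le_trans _ _ (Yd3 T)).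
    by apply: Yw_homo; [move=> i; apply: exprn_ge0|apply: ltnW].
  have : ~~ (eps * n <= Yd3 T).
    by move: typ; apply: contra => h; rewrite /atypical h !orbT.
  by rewrite -ltNge => /ltW.
apply: le_trans (kicks_le s.+1) _; apply: (@le_trans _ _ T%:R); first by rewrite ler_nat.
apply: le_trans T_le' _; rewrite ler_wpM2l //.
exact: (a_le n_gt0 aE al_eps).
Qed.

Lemma seen_weight_le (f : nat -> R) s : (s < T)%N -> (forall k, 0 <= f k <= k%:R ^+ 2) ->
  0 <= Yw (fun i => f (deg i) * (deg i)%:R) s m + f 1%N * K s.+1
    <= (1 + Th) * eps * n.
Proof.
move=> sT fP; have f0 k : 0 <= f k by have /andP[] := fP k.
rewrite addr_ge0 /=; last by rewrite mulr_ge0 ?kicks_ge0.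
  have /andP[_] := cube_seen sT; apply: le_trans; apply: lerD.
    apply: ler_sum => t _; rewrite /gain; case: ifP => // _.
    by rewrite exprSr ler_wpM2r //; have /andP[] := fP (deg (vtx (m (leaf_rule (covt t m))))).
  rewrite -[leRHS]mul1r ler_wpM2r ?kicks_ge0 //.
  by have /andP[_] := fP 1%N; rewrite expr1n.
by apply: Yw_ge0 => i; rewrite mulr_ge0.
Qed.

Lemma weight_approx (f : nat -> R) (q : R) : 0 <= q ->
  (forall k, 0 <= f k) -> (forall k, (0 < k)%N -> f k <= k%:R ^+ 2) ->
  `|\sum_i f (deg i) * (deg i)%:R - q * (lam * n)| <= eps * n ->
  ~~ deviates (fun i => f (deg i)) (eps * a) m ->
  forall t, (t <= T)%N ->
  `|Yw (fun i => f (deg i)) t m - q * t%:R|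
     <= drift_const lam Th q (1 + Th) * (eps * a).
Proof.
move=> q0 f0 fle fq dv.
(* The value of [f] at 0 is immaterial, as sums over half-edges never meet isolated vertices.
   Setting it to 0 extends the bound by [k%:R ^+ 2] to all [k]. *)
pose g k := if k == 0%N then 0 else f k.
have gP k : 0 <= g k <= k%:R ^+ 2.
  rewrite /g; case: (eqVneq k 0%N) => [->|k0]; first by rewrite expr0n lexx.
  by rewrite f0 fle // lt0n.
have gE k : g k * k%:R = f k * k%:R.
  by rewrite /g; case: eqP => [->|]; rewrite ?mulr0.
pose X s := Yw (fun i => g (deg i) * (deg i)%:R) s m + g 1%N * K s.+1.
apply: (drift_approx (X := X) n_gt0 aE al_gt0 al_eps lam_gt0 N_approx Th_ge0 T_le'
  eps_small q0 _ fq).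
- by rewrite addr_ge0.
- by move=> s sT; apply: seen_weight_le.
move=> t tT; have := deviatesN dv tT; congr (is_true (`|_ - _| <= _)).
apply: eq_bigr => s _; have sT : (s < T)%N by apply: leq_trans tT.
rewrite comp_sum //; congr ((_ - (_ + _)) / _).
by apply: eq_bigr => s' _; rewrite /gain gE.
Qed.

Lemma square_approx t : (t <= T)%N -> `|Yd2 t - rho * t%:R| <= C1 * (eps * a).
Proof.
apply: (@weight_approx (fun k => k%:R ^+ 2)) => //.
- by move=> k; apply: exprn_ge0.
- apply: le_trans cube_approx; rewrite le_eqVlt; apply/orP; left.
  by apply/eqP; congr `|_ - _|; apply: eq_bigr => i _; rewrite -exprSr.
by move: typ; apply: contra => h; rewrite /atypical h !orbT.
Qed.

Lemma degree_approx t : (t <= T)%N ->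
  `|Yd t - \sum_(s < t) (2 * #|H|%:R + a - Yd2 s - K s.+1)
       / (#|H|%:R - (2 * s + 1)%:R)| <= eps * (a * al).
Proof.
move=> tT; have dv : ~~ deviates (fun i => (deg i)%:R) (eps * (a * al)) m.
  by move: typ; apply: contra => h; rewrite /atypical h.
apply: le_trans (deviatesN dv tT); rewrite le_eqVlt; apply/orP; left.
apply/eqP; congr `|_ - _|; apply: eq_bigr => s _.
have sT : (s < T)%N by apply: leq_trans tT.
rewrite (comp_sum (fun k => k%:R)) // mul1r opprD addrA -sqrE.
by congr ((_ - _ - _) / _).
Qed.

Lemma actE t : (t <= T)%N -> A t = #|act (covt t m)|%:R.
Proof. by move=> tT; rewrite act_kicks. Qed.

Lemma A_ge0 t : (t <= T)%N -> 0 <= A t.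
Proof. by move=> tT; rewrite actE. Qed.

Lemma A_eq0 t : (t <= T)%N -> (A t == 0) = (act (covt t m) == set0).
Proof. by move=> tT; rewrite actE // pnatr_eq0 cards_eq0. Qed.

Lemma kicksS t : (t < T)%N -> K t.+1 = K t + (A t == 0)%:R.
Proof.
by move=> tT; rewrite A_eq0 ?(ltnW tT) // /K /kicks big_ord_recr.
Qed.

Let K0 : K 0%N = 0. Proof. by rewrite /K /kicks big_ord0. Qed.

Lemma kicks_small t : (t <= T)%N -> K t <= (1 + Cc) * (eps * a).
Proof.
exact: (K_small_eps n_gt0 aE al_gt0 al_eps eps_le1 one_le lam_gt0 N_approx
  Th_ge0 T_le' eps_small (ltW rho_gt4) C1_ge0 square_approx degree_approx
  (fun t => erefl (A t)) K0 kicksS eps_crude).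
Qed.

Lemma window_active t : (t <= T)%N -> del * a <= t%:R -> t%:R <= (th - del) * a ->
  act (covt t m) != set0.
Proof.
move=> tT h1 h2; rewrite -A_eq0 // gt_eqF //.
exact: (active_window n_gt0 aE al_gt0 al_eps eps_le1 one_le lam_gt0 N_approx
  Th_ge0 T_le' eps_small (ltW rho_gt4) C1_ge0 square_approx degree_approx
  (fun t => erefl (A t)) K0 kicksS eps_crude kap_gt0 del_gt0 eps_del2 tT h1 h2).
Qed.

Lemma window_zero : exists tau, [/\ (t2 <= tau <= T)%N, act (covt tau m) = set0 &
  forall s, (t2 <= s < tau)%N -> act (covt s m) != set0].
Proof.
have [tau [tP A0 An]] :=
  zero_window n_gt0 aE al_gt0 al_eps eps_le1 one_le lam_gt0 N_approx
  Th_ge0 T_le' eps_small (ltW rho_gt4) C1_ge0 square_approx degree_approx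
  (fun t => erefl (A t)) A_ge0 K0 kicksS eps_crude kap_gt0 del_gt0 t2_le t2T
  T_ge eps_del.
have /andP[t2tau tauT] := tP; exists tau; split=> //.
  by apply/eqP; rewrite -A_eq0 // A0.
move=> s sP; rewrite -A_eq0; first exact: An.
by have /andP[_ st] := sP; apply: leq_trans (ltnW st) tauT.
Qed.

(** The undiscovered squares have lost about [rho * tau], twice the free half-edges only [4 * tau].
    The difference [kap * tau], close to [2 * a], exceeds the initial surplus [a] by a margin [a]: a
    quarter pays for [eta], and [del_small] fits all errors in the other three. *)
Lemma stop_subcritical tau : (t2 <= tau <= T)%N -> act (covt tau m) = set0 ->
  subcritical vtx eta J (covt tau m).
Proof.
move=> /andP[t2tau tauT] A0; rewrite /subcritical.
have tauH : (2 * tau <= #|H|)%N by apply: leq_trans TH; rewrite leq_mul2l tauT orbT.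
have -> : \sum_(i | i \notin disc (covt tau m)) ((deg i)%:R : R) ^+ 2 =
    2 * #|H|%:R + a - (Yd2 tau + K tau).
  have := disc_kicks (fun k => k%:R ^+ 2) mP tauT; rewrite expr1n mul1r => <-.
  by rewrite -sqrE [in RHS](bigID (mem (disc (covt tau m)))) /= addrC addrK.
rewrite (card_cov leaf_rule_notin) // -subnDA natrB; last first.
  by rewrite -mulnDr; apply: leq_trans TJH; rewrite leq_mul2l leq_add2r tauT orbT.
rewrite natrD !natrM.
have := square_approx tauT; rewrite ler_norml => /andP[h1 _].
have h2 := kicks_ge0 tau.
have h3 : t2%:R <= tau%:R :> R by rewrite ler_nat.
have h4 : kap * t2%:R <= kap * tau%:R by rewrite ler_wpM2l.
have h5 : kap * ((th - del) * a - 1) <= kap * t2%:R by rewrite ler_wpM2l.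
have e5 : kap * ((th - del) * a - 1) = 2 * a - kap * del * a - kap.
  by field; rewrite gt_eqF.
have h6 : kap <= kap * (del * a).
  rewrite ler_peMr //; apply: le_trans one_a _; rewrite ler_pM2r //.
  apply: le_trans eps_del3; rewrite ler_peMl ?(ltW eps_gt0) //.
  have := C1_ge0; have := Cone_ge0; have := Cph_ge0; have := Cc_ge0; lra.
have h7 : C1 * (eps * a) <= del * a.
  apply: eps_x => //; have := Cone_ge0; have := Cph_ge0; have := Cc_ge0; lra.
have h8 : eta * (#|H|%:R - (2 * tau%:R + 2 * J%:R)) <= a / 4.
  apply: (@le_trans _ _ (eta * (2 * lam * n))).
    apply: ler_wpM2l; first by rewrite divr_ge0 ?mulr_ge0 ?(ltW al_gt0).
    have := N_approx; rewrite ler_norml => /andP[_].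
    have : eps * n <= lam * n by rewrite ler_pM2r.
    have : 0 <= tau%:R :> R by []. have : 0 <= J%:R :> R by []. lra.
  have -> : eta * (2 * lam * n) = a / 4 by rewrite aE; field; rewrite gt_eqF.
  by [].
have h9 : (2 * kap + 5) * del * a <= 3 / 4 * a by rewrite ler_pM2r.
have h10 := J_le.
lra.
Qed.

Local Notation cls i := [set k | connect (madj vtx m) i k].

(** The giant is explored between [tau], the first zero from [t2] on, and [tau1], the last zero
    before it, which is at most [del * a] by [window_active]. Any other component was found by
    [tau1] or is left at [tau], where [late_big] is excluded. *)
Lemma typical_giant : exists v0 : V,
  [/\ `|#|cls v0|%:R - th * a| <= 6 * (del * a),
      `|\sum_(i in cls v0) ph (deg i) - r * (th * a)| <= (4 + 2 * r) * (del * a),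
      `|(\sum_(i in cls v0) deg i)%:R - 2 * (th * a)| <= 6 * (del * a) &
      forall i, i \notin cls v0 -> (\sum_(k in cls i) deg k)%:R <= 2 * (del * a)].
Proof.
have [tau [tauP A0 An]] := window_zero; have /andP[t2tau tauT] := tauP.
have sc := stop_subcritical tauP A0.
have tauH : (2 * tau <= #|H|)%N by apply: leq_trans TH; rewrite leq_mul2l tauT orbT.
have a0 := ltW a_gt0.
have da1 : 1 <= del * a.
  apply: le_trans one_a _; rewrite ler_pM2r //.
  apply: le_trans eps_del3; rewrite ler_peMl ?(ltW eps_gt0) //.
  by have := C1_ge0; have := Cone_ge0; have := Cph_ge0; have := Cc_ge0; lra.
have thd : 4 * del <= th.
  rewrite ler_pdivlMr //; have := del_small; have := del_gt0.
  have : 0 <= del * kap by rewrite mulr_ge0 // ltW.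
  lra.
have tau_pos : (0 < tau)%N.
  rewrite -(ltr_nat R); apply: lt_le_trans (_ : t2%:R <= _); last by rewrite ler_nat.
  apply: lt_le_trans t2_ge; rewrite subr_gt0; have : 4 * del * a <= th * a by rewrite ler_pM2r.
  lra.
(* Time 0 is a zero, so a last zero before [tau] exists. *)
have ex0 : exists s, (s < tau)%N && (act (covt s m) == set0).
  exists 0%N; rewrite tau_pos /=; apply/eqP/setP => h; rewrite !inE /= /disc imset0 inE.
  by [].
have ub s : (s < tau)%N && (act (covt s m) == set0) -> (s <= tau)%N.
  by case/andP => /ltnW.
case: (ex_maxnP ex0 ub) => tau1 /andP[t1t /eqP A1] tmax.
have tau1T : (tau1 <= T)%N by apply: leq_trans (ltnW t1t) tauT.
have tau1H : (2 * tau1 <= #|H|)%N by apply: leq_trans TH; rewrite leq_mul2l tau1T orbT.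
have nz s : (tau1 < s < tau)%N -> act (covt s m) != set0.
  move=> /andP[s1 s2]; apply/negP => As; have := tmax s; rewrite s2 As => /(_ isT).
  by rewrite leqNgt s1.
have tau1_le : tau1%:R <= del * a.
  rewrite leNgt; apply/negP => h; have : act (covt tau1 m) != set0; last by rewrite A1 eqxx.
  have [t21|t12] := leqP t2 tau1; first by apply: An; rewrite t21.
  apply: window_active => //; first exact: ltW.
  by apply: le_trans t2_le; rewrite ler_nat ltnW.
pose v0 := vtx (leaf_rule (covt tau1 m)); exists v0.
have BE : disc (covt tau m) :\: disc (covt tau1 m) = cls v0.
  exact: (disc_component leaf_rule_notin leaf_rule_act mP t1t tauH A1 A0 nz).
have sub1 : disc (covt tau1 m) \subset disc (covt tau m).
  by apply: disc_sub; apply: ltnW.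
have sumB (F : V -> R) : \sum_(i in cls v0) F i =
    \sum_(i in disc (covt tau m)) F i - \sum_(i in disc (covt tau1 m)) F i.
  rewrite [X in _ = X - _](big_setID (disc (covt tau1 m))) /= (setIidPr sub1) BE.
  by rewrite addrC addrK.
have tau_near : `|tau%:R - th * a| <= 2 * (del * a).
  have : t2%:R <= tau%:R :> R by rewrite ler_nat.
  have : tau%:R <= T%:R :> R by rewrite ler_nat.
  have := t2_ge; have := T_le; rewrite ler_norml => ????.
  by apply/andP; split; lra.
(* In units of [del * a] the error is 1 for the fluctuation, 1 for the restarts, 2 for the vertices
   found by [tau1], and [2 * q] for the position of [tau]. *)
have weightB (f : nat -> R) q : 0 <= q -> (forall k, 0 <= f k <= 1) ->
    `|\sum_i f (deg i) * (deg i)%:R - q * (lam * n)| <= eps * n ->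
    ~~ deviates (fun i => f (deg i)) (eps * a) m ->
    drift_const lam Th q (1 + Th) * (eps * a) <= del * a ->
    `|\sum_(i in cls v0) f (deg i) - q * (th * a)| <= (4 + 2 * q) * (del * a).
  move=> q0 f01 fq dv Cq; rewrite sumB.
  have f0 k : 0 <= f k by have /andP[] := f01 k.
  have fle k : (0 < k)%N -> f k <= k%:R ^+ 2.
    move=> k0; have /andP[_ h] := f01 k; apply: le_trans h _.
    by rewrite -natrX ler1n expn_gt0 k0.
  have := weight_approx q0 f0 fle fq dv tauT; rewrite disc_kicks //.
  have := kicks_small tauT; have := kicks_ge0 tau.
  have kk : (1 + Cc) * (eps * a) <= del * a.
    by apply: eps_x; have := C1_ge0; have := Cone_ge0; have := Cph_ge0; have := Cc_ge0; lra.
  have s1_ge0 : 0 <= \sum_(i in disc (covt tau1 m)) f (deg i) by apply: sumr_ge0.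
  have s1_le : \sum_(i in disc (covt tau1 m)) f (deg i) <= 2 * (del * a).
    apply: (@le_trans _ _ (\sum_(i in disc (covt tau1 m)) 1)).
      by apply: ler_sum => i _; have /andP[] := f01 (deg i).
    rewrite sumr_const; apply: (@le_trans _ _ (2 * tau1)%:R).
      by rewrite ler_nat (card_disc vtx leaf_rule_notin).
    by rewrite natrM ler_wpM2l.
  have : `|q * tau%:R - q * (th * a)| <= q * (2 * (del * a)).
    by rewrite -mulrBr normrM (ger0_norm q0) ler_wpM2l.
  have fK : f 1%N * K tau <= K tau.
    by rewrite ler_piMl ?kicks_ge0 //; have /andP[] := f01 1%N.
  have fK0 : 0 <= f 1%N * K tau by rewrite mulr_ge0 ?kicks_ge0.
  rewrite -/(K tau); move: s1_ge0 s1_le fK fK0.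
  set s1 := \sum_(i in disc (covt tau1 m)) _; set y := Yw _ tau m; set k1 := f 1%N * _.
  rewrite !ler_norml => ????  /andP[??] ?? /andP[??].
  by apply/andP; split; lra.
split.
- have h := weightB (fun=> 1) 1 ler01.
  have e1 : `|#|cls v0|%:R - th * a| = `|\sum_(i in cls v0) 1 - 1 * (th * a)|.
    by rewrite sumr_const mul1r.
  rewrite e1; have -> : 6 * (del * a) = (4 + 2 * 1) * (del * a) by ring.
  apply: h.
  + by move=> _; rewrite ler01 lexx.
  + apply: le_trans N_approx; rewrite mul1r le_eqVlt; apply/orP; left; apply/eqP.
    congr `|_ - _|; under eq_bigr do rewrite mul1r.
    rewrite -natr_sum; congr _%:R; have := sum_deg_nat vtx xpredT => /= ->.
    by rewrite -cardsT; apply: eq_card => h'; rewrite !inE.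
  + by move: typ; apply: contra => h'; rewrite /atypical h' !orbT.
  + apply: eps_x => //; have := C1_ge0; have := Cph_ge0; have := Cc_ge0; lra.
- apply: weightB => //.
    by move: typ; apply: contra => h'; rewrite /atypical h' !orbT.
  by apply: eps_x => //; have := C1_ge0; have := Cone_ge0; have := Cc_ge0; lra.
- rewrite natr_sum sumB -!natr_sum.
  rewrite (deg_disc_zero leaf_rule_notin mP tauH A0).
  rewrite (deg_disc_zero leaf_rule_notin mP tau1H A1) !natrM.
  have : 0 <= tau1%:R :> R by []. move: tau_near tau1_le; rewrite !ler_norml.
  by move=> /andP[??] ??; apply/andP; split; lra.
move=> i; rewrite -BE in_setD negb_and negbK => /orP[i1|i2].
  apply: (@le_trans _ _ (2 * tau1)%:R); last by rewrite natrM ler_wpM2l.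
  rewrite ler_nat -(deg_disc_zero leaf_rule_notin mP tau1H A1).
  rewrite big_mkcond [X in (_ <= X)%N]big_mkcond /=; apply: leq_sum => k _.
  rewrite inE; case: ifP => // ik; rewrite ifT //.
  exact: (mclosed_connect (disc_mclosed mP A1) ik).
apply: (@le_trans _ _ (2 * J)%:R); last by rewrite natrM ler_wpM2l.
rewrite ler_nat leqNgt; apply/negP => bigi.
move: typ; rewrite /atypical !negb_or => /and5P[_ _ _ _ /andP[_ /negP[]]].
apply/existsP; exists (Ordinal (tauT : (tau < T.+1)%N)) => /=.
rewrite t2tau A0 eqxx sc /=; apply/andP; split.
  apply/forallP => s; apply/implyP => t2s; apply: An.
  by rewrite t2s ltn_ord.
apply/existsP; exists i; rewrite i2 /=; move: bigi; congr (_ < _)%N.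
by apply: eq_bigl => k; rewrite inE.
Qed.

End Typical.

Variables (c4 Dl : R).
Hypothesis c4_ge0 : 0 <= c4.
Hypothesis Dl_ge0 : 0 <= Dl.
Hypothesis fourth_le : \sum_i ((deg i)%:R : R) ^+ 4 <= c4 * n.
Hypothesis deg_le : forall i, (deg i)%:R <= Dl.
Hypothesis eta_le2 : eta <= 2.

Let v := 2 * c4 / lam.

Lemma deg_pow_le (k : nat) i : (k <= 4)%N -> (0 < k)%N ->
  ((deg i)%:R : R) ^+ k <= (deg i)%:R ^+ 4.
Proof.
move=> k4 k0; case: (deg i) => [|q]; first by rewrite !expr0n -!leqn0 leqNgt k0.
by rewrite ler_weXn2l // ler1n.
Qed.

Lemma var_le (w : V -> R) (c : R) t : (t < T)%N -> 0 <= c ->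
  \sum_i w i *+ deg i <= c * n ->
  \sum_i w i *+ deg i <= (2 * c / lam) *+ (#|H| - 2 * t - 1).
Proof.
move=> tT c0 wc; apply: le_trans wc _.
have := den_ge n_gt0 aE al_eps N_approx Th_ge0 T_le' eps_small tT.
have -> : #|H|%:R - (2 * t + 1)%:R = (#|H| - 2 * t - 1)%:R :> R.
  by rewrite -subnDA natrB //; apply: leq_trans TH; rewrite addn1 ltn_mul2l.
move=> h; rewrite -[leRHS]mulr_natr.
have -> : c * n = 2 * c / lam * (lam * n / 2) by field; rewrite gt_eqF.
by rewrite ler_wpM2l // divr_ge0 // mulr_ge0.
Qed.

Lemma deviates_bound (w : V -> R) (b c : R) : 0 < b -> 0 <= c ->
  (\sum_i w i ^+ 2 *+ deg i) <= c * n ->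
  #|[set m in fpf H | deviates w b m]|%:R
     <= 2 * c / lam * Th * a / b ^+ 2 * #|fpf H|%:R.
Proof.
move=> b0 c0 wc; have c0' : 0 <= 2 * c / lam by rewrite divr_ge0 // mulr_ge0.
have := weight_maximal leaf_rule_notin TH b0 (fun t tT => var_le tT c0 wc) c0'.
have b2 : 0 < b ^+ 2 by rewrite exprn_gt0.
rewrite -ler_pdivlMr // => h; apply: le_trans h _.
rewrite -[_ *+ #|_|]mulr_natr mulrAC ler_wpM2r // ler_pM2r ?invr_gt0 //.
by rewrite -[leLHS]mulr_natr -[leRHS]mulrA ler_wpM2l.
Qed.

(** Chebyshev for the four deviations, Markov for the cubes, [late_big_bound] for the rest. The
    degrees and the late components both give [1 / (a * al ^+ 2)], which is where [n * al ^+ 3] must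
    be large. The squares would need a fifth moment, replaced by [Dl] times the fourth. *)
Lemma atypical_bound :
  #|[set m in fpf H | atypical m]|%:R <=
   ((v * Th / eps ^+ 2 + 16 * c4 * lam / del ^+ 2) / (a * al ^+ 2)
    + v * Th * (Dl + 2) / eps ^+ 2 / a + v * Th / eps * al) * #|fpf H|%:R.
Proof.
have deg_sum k : (0 < k <= 4)%N -> \sum_i ((deg i)%:R : R) ^+ k <= c4 * n.
  move=> /andP[k0 k4]; apply: le_trans fourth_le; apply: ler_sum => i _.
  exact: deg_pow_le.
have b1 : 0 < eps * (a * al) by rewrite !mulr_gt0.
have b2 : 0 < eps * a by rewrite mulr_gt0.
have natX i k : ((deg i)%:R : R) ^+ k *+ deg i = (deg i)%:R ^+ k.+1.
  by rewrite exprSr mulr_natr.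
set F := #|fpf H|%:R; have F0 : 0 <= F by [].
pose S (P : pred {perm H}) : R := #|[set m in fpf H | P m]|%:R.
have SU (P Q : pred {perm H}) : S (fun m => P m || Q m) <= S P + S Q.
  rewrite /S -natrD ler_nat; apply: leq_trans (leq_card_setU _ _).
  apply/subset_leq_card/subsetP => m; rewrite in_setU !in_set.
  by case/andP => -> /orP[]->; rewrite ?orbT.
have e1 : S (fun m => deviates (fun i => (deg i)%:R) (eps * (a * al)) m)
    <= v * Th / eps ^+ 2 / (a * al ^+ 2) * F.
  have -> : v * Th / eps ^+ 2 / (a * al ^+ 2) = v * Th * a / (eps * (a * al)) ^+ 2.
    by field; rewrite !gt_eqF.
  apply: deviates_bound => //; under eq_bigr do rewrite natX.
  exact: deg_sum.
have e2 : S (fun m => deviates (fun i => (deg i)%:R ^+ 2) (eps * a) m)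
    <= v * Th * Dl / eps ^+ 2 / a * F.
  have -> : v * Th * Dl / eps ^+ 2 / a = 2 * (c4 * Dl) / lam * Th * a / (eps * a) ^+ 2.
    by rewrite /v; field; rewrite !gt_eqF.
  apply: deviates_bound => //; first exact: mulr_ge0.
  under eq_bigr do rewrite -exprM natX.
  apply: (@le_trans _ _ (\sum_i Dl * (deg i)%:R ^+ 4)).
    by apply: ler_sum => i _; rewrite exprS ler_wpM2r ?exprn_ge0.
  by rewrite -mulr_sumr mulrAC [leRHS]mulrC ler_wpM2l.
have bd (w : V -> R) : (forall i, 0 <= w i <= 1) ->
    S (fun m => deviates w (eps * a) m) <= v * Th / eps ^+ 2 / a * F.
  move=> w01; have -> : v * Th / eps ^+ 2 / a = v * Th * a / (eps * a) ^+ 2.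
    by field; rewrite !gt_eqF.
  apply: deviates_bound => //.
  apply: le_trans (deg_sum 1%N isT); apply: ler_sum => i _; rewrite expr1.
  have /andP[w0 w1] := w01 i.
  by rewrite -[leLHS]mulr_natr ler_piMl // exprn_ile1.
have e3 : S (fun m => deviates (fun=> 1) (eps * a) m) <= v * Th / eps ^+ 2 / a * F.
  by apply: bd => i; rewrite ler01 lexx.
have e4 := bd (fun i => ph (deg i)) (fun i => ph_01 (deg i)).
have e5 : S (fun m => eps * n <= Yw (fun i => (deg i)%:R ^+ 3) T m) <= v * Th / eps * al * F.
  have -> : v * Th / eps * al = v * Th * a / (eps * n).
    by rewrite aE; field; rewrite !gt_eqF.
  have en : 0 < eps * n by rewrite mulr_gt0.
  rewrite mulrAC ler_pdivlMr //.
  have w0 i : 0 <= ((deg i)%:R : R) ^+ 3 by apply: exprn_ge0.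
  apply: (@le_trans _ _ (\sum_(m in fpf H) Yw (fun i => (deg i)%:R ^+ 3) T m)).
    rewrite mulrC mulr_natr -sumr_const big_mkcond [leRHS]big_mkcond /=.
    apply: ler_sum => m _; rewrite in_set; case: (m \in fpf H) => //=.
    by case: ifP => // _; apply: Yw_ge0.
  apply: le_trans (weight_mean (v := v) leaf_rule_notin TH w0 _) _.
    move=> t tT; apply: var_le => //; under eq_bigr do rewrite natX.
    exact: deg_sum.
  rewrite -[_ *+ #|_|]mulr_natr ler_wpM2r // -[leLHS]mulr_natr -[leRHS]mulrA ler_wpM2l //.
  by rewrite divr_ge0 // mulr_ge0.
have e6 : S (late_big vtx leaf_rule eta t2 T J)
    <= 16 * c4 * lam / del ^+ 2 / (a * al ^+ 2) * F.
  have eta0 : 0 < eta by rewrite divr_gt0 // mulr_gt0.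
  have lb := late_big_bound leaf_rule_notin leaf_rule_act t2 (ltW eta0) eta_le2 TJH.
  have J0 : 0 < J%:R :> R by apply: lt_le_trans J_ge; rewrite !mulr_gt0 ?invr_gt0.
  have JJ : (del * a / 2) ^+ 2 <= J%:R ^+ 2.
    by rewrite ler_sqr ?nnegrE ?mulr_ge0 ?invr_ge0 ?(ltW del_gt0) ?(ltW a_gt0) // (ltW J0).
  have -> : 16 * c4 * lam / del ^+ 2 / (a * al ^+ 2) =
      c4 * n / (2 * eta * (del * a / 2) ^+ 2).
    by rewrite aE; field; rewrite !gt_eqF.
  have p0 : 0 < 2 * eta * (del * a / 2) ^+ 2.
    by repeat first [done | apply: mulr_gt0 | apply: exprn_gt0 | rewrite invr_gt0].
  rewrite mulrAC ler_pdivlMr //.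
  apply: (@le_trans _ _ ((\sum_i (deg i)%:R ^+ 2) * F)); last first.
    by rewrite ler_wpM2r // deg_sum.
  apply: le_trans lb; rewrite natrM mulrC.
  have -> : eta * J%:R * (2%:R * J%:R) = 2 * eta * J%:R ^+ 2 by ring.
  by rewrite ler_wpM2r // ler_wpM2l // mulr_ge0 // ltW.
pose P1 m := deviates (fun i => (deg i)%:R) (eps * (a * al)) m.
pose P2 m := deviates (fun i => (deg i)%:R ^+ 2) (eps * a) m.
pose P3 m := deviates (fun=> 1) (eps * a) m.
pose P4 m := deviates (fun i => ph (deg i)) (eps * a) m.
pose P5 m := eps * n <= Yw (fun i => (deg i)%:R ^+ 3) T m.
pose P6 m := late_big vtx leaf_rule eta t2 T J m.
apply: le_trans (SU P1 (fun m => [|| P2 m, P3 m, P4 m, P5 m | P6 m])) _.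
apply: le_trans (lerD e1 (SU P2 (fun m => [|| P3 m, P4 m, P5 m | P6 m]))) _.
have u3 := SU P3 (fun m => [|| P4 m, P5 m | P6 m]).
have u4 := SU P4 (fun m => P5 m || P6 m).
have u5 := SU P5 P6.
have -> : (v * Th / eps ^+ 2 + 16 * c4 * lam / del ^+ 2) / (a * al ^+ 2)
    + v * Th * (Dl + 2) / eps ^+ 2 / a + v * Th / eps * al =
   v * Th / eps ^+ 2 / (a * al ^+ 2) + v * Th * Dl / eps ^+ 2 / a +
   v * Th / eps ^+ 2 / a + v * Th / eps ^+ 2 / a + v * Th / eps * al +
   16 * c4 * lam / del ^+ 2 / (a * al ^+ 2) by ring.
rewrite ![(_ + _) * F]mulrDl.
have {}e2 : S P2 <= v * Th * Dl / eps ^+ 2 / a * F := e2.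
have {}e3 : S P3 <= v * Th / eps ^+ 2 / a * F := e3.
have {}e4 : S P4 <= v * Th / eps ^+ 2 / a * F := e4.
have {}e5 : S P5 <= v * Th / eps * al * F := e5.
have {}e6 : S P6 <= 16 * c4 * lam / del ^+ 2 / (a * al ^+ 2) * F := e6.
move: e2 e3 e4 e5 e6 u3 u4 u5.
set x2 := S P2; set x3 := S P3; set x4 := S P4; set x5 := S P5; set x6 := S P6.
set x34 := S (fun m => P3 m || _); set x45 := S (fun m => P4 m || _).
set x56 := S (fun m => P5 m || _).
set y1 := _ * F; set y2 := _ * F; set y3 := _ * F; set y4 := _ * F; set y5 := _ * F.
by move=> *; lra.
Qed.

End LeafRule.

(** * Matchings and graphs *)

Local Close Scope ring_scope.

Lemma set2_eq (T : finType) (a b x y : T) : [set a; b] = [set x; y] ->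
  (a = x /\ b = y) \/ (a = y /\ b = x).
Proof.
move=> E.
have : a \in [set x; y] by rewrite -E !inE eqxx.
have : b \in [set x; y] by rewrite -E !inE eqxx orbT.
have : x \in [set a; b] by rewrite E !inE eqxx.
have : y \in [set a; b] by rewrite E !inE eqxx orbT.
by rewrite !inE => /orP[]/eqP ? /orP[]/eqP ? /orP[]/eqP ? /orP[]/eqP ?;
  first [left; split; congruence | right; split; congruence].
Qed.

(** Choosing the unique mate is an involution by symmetry. This recovers a permutation both from the
    blocks of a partition and from a simple graph. *)
Lemma mate_exists (H : finType) (r : rel H) : symmetric r ->
  (forall h, exists2 h', r h h' & h' != h) ->
  (forall h x y, r h x -> x != h -> r h y -> y != h -> x = y) ->
  exists2 m : {perm H}, m \in fpf H & forall h, r h (m h).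
Proof.
move=> rs rex run.
pose f h := odflt h [pick x | r h x && (x != h)].
have fP h : r h (f h) /\ f h != h.
  rewrite /f; case: pickP => [x /andP[]//|no].
  by have [x rx xh] := rex h; have := no x; rewrite rx xh.
have fK : involutive f.
  move=> h; have [r1 n1] := fP h; have [r2 n2] := fP (f h).
  by apply: (run (f h)) => //; rewrite 1?rs // eq_sym.
exists (perm (can_inj fK)); last by move=> h; rewrite permE; have [] := fP h.
by apply/fpfP => h; rewrite !permE fK; split=> //; have [] := fP h.
Qed.

Section Blocks.
Variables (n : nat) (d : 'I_n -> nat).
Local Notation H := (half_edge d).
Local Notation vtx := (fun h : H => tag h).
Local Notation deg := (deg vtx).

Lemma half_edge_eq (h h' : H) : tag h = tag h' ->
  (tagged h : nat) = (tagged h' : nat) -> h = h'.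
Proof.
by case: h h' => i x [j y] /= ij; subst j => /val_inj ->.
Qed.

Lemma deg_half_edge i : deg i = d i.
Proof.
rewrite degE -[RHS](card_ord (d i)) -cardsT.
have -> : [set h : H | tag h == i] =
    [set Tagged (fun i => 'I_(d i)) x | x in [set: 'I_(d i)]].
  apply/setP => h; rewrite inE; apply/eqP/imsetP => [<-|[x _ ->]//].
  by exists (tagged h); rewrite ?inE //; case: h.
apply: card_imset => x y E.
by apply: val_inj; have := congr1 (fun h : H => (tagged h : nat)) E.
Qed.

(** On [fpf] this is a bijection onto [matchings d], so uniform counts transfer. *)
Definition blocks (m : {perm H}) : {set {set H}} := [set [set h; m h] | h : H].

Lemma in_blocks (m : {perm H}) h : [set h; m h] \in blocks m.
Proof. exact: imset_f. Qed.

Lemma blocks_in (m : {perm H}) B h : m \in fpf H -> B \in blocks m -> h \in B -> B = [set h; m h].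
Proof.
move=> mP /imsetP[x _ ->]; rewrite !inE => /orP[]/eqP -> //.
by rewrite fpfK // setUC.
Qed.

Lemma blocks_partition (m : {perm H}) : m \in fpf H -> partition (blocks m) [set: H].
Proof.
move=> mP; apply/and3P; split.
- rewrite eqEsubset subsetT /=; apply/subsetP => h _; apply/bigcupP.
  by exists [set h; m h]; rewrite ?in_blocks // !inE eqxx.
- apply/trivIsetP => B B' BP BP' BB'; rewrite -setI_eq0.
  apply: contraNT BB' => /set0Pn[h]; rewrite inE => /andP[hB hB'].
  by rewrite (blocks_in mP BP hB) (blocks_in mP BP' hB').
- by apply/imsetP => -[x _ /setP/(_ x)]; rewrite !inE eqxx.
Qed.

Lemma blocks_matching (m : {perm H}) : m \in fpf H -> blocks m \in matchings d.
Proof.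
move=> mP; rewrite inE blocks_partition //; apply/forall_inP => B /imsetP[h _ ->].
by rewrite cards2 [h == _]eq_sym fpf_neq.
Qed.

Lemma blocks_inj : {in fpf H &, injective blocks}.
Proof.
move=> m m' mP mP' E; apply/permP => h.
have : [set h; m h] \in blocks m' by rewrite -E in_blocks.
move=> /(blocks_in mP')/(_ (set21 _ _)) E2.
have : m h \in [set h; m' h] by rewrite -E2 !inE eqxx orbT.
by rewrite !inE (negPf (fpf_neq _ mP)) => /eqP.
Qed.

Lemma matchings_blocks : matchings d = blocks @: fpf H.
Proof.
apply/setP => M; apply/idP/imsetP => [|[m mP ->]]; last exact: blocks_matching.
rewrite inE => /andP[MP /forall_inP M2].
have [/eqP Mc Mt M0] := and3P MP.
have hM h : h \in cover M by rewrite Mc inE.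
have bM h : pblock M h \in M by apply: pblock_mem.
have hb h : h \in pblock M h by rewrite mem_pblock.
have sb h x : x \in pblock M h -> pblock M x = pblock M h.
  by move=> xh; apply: def_pblock.
have two h : exists2 x, x != h & pblock M h = [set h; x].
  have /cards2P[a [b [ab E]]] := M2 _ (bM h).
  have := hb h; rewrite E !inE => /orP[]/eqP ->.
    by exists b; rewrite // eq_sym.
  by exists a; rewrite // setUC.
have [m mP mE] : exists2 m : {perm H}, m \in fpf H & forall h, m h \in pblock M h.
  apply: (@mate_exists H (fun h x => x \in pblock M h)).
  - by move=> h x; apply/idP/idP => /sb E; rewrite -?E ?hb // E hb.
  - by move=> h; have [x xh E] := two h; exists x; rewrite // E !inE eqxx orbT.
  - move=> h x y; have [z zh ->] := two h; rewrite !inE => /orP[]/eqP-> //.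
      by rewrite eqxx.
    by move=> _ /orP[]/eqP-> //; rewrite eqxx.
have pE h : pblock M h = [set h; m h].
  have [x xh E] := two h; have := mE h; rewrite E !inE (negPf (fpf_neq _ mP)) /=.
  by move=> /eqP ->.
exists m => //; apply/setP => B; apply/idP/imsetP => [BM|[h _ ->]]; last by rewrite -pE.
have /card_gt0P[h hB] : 0 < #|B| by rewrite (eqP (M2 _ BM)).
by exists h; rewrite // -pE (def_pblock Mt BM hB).
Qed.

Definition edge (m : {perm H}) (h : H) : {set 'I_n} := [set tag h; tag (m h)].

Lemma image_block (m : {perm H}) h : [set tag x | x in [set h; m h]] = edge m h.
Proof. by rewrite imsetU !imset_set1. Qed.

Lemma mem_graph (m : {perm H}) e : e \in graph_of_matching (blocks m) ->
  exists h, e = edge m h.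
Proof.
by case/mapP => B; rewrite mem_enum => /imsetP[h _ ->] ->; exists h; rewrite image_block.
Qed.

Lemma edge_graph (m : {perm H}) h : edge m h \in graph_of_matching (blocks m).
Proof.
by apply/mapP; exists [set h; m h]; rewrite ?mem_enum ?in_blocks // image_block.
Qed.

Lemma adj_madj (m : {perm H}) : m \in fpf H -> adj (graph_of_matching (blocks m)) =2 madj vtx m.
Proof.
move=> mP i j; apply/idP/existsP => [/mem_graph[h /set2_eq[[-> ->]|[-> ->]]]|[h /andP[/eqP <- /eqP <-]]].
- by exists h; rewrite !eqxx.
- by exists (m h); rewrite fpfK // !eqxx.
- exact: edge_graph.
Qed.

(** The edges, with multiplicity, are indexed by the blocks, and these split the half-edges into
    pairs. *)
Lemma sum_graph (m : {perm H}) (f : {set 'I_n} -> nat) (g : H -> nat) : m \in fpf H ->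
  (forall h, f (edge m h) = g h + g (m h)) ->
  \sum_(e <- graph_of_matching (blocks m)) f e = \sum_h g h.
Proof.
move=> mP fg; rewrite /graph_of_matching big_map big_enum /=.
have <- : \sum_(h in [set: H]) g h = \sum_h g h by apply: eq_bigl => h; rewrite inE.
rewrite (set_partition_big _ (blocks_partition mP)) /=.
apply: eq_bigr => B /imsetP[h _ ->]; rewrite image_block fg.
by rewrite big_setU1 ?big_set1 // inE eq_sym fpf_neq.
Qed.

Lemma degree_graph (m : {perm H}) i : m \in fpf H -> degree (graph_of_matching (blocks m)) i = d i.
Proof.
move=> mP; rewrite -deg_half_edge /degree.
rewrite (sum_graph (g := fun h => tag h == i : nat) mP).
  by rewrite degE -sum1_card [RHS]big_mkcond /=; apply: eq_bigr => h _;
     rewrite inE; case: eqP.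
move=> h; rewrite /edge !inE ![i == _]eq_sym.
have [-> |hi] := eqVneq (tag h) i; have [->|mi] := eqVneq (tag (m h)) i.
- by rewrite setUid eqxx.
- case: eqP => [/setP/(_ (tag (m h)))|//]; rewrite !inE eqxx orbT.
  by rewrite (negPf mi).
- case: eqP => [/setP/(_ (tag h))|//]; rewrite !inE eqxx.
  by rewrite (negPf hi).
- case: eqP => [/setP/(_ (tag h))|//]; rewrite !inE eqxx.
  by rewrite (negPf hi).
Qed.

Lemma nedges_graph (m : {perm H}) B : m \in fpf H -> mclosed vtx m B ->
  2 * nedges (graph_of_matching (blocks m)) B = \sum_(i in B) d i.
Proof.
move=> mP Bc; rewrite /nedges -sum1_count big_mkcond /= big_distrr /=.
rewrite (sum_graph (g := fun h => tag h \in B : nat) mP).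
  have -> : \sum_(i in B) d i = \sum_(i in B) deg i.
    by apply: eq_bigr => i _; rewrite deg_half_edge.
  rewrite [RHS](sum_deg_nat vtx) -sum1_card [RHS]big_mkcond /=.
  by apply: eq_bigr => h _; rewrite inE; case: (tag h \in B).
move=> h; rewrite /edge subUset !sub1set.
have -> : (tag (m h) \in B) = (tag h \in B).
  by apply/idP/idP => /Bc //; rewrite fpfK.
by rewrite andbb; case: ifP.
Qed.

(** All that the study of components needs from a graph. The multigraph of [m] and, for simple [m],
    its edge set both satisfy it, so one proof serves both models. *)
Definition models (m : {perm H}) (G : mgraph 'I_n) : Prop :=
  [/\ adj G =2 madj vtx m, degree G =1 d &
      forall B, mclosed vtx m B -> 2 * nedges G B = \sum_(i in B) d i].

Lemma models_matching (m : {perm H}) : m \in fpf H -> models m (graph_of_matching (blocks m)).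
Proof.
move=> mP; split; first exact: adj_madj.
- by move=> i; apply: degree_graph.
- by move=> B; apply: nedges_graph.
Qed.

Local Notation simple := (simple_m vtx).

Lemma simpleP (m : {perm H}) : simple m ->
  (forall h, tag (m h) != tag h) /\
  (forall h h', tag h = tag h' -> tag (m h) = tag (m h') -> h = h').
Proof.
move=> /andP[/forallP h1 /forallP h2]; split=> // h h' E1 E2.
by have /forallP/(_ h') := h2 h; rewrite E1 E2 !eqxx => /eqP.
Qed.

Definition edge_set (m : {perm H}) : {set {set 'I_n}} := [set edge m h | h : H].

Lemma edge_set_perm (m : {perm H}) : m \in fpf H -> simple m ->
  perm_eq (graph_of_edges (edge_set m)) (graph_of_matching (blocks m)).
Proof.
move=> mP ms; have [L U] := simpleP ms; apply: uniq_perm; first exact: enum_uniq.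
  rewrite map_inj_in_uniq ?enum_uniq // => B B'; rewrite !mem_enum.
  case/imsetP => h _ -> /imsetP[h' _ ->]; rewrite !image_block.
  case/set2_eq => -[E1 E2]; first by rewrite (U _ _ E1 E2).
  have -> : h = m h' by apply: U => //; rewrite fpfK.
  by rewrite fpfK // setUC.
move=> e; rewrite mem_enum; apply/imsetP/idP => [[h _ ->]|/mem_graph[h ->]].
  exact: edge_graph.
by exists h.
Qed.

Lemma models_simple (m : {perm H}) : m \in fpf H -> simple m ->
  models m (graph_of_edges (edge_set m)).
Proof.
move=> mP ms; have pe := edge_set_perm mP ms.
have [a1 a2 a3] := models_matching mP; split.
- by move=> i j; rewrite -a1 /adj (perm_mem pe).
- by move=> i; rewrite -a2 /degree (perm_big _ pe).
- by move=> B /a3 <-; rewrite /nedges (seq.permP pe).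
Qed.

Lemma edge_set_simple (m : {perm H}) : m \in fpf H -> simple m -> edge_set m \in simple_graphs d.
Proof.
move=> mP ms; have [L _] := simpleP ms; have [_ dg _] := models_simple mP ms.
rewrite inE; apply/andP; split.
  by apply/forall_inP => e /imsetP[h _ ->]; rewrite cards2 [tag h == _]eq_sym L.
by apply/forallP => i; rewrite -[enum _]/(graph_of_edges _) dg.
Qed.

(** The group permuting the half-edges at each vertex. Acting by conjugation, it has the fibres of
    [edge_set] over simple graphs as free orbits. *)
Definition tag_perms : {set {perm H}} := [set g : {perm H} | [forall h, tag (g h) == tag h]].

Lemma tag_permsP (g : {perm H}) : reflect (forall h, tag (g h) = tag h) (g \in tag_perms).
Proof. by rewrite inE; apply: (iffP forallP) => gP h; apply/eqP/gP. Qed.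

Lemma simple_conj (m g : {perm H}) : m \in fpf H -> simple m -> g \in tag_perms ->
  [/\ (m ^ g)%g \in fpf H, simple (m ^ g)%g & edge_set (m ^ g)%g = edge_set m].
Proof.
move=> mP ms /tag_permsP gP; have [L U] := simpleP ms.
have JE h : (m ^ g)%g (g h) = g (m h) by rewrite permJ.
have gK h : exists h', h = g h' by exists (g^-1%g h); rewrite permKV.
split.
- apply/fpfP => h; have [x ->] := gK h; rewrite !JE fpfK //; split=> //.
  by rewrite (inj_eq perm_inj) fpf_neq.
- apply/andP; split.
    by apply/forallP => h; have [x ->] := gK h; rewrite JE !gP.
  apply/forallP => h; apply/forallP => h'; have [x ->] := gK h; have [y ->] := gK h'.
  rewrite !JE !gP; apply/implyP => /andP[/eqP E1 /eqP E2].
  by rewrite (U _ _ E1 E2).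
- apply/setP => e; apply/imsetP/imsetP => -[h _ ->].
    by have [x ->] := gK h; exists x; rewrite // /edge JE !gP.
  by exists (g h); rewrite // /edge JE !gP.
Qed.

(** In a simple matching a half-edge is determined by its own vertex and that of its partner. *)
Lemma simple_free (m g g' : {perm H}) : m \in fpf H -> simple m -> g \in tag_perms ->
  g' \in tag_perms -> (m ^ g)%g = (m ^ g')%g -> g = g'.
Proof.
move=> mP ms gP gP' E; have [_ ms' _] := simple_conj mP ms gP.
have [_ U] := simpleP ms'; move/tag_permsP: gP => gP; move/tag_permsP: gP' => gP'.
apply/permP => h; apply: U; first by rewrite gP gP'.
by rewrite permJ E permJ gP gP'.
Qed.

(** Each half-edge is sent to the one at the same vertex that leads, under [m'], to the same
    neighbour. *)
Lemma simple_transitive (m m' : {perm H}) : m \in fpf H -> simple m -> m' \in fpf H ->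
  simple m' -> edge_set m = edge_set m' -> exists2 g, g \in tag_perms & m' = (m ^ g)%g.
Proof.
move=> mP ms mP' ms' E; have [L U] := simpleP ms; have [L' U'] := simpleP ms'.
have ex h : exists x, (tag x == tag h) && (tag (m' x) == tag (m h)).
  have : edge m h \in edge_set m' by rewrite -E imset_f.
  case/imsetP => x _ /set2_eq[[-> ->]|[-> ->]]; first by exists x; rewrite !eqxx.
  by exists (m' x); rewrite fpfK // !eqxx.
pose f h := xchoose (ex h).
have fP h : tag (f h) = tag h /\ tag (m' (f h)) = tag (m h).
  by have /andP[/eqP ? /eqP ?] := xchooseP (ex h).
have fI : injective f.
  move=> x y fxy; have [x1 x2] := fP x; have [y1 y2] := fP y.
  by apply: U; [rewrite -x1 fxy|rewrite -x2 fxy].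
exists (perm fI); first by apply/tag_permsP => h; rewrite permE; have [] := fP h.
apply/permP => y; have [x ->] : exists x, y = perm fI x.
  by exists ((perm fI)^-1%g y); rewrite permKV.
rewrite permJ !permE; have [x1 x2] := fP x; have [z1 z2] := fP (m x).
by apply: U'; [rewrite z1|rewrite fpfK // z2 fpfK].
Qed.

(** The half-edges at [i] are labelled by the edges at [i] in the order of [enum], and two
    half-edges with the same label are matched. *)
Lemma simple_exists E : E \in simple_graphs d ->
  exists m, [/\ m \in fpf H, simple m & edge_set m = E].
Proof.
rewrite inE => /andP[/forall_inP E2 /forallP Ed].
pose Ei i := enum [set e in E | i \in e].
have szEi i : size (Ei i) = d i.
  rewrite -(eqP (Ed i)) /degree -cardE -sum1_card big_enum /= big_mkcond.
  rewrite [RHS]big_mkcond /=; apply: eq_bigr => e _; rewrite inE.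
  case eE: (e \in E) => //=; have /eqP e2 := E2 _ eE.
  have [eq|_] := eqVneq e [set i]; first by rewrite eq cards1 in e2.
  by case: (i \in e).
pose g (h : H) := nth set0 (Ei (tag h)) (tagged h).
have gm h : g h \in Ei (tag h) by apply: mem_nth; rewrite szEi.
have gE h : g h \in E by have := gm h; rewrite mem_enum inE => /andP[].
have tg h : tag h \in g h by have := gm h; rewrite mem_enum inE => /andP[].
have gU h h' : tag h = tag h' -> g h = g h' -> h = h'.
  case: h h' => i x [j y] /= ij; subst j => gg; apply: half_edge_eq => //=.
  apply/eqP; rewrite -(@nth_uniq _ set0 (Ei i)) ?szEi // ?enum_uniq //.
  by apply/eqP.
have gS e i : e \in E -> i \in e -> exists2 h, tag h = i & g h = e.
  move=> eE ie; have ei : e \in Ei i by rewrite mem_enum inE eE.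
  have lt : index e (Ei i) < d i by rewrite -szEi index_mem.
  exists (Tagged (fun i => 'I_(d i)) (Ordinal lt)) => //.
  by rewrite /g /= nth_index.
have other h : exists2 h', g h' = g h & (h' != h) && (g h == [set tag h; tag h']).
  have /cards2P[a [b [ab Eg]]] := E2 _ (gE h).
  have [k kh gk] : exists2 k, k != tag h & g h = [set tag h; k].
    have := tg h; rewrite Eg !inE => /orP[]/eqP ->.
      by exists b; rewrite // eq_sym.
    by exists a; rewrite // setUC.
  have kg : k \in g h by rewrite gk !inE eqxx orbT.
  have [h' th' gh'] := gS _ _ (gE h) kg; exists h' => //.
  by rewrite gk th' eqxx andbT; apply: contraNneq kh => <-; rewrite th'.
have [m mP mg] : exists2 m : {perm H}, m \in fpf H & forall h, g h == g (m h).
  apply: (@mate_exists H (fun h x => g h == g x)).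
  - by move=> h x; rewrite eq_sym.
  - by move=> h; have [x gx /andP[xh _]] := other h; exists x; rewrite // gx.
  - move=> h x y /eqP hx xh /eqP hy yh.
    have [z gz /andP[zh /eqP E1]] := other h.
    have key w : g h = g w -> w != h -> w = z.
      move=> hw wh; have := tg w; rewrite -hw E1 !inE => /orP[]/eqP tw.
        by rewrite (gU w h) ?eqxx // in wh.
      by apply: gU => //; rewrite -hw gz.
    by rewrite (key x) // (key y).
have eg h : edge m h = g h.
  have [z gz /andP[zh /eqP E1]] := other h.
  have hm := eqP (mg h); have := tg (m h); rewrite -hm E1 !inE => /orP[]/eqP tm.
    have := fpf_neq h mP; rewrite (gU (m h) h) ?eqxx //.
  by rewrite /edge tm.
have ms : simple m.
  apply/andP; split.
    apply/forallP => h; have := E2 _ (gE h); rewrite -eg /edge cards2 [tag h == _]eq_sym.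
    by case: (tag (m h) == tag h).
  apply/forallP => h; apply/forallP => h'; apply/implyP => /andP[/eqP t1 /eqP t2].
  by apply/eqP/gU => //; rewrite -!eg /edge t1 t2.
exists m; split=> //; apply/setP => e; apply/imsetP/idP => [[h _ ->]|eE].
  by rewrite eg gE.
have /card_gt0P[i ie] : 0 < #|e| by rewrite (eqP (E2 _ eE)).
by have [h _ gh] := gS _ _ eE ie; exists h; rewrite // eg.
Qed.

Lemma simple_fibre (P : pred {set {set 'I_n}}) :
  #|[set m in fpf H | simple m && P (edge_set m)]| =
  #|[pred E in simple_graphs d | P E]| * #|tag_perms|.
Proof.
rewrite -sum1_card (partition_big edge_set [pred E in simple_graphs d | P E]) /=; last first.
  by move=> m; rewrite in_set => /and3P[mP ms Pm]; rewrite edge_set_simple.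
rewrite -sum_nat_const; apply: eq_bigr => E /andP[EP PE].
have [m0 [mP0 ms0 E0]] := simple_exists EP.
have inj : {in tag_perms &, injective (fun g => m0 ^ g)%g}.
  by move=> g g' gP gP'; apply: simple_free.
rewrite -(card_in_imset inj) -sum1_card; apply: eq_bigl => m; rewrite in_set.
apply/idP/imsetP => [/andP[/and3P[mP ms _] /eqP mE]|[g gP ->]].
  have [g gP ->] := simple_transitive mP0 ms0 mP ms (etrans E0 (esym mE)).
  by exists g.
have [-> -> ->] := simple_conj mP0 ms0 gP.
by rewrite E0 PE eqxx.
Qed.

End Blocks.

Local Open Scope ring_scope.

Lemma ndeg_sum (R : nmodType) n (d : 'I_n -> nat) (g : nat -> R) K :
  \sum_(k < K) g k *+ ndeg d k = \sum_(i < n | (d i < K)%N) g (d i).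
Proof.
case: K => [|K]; first by rewrite big_ord0 big_pred0.
rewrite (partition_big (fun i => inord (d i) : 'I_K.+1) xpredT) //=.
apply: eq_bigr => k _; rewrite /ndeg -sumr_const.
apply: eq_big => [i|i]; last by rewrite inE => /eqP ->.
rewrite inE; apply/eqP/andP => [ik|[iK /eqP <-]]; last by rewrite inordK.
by rewrite ik; split=> //; apply/eqP/val_inj; rewrite /= inordK.
Qed.


(** * From classes of a matching to the largest components *)

Section Good.
Variables (n : nat) (d : 'I_n -> nat) (R : realFieldType).
Local Notation H := (half_edge d).
Local Notation vtx := (fun h : H => tag h).
Implicit Type m : {perm H}.

Definition cls m (i : 'I_n) : {set 'I_n} := [set k | connect (madj vtx m) i k].

Definition good (e th r a : R) (k : nat) m : bool :=
  [exists v0, [&& `|#|cls m v0|%:R - th * a| <= e * a,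
    `|#|[set i in cls m v0 | d i == k]|%:R - r * (th * a)| <= e * a,
    `|(\sum_(i in cls m v0) d i)%:R - 2 * (th * a)| <= e * a &
    [forall i, (i \notin cls m v0) ==>
       ((\sum_(j in cls m i) d j)%:R <= e * a)]]].

Section Components.
Variables (m : {perm H}) (G : mgraph 'I_n).
Hypothesis mP : m \in fpf H.
Hypothesis mG : models m G.

Let csym : connect_sym (madj vtx m) := sym_connect_sym (madj_sym vtx mP).

Lemma cls_eq i j : j \in cls m i -> cls m j = cls m i.
Proof.
rewrite inE => ij; apply/setP => k; rewrite !inE.
by rewrite (same_connect csym ij).
Qed.

Lemma componentsE : components G = [set cls m i | i : 'I_n].
Proof.
have [adjE _ _] := mG; rewrite /components /equivalence_partition.
apply/setP => C; apply/imsetP/imsetP => -[i _ ->]; exists i; rewrite ?inE //;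
  by apply/setP => k; rewrite !inE (eq_connect adjE).
Qed.

Lemma cls_closed i : mclosed vtx m (cls m i).
Proof.
move=> h; rewrite !inE => ih; apply: connect_trans ih _; apply: connect1.
by apply/existsP; exists h; rewrite !eqxx.
Qed.

Lemma cls_deg i : (2 * nedges G (cls m i) = \sum_(j in cls m i) d j)%N.
Proof. by have [_ _ ->] := mG; last exact: cls_closed. Qed.

Lemma cls_isolated j k : d j = 0%N -> connect (madj vtx m) j k -> k = j.
Proof.
move=> dj /connectP[[|l q] /=]; first by move=> _ ->.
case/andP => /existsP[h /andP[/eqP hj _]] _ _; exfalso.
have : (0 < d (tag h))%N by apply: leq_ltn_trans (ltn_ord (tagged h)).
by rewrite hj dj.
Qed.

(** The 1 is for an isolated vertex, alone in its class; in any other class all degrees are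
    positive. *)
Lemma card_cls i : (#|cls m i| <= 1 + \sum_(j in cls m i) d j)%N.
Proof.
have [/exists_inP[j ji /eqP dj]|/exists_inPn dpos] :=
    boolP [exists j in cls m i, d j == 0%N].
  rewrite -(cls_eq ji); apply: leq_trans (leq_addr _ _).
  rewrite -(cards1 j); apply/subset_leq_card/subsetP => k; rewrite !inE.
  by move/(cls_isolated dj) => ->.
apply: leq_trans (leq_addl _ _); rewrite -sum1_card; apply: leq_sum => j ji.
by rewrite lt0n; apply: dpos.
Qed.

Variables (e th r a : R) (k : nat) (C1 C2 : {set 'I_n}).
Hypothesis a_gt0 : 0 < a.
Hypothesis ea_ge1 : 1 <= e * a.
Hypothesis e_th : 3 * e < th.
Hypothesis gm : good e th r a k m.
Hypothesis C1P : is_largest (components G) C1.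
Hypothesis C2P : is_largest (components G :\ C1) C2.

(** By [card_cls] a class other than that of [v0] has at most [1 + e * a] vertices, hence at most
    [2 * (e * a)], fewer than that of [v0] since [3 * e < th]. So [C1] is forced, while [C2] is
    another class, or empty if there is none. *)
Lemma good_components :
  [/\ `|(nvertices C1)%:R - th * a| <= e * a,
      `|(nvertices_deg G k C1)%:R - r * (th * a)| <= e * a,
      `|(nedges G C1)%:R - th * a| <= e * a,
      (nvertices C2)%:R <= 2 * (e * a) &
      (nedges G C2)%:R <= e * a].
Proof.
have ea0 : 0 <= e * a by apply: le_trans ea_ge1.
have [_ dE _] := mG; case/existsP: gm => v0 /and4P[g1 g2 g3 /forallP g4].
have v0C : cls m v0 \in components G by rewrite componentsE imset_f.
have small i : i \notin cls m v0 -> (\sum_(j in cls m i) d j)%:R <= e * a.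
  by move=> iv; have := g4 i; rewrite iv.
have small_card i : i \notin cls m v0 -> #|cls m i|%:R <= 2 * (e * a).
  move=> /small sm; apply: (@le_trans _ _ (1 + \sum_(j in cls m i) d j)%:R).
    by rewrite ler_nat card_cls.
  by rewrite natrD; have := ea_ge1; lra.
have big : 2 * (e * a) < #|cls m v0|%:R.
  move: g1; rewrite ler_norml => /andP[h _].
  have : 3 * e * a < th * a by rewrite ltr_pM2r.
  lra.
have C1E : C1 = cls m v0.
  move: C1P; rewrite /is_largest; case: ifP => [/eqP C0|_ [C1c C1max]].
    by rewrite C0 inE in v0C.
  move: C1c; rewrite componentsE => /imsetP[i _ E].
  have [iv|iv] := boolP (i \in cls m v0); first by rewrite E (cls_eq iv).
  have := C1max _ v0C; rewrite E -(ler_nat R) => h.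
  by have := lt_le_trans big (le_trans h (small_card _ iv)); rewrite ltxx.
have nedgesE i : (nedges G (cls m i))%:R = (\sum_(j in cls m i) d j)%:R / 2 :> R.
  by rewrite -cls_deg natrM mulrC mulKf // pnatr_eq0.
have C2S : C2 = set0 \/ exists2 i, i \notin cls m v0 & C2 = cls m i.
  move: C2P; rewrite /is_largest; case: ifP => [_ ->|_ [C2c _]]; first by left.
  right; move: C2c; rewrite !inE C1E componentsE => /andP[ne /imsetP[i _ E]].
  by exists i => //; apply: contraNN ne => iv; rewrite E (cls_eq iv).
split.
- by rewrite C1E.
- rewrite C1E; have -> : nvertices_deg G k (cls m v0) = #|[set i in cls m v0 | d i == k]|.
    by apply: eq_card => i; rewrite !inE dE.
  exact: g2.
- rewrite C1E nedgesE; move: g3; rewrite !ler_norml => /andP[h1 h2].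
  by clear C1E C2S nedgesE; apply/andP; split; lra.
- case: C2S => [->|[i iv ->]]; last exact: small_card.
  by rewrite /nvertices cards0 mulr_ge0.
- case: C2S => [->|[i iv ->]]; last first.
    rewrite nedgesE; apply: le_trans (small _ iv).
    by rewrite ler_pdivrMr // ler_peMr // ler1n.
  suff -> : nedges G set0 = 0%N by [].
  have [_ _ /(_ set0)] := mG; rewrite big_set0 => E.
  have : (2 * nedges G set0 = 0)%N by apply: E => h; rewrite inE.
  by move/eqP; rewrite muln_eq0 /= => /eqP.
Qed.

End Components.

Lemma card_matchings (E : pred {set {set H}}) :
  #|[pred w in matchings d | E w]| = #|[set m in fpf H | E (blocks m)]|.
Proof.
have inj : {in [set m in fpf H | E (blocks m)] &, injective (@blocks n d)}.
  by move=> x y; rewrite !in_set => /andP[xP _] /andP[yP _]; apply: blocks_inj;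
     rewrite ?in_set.
rewrite -(card_in_imset inj); apply: eq_card => w; rewrite [LHS]inE matchings_blocks.
apply/andP/imsetP => [[/imsetP[m mP ->] Em]|[m]].
  by exists m; rewrite // in_set mP.
rewrite in_set => /andP[mP Em] ->; split=> //.
by apply/imsetP; exists m.
Qed.

Lemma card_matchingsT : #|matchings d| = #|fpf H|.
Proof.
by rewrite matchings_blocks card_in_imset //; apply: blocks_inj.
Qed.

End Good.

(** * Counting bounds for a fixed degree sequence *)

Section Core.
Variables (n : nat) (d : 'I_n -> nat) (R : realFieldType).
Local Notation H := (half_edge d).
Local Notation vtx := (fun h : H => tag h).

Definition nmatch : nat := #|fpf H|.
Definition nbad (e th r a : R) (k : nat) : nat :=
  #|[set m in fpf H | ~~ good e th r a k m]|.
Definition nsimple : nat := #|[set m in fpf H | simple_m vtx m]|.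

Lemma unif_matchings (e th r a : R) k (E : pred {set {set H}}) :
  (forall m, m \in fpf H -> E (blocks m) -> ~~ good e th r a k m) ->
  (#|[pred w in matchings d | E w]| <= nbad e th r a k)%N.
Proof.
move=> Eg; rewrite card_matchings; apply/subset_leq_card/subsetP => m.
by rewrite !in_set => /andP[mP /Eg -> //]; rewrite ?in_set mP.
Qed.

Lemma unif_simple (e th r a : R) k (E : pred {set {set 'I_n}}) :
  (forall m, m \in fpf H -> simple_m vtx m -> E (edge_set m) -> ~~ good e th r a k m) ->
  (#|[pred w in simple_graphs d | E w]| * #|tag_perms d| <= nbad e th r a k)%N.
Proof.
move=> Eg; rewrite -simple_fibre; apply/subset_leq_card/subsetP => m.
by rewrite !in_set => /and3P[mP ms Em]; rewrite mP Eg // in_set.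
Qed.

Lemma card_simple : (#|simple_graphs d| * #|tag_perms d| = nsimple)%N.
Proof.
transitivity (#|[pred w in simple_graphs d | xpredT w]| * #|tag_perms d|)%N.
  by congr (_ * _)%N; apply: eq_card => w; rewrite [RHS]inE andbT.
by rewrite -simple_fibre; apply: eq_card => m; rewrite !in_set andbT.
Qed.

Lemma card_tag_perms : (0 < #|tag_perms d|)%N.
Proof. by apply/card_gt0P; exists 1%g; apply/tag_permsP => h; rewrite perm1. Qed.

Lemma card_half_edge : #|{: H}| = (\sum_i d i)%N.
Proof.
rewrite -[LHS]cardsT; have := sum_deg_nat vtx xpredT => /= E.
have -> : [set: H] = [set h : H | true] by apply/setP => h; rewrite !inE.
by rewrite -E; apply: eq_bigr => i _; rewrite deg_half_edge.
Qed.

Section Bound.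
Variables (a al lam rho del eps r c4 Dl e : R) (T t2 J k : nat).
Local Notation kap := (rho - 4).
Local Notation th := (2 / kap).
Local Notation Th := (2 / kap + 1).
Local Notation C1 := (drift_const lam Th rho (1 + Th)).
Local Notation Cone := (drift_const lam Th 1 (1 + Th)).
Local Notation Cph := (drift_const lam Th r (1 + Th)).
Local Notation Cc := (crude_const lam Th rho C1).
Local Notation Cw := (walk_const lam Th rho C1).
Hypothesis n_gt0 : 0 < n%:R :> R.
Hypothesis aE : a = n%:R * al.
Hypothesis al_gt0 : 0 < al.
Hypothesis al_eps : al <= eps.
Hypothesis eps_le1 : eps <= 1.
Hypothesis one_le : 1 <= eps * (a * al).
Hypothesis lam_gt0 : 0 < lam.
Hypothesis rho_gt4 : 4 < rho.
Hypothesis r_ge0 : 0 <= r.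
Hypothesis N_approx : `|(\sum_i d i)%:R - lam * n%:R| <= eps * n%:R.
Hypothesis cube_approx :
  `|\sum_i ((d i)%:R : R) ^+ 3 - rho * (lam * n%:R)| <= eps * n%:R.
Hypothesis k_approx : `|(k * ndeg d k)%:R - r * (lam * n%:R)| <= eps * n%:R.
Hypothesis sqrE : \sum_i ((d i)%:R : R) ^+ 2 = 2 * (\sum_i d i)%:R + a.
Hypothesis eps_small : (1 + 2 * Th) * eps <= lam / 2.
Hypothesis eps_crude : (1 + Cc) * eps <= 1.
Hypothesis eps_lam : eps <= lam.
Hypothesis eps_del : 2 * lam * ((2 * Cw + 1) * eps) < del.
Hypothesis eps_del2 : lam * (Cw * eps) < kap * del ^+ 2 / 2.
Hypothesis eps_del3 : (C1 + Cone + Cph + Cc + 3) * eps <= del.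
Hypothesis del_gt0 : 0 < del.
Hypothesis del_small : (2 * kap + 5) * del <= 3 / 4.
Hypothesis t2_le : t2%:R <= (th - del) * a.
Hypothesis t2_ge : (th - del) * a - 1 <= t2%:R.
Hypothesis T_le : T%:R <= (th + del) * a.
Hypothesis T_ge : (th + del / 2) * a <= T%:R.
Hypothesis J_le : J%:R <= del * a.
Hypothesis J_ge : del * a / 2 <= J%:R.
Hypothesis TJ : (2 * (T + J) <= \sum_i d i)%N.
Hypothesis T_leaves : (2 * T <= ndeg d 1)%N.
Hypothesis c4_ge0 : 0 <= c4.
Hypothesis Dl_ge0 : 0 <= Dl.
Hypothesis fourth_le : \sum_i ((d i)%:R : R) ^+ 4 <= c4 * n%:R.
Hypothesis d_le : forall i, (d i)%:R <= Dl.
Hypothesis e_ge1 : 6 * del <= e.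
Hypothesis e_ge2 : (4 + 2 * r) * del <= e.

Lemma core_bound : (nbad e th r a k)%:R <=
   ((2 * c4 / lam * Th / eps ^+ 2 + 16 * c4 * lam / del ^+ 2) / (a * al ^+ 2)
    + 2 * c4 / lam * Th * (Dl + 2) / eps ^+ 2 / a + 2 * c4 / lam * Th / eps * al)
   * nmatch%:R.
Proof.
have kap0 : 0 < kap by rewrite subr_gt0.
have a0 : 0 < a by rewrite aE mulr_gt0.
have T0 : (0 < T)%N.
  rewrite -(ltr_nat R); apply: lt_le_trans T_ge.
  by rewrite mulr_gt0 // addr_gt0 ?divr_gt0.
have : (0 < #|{: H}|)%N.
  by rewrite card_half_edge; apply: leq_trans TJ; rewrite muln_gt0 addn_gt0 T0.
case/card_gt0P => h0 _.
pose ph (q : nat) : R := (q == k)%:R.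
have degs (f : nat -> R) : \sum_i f (deg vtx i) = \sum_i f (d i).
  by apply: eq_bigr => i _; rewrite deg_half_edge.
have lv : (2 * T <= #|[set i | deg vtx i == 1%N]|)%N.
  apply: leq_trans T_leaves _; apply: eq_leq.
  by apply: eq_card => i; rewrite !inE deg_half_edge.
have NA : `|#|H|%:R - lam * n%:R| <= eps * n%:R by rewrite card_half_edge.
have CA : `|\sum_i ((deg vtx i)%:R : R) ^+ 3 - rho * (lam * n%:R)| <= eps * n%:R.
  by rewrite (degs (fun q => q%:R ^+ 3)).
have PA : `|\sum_i ph (deg vtx i) * (deg vtx i)%:R - r * (lam * n%:R)| <= eps * n%:R.
  rewrite (degs (fun q => ph q * q%:R)); apply: le_trans k_approx.
  rewrite le_eqVlt; apply/orP; left; apply/eqP; congr `|_ - _|.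
  rewrite natrM mulrC /ndeg mulr_natl -sumr_const [RHS]big_mkcond /=.
  apply: eq_bigr => i _; rewrite inE /ph.
  by have [->|_] := eqVneq (d i) k; rewrite ?mul1r ?mul0r.
have SA : \sum_i ((deg vtx i)%:R : R) ^+ 2 = 2 * #|H|%:R + a.
  by rewrite (degs (fun q => q%:R ^+ 2)) card_half_edge.
have TJH : (2 * (T + J) <= #|H|)%N by rewrite card_half_edge.
have FA : \sum_i ((deg vtx i)%:R : R) ^+ 4 <= c4 * n%:R.
  by rewrite (degs (fun q => q%:R ^+ 4)).
have DA i : (deg vtx i)%:R <= Dl by rewrite deg_half_edge.
have ph01 q : 0 <= ph q <= 1 by rewrite /ph; case: eqP; rewrite ?ler01 ?lexx.
have eta2 : al / (8 * lam) <= 2.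
  rewrite ler_pdivrMr ?mulr_gt0 //; apply: le_trans al_eps _.
  by apply: le_trans eps_lam _; rewrite mulrA ler_peMl ?(ltW lam_gt0) // -natrM ler1n.
have bd := atypical_bound h0 lv t2 n_gt0 aE al_gt0 al_eps lam_gt0 rho_gt4 ph01
  NA eps_small del_gt0 del_small T_le J_ge TJH c4_ge0 Dl_ge0 FA DA eta2.
apply: le_trans bd; rewrite ler_nat; apply/subset_leq_card/subsetP => m.
rewrite in_set => /andP[mP]; apply: contraR; rewrite in_set mP /= => typ.
have [v0 [g1 g2 g3 g4]] := typical_giant lv n_gt0 aE al_gt0 al_eps eps_le1 one_le
  lam_gt0 rho_gt4 r_ge0 ph01 NA CA PA SA eps_small eps_crude eps_lam eps_del eps_del2
  eps_del3 del_gt0 del_small t2_le t2_ge T_le T_ge J_le TJH mP typ.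
have e1 : 6 * (del * a) <= e * a by rewrite mulrA ler_pM2r.
have e2 : (4 + 2 * r) * (del * a) <= e * a by rewrite mulrA ler_pM2r.
have e3 : 2 * (del * a) <= e * a.
  apply: le_trans e1; rewrite ler_wpM2r ?ler_nat // ltW // mulr_gt0 //.
apply/existsP; exists v0; apply/and4P; split.
- exact: le_trans e1.
- apply: le_trans e2; apply: le_trans g2; rewrite le_eqVlt; apply/orP; left.
  apply/eqP; congr `|_ - _|; rewrite -sum1_card natr_sum big_mkcond [RHS]big_mkcond /=.
  apply: eq_bigr => i _; rewrite !in_set deg_half_edge /ph.
  by case: (connect _ _ _) => //=; case: eqP.
- apply: le_trans e1; apply: le_trans g3; rewrite le_eqVlt; apply/orP; left.
  by apply/eqP; congr `|_%:R - _|; apply: eq_bigr => i _; rewrite deg_half_edge.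
- apply/forallP => i; apply/implyP => /g4 h; apply: le_trans e3; apply: le_trans h.
  rewrite le_eqVlt; apply/orP; left; apply/eqP; congr _%:R.
  by apply: eq_bigr => j _; rewrite deg_half_edge.
Qed.

End Bound.

Lemma simple_core (Delta : nat) : (forall i, (d i <= Delta)%N) ->
  (4 <= \sum_i d i)%N ->
  4 * ((2 * Delta)%:R * (\sum_i d i - 1)%:R^-1 +
     (4 * Delta * (\sum_i d i ^ 2))%:R *
       ((\sum_i d i - 1)%:R^-1 * (\sum_i d i - 3)%:R^-1)) <= 4^-1 :> R ->
  nmatch%:R <= (\prod_(j in bad_set vtx) (1 + 4 * qw (@bad_ev H) R j)) * nsimple%:R /\
  \sum_(j in bad_set vtx) qw (@bad_ev H) R j <=
    (\sum_i d i - 1)%:R^-1 * ((\sum_i d i ^ 2)%:R +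
      ((\sum_i d i ^ 2) ^ 2)%:R * (\sum_i d i - 3)%:R^-1).
Proof.
move=> dD N4 cb.
have QE : (\sum_i deg vtx i ^ 2 = \sum_i d i ^ 2)%N.
  by apply: eq_bigr => i _; rewrite deg_half_edge.
have dD' i : (deg vtx i <= Delta)%N by rewrite deg_half_edge.
have H4 : (4 <= #|H|)%N by rewrite card_half_edge.
split.
  have cb' : confbound vtx R Delta <= 4^-1 by rewrite /confbound QE card_half_edge.
  by have [P ->] := simple_bound dD' H4 cb'.
by have := @qw_sum H 'I_n vtx R; rewrite /qbound QE card_half_edge.
Qed.

End Core.


From mathcomp Require Import all_classical all_reals all_analysis.
Import numFieldNormedType.Exports.
Local Open Scope classical_set_scope.

(** * Limits of moments *)

Section Moments.
Variables (R : realType) (d : forall n : nat, 'I_n -> nat) (p : nat -> R).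
Arguments d : clear implicits.
Hypothesis p_ge0 : forall k, 0 <= p k.
Hypothesis d_cvg : forall k : nat, (ndeg (d n) k)%:R / n%:R @[n --> \oo] --> p k.
Variable C : R.
Hypothesis fourth : \forall n \near \oo, \sum_(i < n) ((d n i)%:R : R) ^+ 4 <= C * n%:R.

Lemma trunc_cvg (g : nat -> R) K :
  (\sum_(i < n | (d n i < K)%N) g (d n i)) / n%:R @[n --> \oo]
    --> \sum_(k < K) g k * p k.
Proof.
have -> : (fun n => (\sum_(i < n | (d n i < K)%N) g (d n i)) / n%:R) =
    (fun n => \sum_(k < K) g k * ((ndeg (d n) k)%:R / n%:R)).
  apply/funext => n; rewrite -ndeg_sum mulr_suml; apply: eq_bigr => k _.
  by rewrite mulrA mulr_natr.
apply: cvg_big; first exact: add_continuous.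
by move=> k _; apply: cvgMl_tmp; exact: d_cvg.
Qed.

Lemma fourth_p K : \sum_(k < K) k%:R ^+ 4 * p k <= C.
Proof.
have h := @trunc_cvg (fun k => k%:R ^+ 4) K; apply: (cvgr_to_le h).
near=> n.
have n0 : 0 < n%:R :> R by rewrite ltr0n; near: n; exact: nbhs_infty_gt.
rewrite ler_pdivrMr //; apply: (@le_trans _ _ (\sum_(i < n) ((d n i)%:R : R) ^+ 4)).
  by rewrite big_mkcond; apply: ler_sum => i _; case: ifP => // _; apply: exprn_ge0.
by near: n.
Unshelve. all: by end_near. Qed.

Variable g : nat -> R.
Hypothesis g_le : forall k, `|g k| <= k%:R ^+ 3.

Let S K := \sum_(k < K) g k * p k.

(** For [k >= K], a function bounded by the cube is at most [k ^ 4 / K], and the fourth moment is at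
    most [C]. *)
Lemma tail_p K K' : (0 < K)%N -> (K <= K')%N -> `|S K' - S K| <= C / K%:R.
Proof.
move=> K0 KK; have K0' : 0 < K%:R :> R by rewrite ltr0n.
have -> : S K' - S K = \sum_(K <= k < K') g k * p k.
  rewrite /S -!(big_mkord xpredT (fun k => g k * p k)).
  have -> : \sum_(0 <= k < K') g k * p k =
      \sum_(0 <= k < K) g k * p k + \sum_(K <= k < K') g k * p k.
    by rewrite -big_cat_nat.
  by rewrite addrC addKr.
rewrite ler_pdivlMr //.
apply: (@le_trans _ _ (\sum_(0 <= k < K') k%:R ^+ 4 * p k)); last first.
  by rewrite big_mkord fourth_p.
have -> : \sum_(0 <= k < K') k%:R ^+ 4 * p k =
    \sum_(0 <= k < K) k%:R ^+ 4 * p k + \sum_(K <= k < K') k%:R ^+ 4 * p k.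
  by rewrite -big_cat_nat.
apply: (@le_trans _ _ (\sum_(K <= k < K') k%:R ^+ 4 * p k)); last first.
  by rewrite lerDr; apply: sumr_ge0 => k _; rewrite mulr_ge0 ?exprn_ge0.
apply: (@le_trans _ _ ((\sum_(K <= k < K') `|g k * p k|) * K%:R)).
  by rewrite ler_wpM2r ?ler_norm_sum // ltW.
rewrite mulr_suml; apply: ler_sum_nat => k /andP[Kk _].
rewrite normrM (ger0_norm (p_ge0 k)) mulrAC ler_wpM2r // exprSr.
by apply: ler_pM => //; rewrite ler_nat.
Qed.

Lemma moment_cvg : exists l : R, S @ \oo --> l.
Proof.
suff : cvgn S by move=> h; exists (lim (S @ \oo)).
have -> : S = series (fun k => g k * p k).
  by apply/funext => K; rewrite /S /series /= big_mkord.
apply: normed_cvg; apply: nondecreasing_is_cvgn.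
  by apply/nondecreasing_seqP => K; rewrite -subr_ge0 seriesSB normr_ge0.
exists C => _ [K _ <-]; rewrite -[leLHS]/(\sum_(0 <= k < K) `|g k * p k|) big_mkord.
apply: le_trans (fourth_p K); apply: ler_sum => k _.
rewrite normrM (ger0_norm (p_ge0 k)) ler_wpM2r //; apply: le_trans (g_le k) _.
case: (k : nat) => [|q]; first by rewrite !expr0n.
by rewrite ler_weXn2l // ler1n.
Qed.

Lemma moment_lim (l : R) : S @ \oo --> l -> forall K, (0 < K)%N -> `|l - S K| <= C / K%:R.
Proof.
move=> Sl K K0.
have h : `|S K' - S K| @[K' --> \oo] --> `|l - S K|.
  by apply: cvg_norm; apply: cvgB => //; exact: cvg_cst.
apply: (cvgr_to_le h); near=> K'; apply: tail_p => //.
by near: K'; exact: nbhs_infty_ge.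
Unshelve. all: by end_near. Qed.

Lemma tail_d K : (0 < K)%N -> \forall n \near \oo,
  `|(\sum_(i < n) g (d n i)) / n%:R -
    (\sum_(i < n | (d n i < K)%N) g (d n i)) / n%:R| <= C / K%:R.
Proof.
move=> K0; have K0' : 0 < K%:R :> R by rewrite ltr0n.
near=> n.
have n0 : 0 < n%:R :> R by rewrite ltr0n; near: n; exact: nbhs_infty_gt.
rewrite -mulrBl normrM [X in _ * X]ger0_norm ?invr_ge0 ?(ltW n0) // ler_pdivrMr //.
have -> : \sum_(i < n) g (d n i) - \sum_(i < n | (d n i < K)%N) g (d n i) =
    \sum_(i < n | ~~ (d n i < K)%N) g (d n i).
  by rewrite [X in X - _](bigID (fun i => (d n i < K)%N)) /= addrAC subrr add0r.
rewrite mulrAC ler_pdivlMr //.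
apply: (@le_trans _ _ (\sum_(i < n) ((d n i)%:R : R) ^+ 4)); last by near: n.
apply: (@le_trans _ _ ((\sum_(i < n | ~~ (d n i < K)%N) `|g (d n i)|) * K%:R)).
  by rewrite ler_wpM2r ?ler_norm_sum // ltW.
rewrite mulr_suml big_mkcond /=; apply: ler_sum => i _.
case: ifP => [|_]; last by apply: exprn_ge0.
rewrite -leqNgt => Kd; rewrite exprSr.
by apply: ler_pM => //; rewrite ?ler_nat // ltW.
Unshelve. all: by end_near. Qed.

(** Truncation at [K]: the finite sums converge term by term, and the tails for [p] and for the
    degree sequence are both at most [C / K]. *)
Lemma moment : exists l : R, [/\ expect_pmf p g = l%:E,
   (\sum_(i < n) g (d n i)) / n%:R @[n --> \oo] --> l &
   \sum_(k < K) g k * p k @[K --> \oo] --> l].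
Proof.
have [l Sl] := moment_cvg; exists l; split=> //.
  rewrite /expect_pmf; apply: cvg_lim => //.
  have -> : (fun n => (\sum_(0 <= i < n) (g i * p i)%:E)%E) = EFin \o S.
    by apply/funext => K; rewrite /= sumEFin big_mkord.
  by apply: cvg_EFin_comp || (apply/cvg_EFin => //; exact: nearW).
apply/cvgrPdist_le => e e0.
have [K K0 CK] : exists2 K, (0 < K)%N & C / K%:R <= e / 3.
  exists (Num.truncn (3 * C / e)).+1 => //.
  rewrite ler_pdivrMr ?ltr0n // -ler_pdivrMl ?divr_gt0 //.
  have := Num.Theory.truncnS_gt (3 * C / e); move/ltW; apply: le_trans.
  by rewrite le_eqVlt; apply/orP; left; apply/eqP; field; rewrite gt_eqF.
have h1 := moment_lim Sl K0.
have /cvgrPdist_le/(_ (e / 3)) := @trunc_cvg g K.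
move=> /(_ (divr_gt0 e0 (ltr0n _ 3))) h2.
near=> n.
have h3 : `|S K - (\sum_(i < n | (d n i < K)%N) g (d n i)) / n%:R| <= e / 3 by near: n.
have h4 : `|(\sum_(i < n) g (d n i)) / n%:R -
    (\sum_(i < n | (d n i < K)%N) g (d n i)) / n%:R| <= C / K%:R.
  by near: n; exact: tail_d.
move: h1 h3 h4; set x := S K; set y := (\sum_(i < n) _) / _; set z := (\sum_(i < n | _) _) / _.
rewrite !ler_norml => /andP[??] /andP[??] /andP[??]; apply/andP; split; lra.
Unshelve. all: by end_near. Qed.

End Moments.

(** * The giant component *)

Lemma pick_eps (R : realFieldType) (cs : seq R) :
  exists2 eps : R, 0 < eps & forall c, c \in cs -> c * eps < 1.
Proof.
pose X : R := 1 + \sum_(c <- cs) `|c|.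
have X0 : 0 < X by rewrite ltr_pwDl // sumr_ge0.
exists X^-1; first by rewrite invr_gt0.
move=> c cP; rewrite ltr_pdivrMr // mul1r /X (big_rem c) //= addrCA.
apply: le_lt_trans (ler_norm c) _; rewrite ltrDl ltr_pwDl // sumr_ge0 //.
Qed.

Lemma term_le_sum (R : realFieldType) (x1 x2 x3 x4 : R) :
  0 <= x1 -> 0 <= x2 -> 0 <= x3 -> 0 <= x4 ->
  [/\ x1 <= 1 + x1 + x2 + x3 + x4, x2 <= 1 + x1 + x2 + x3 + x4,
      x3 <= 1 + x1 + x2 + x3 + x4 & x4 <= 1 + x1 + x2 + x3 + x4].
Proof. by move=> *; split; lra. Qed.

Lemma truncn_bounds (R : realType) (y : R) : 0 <= y ->
  (Num.truncn y)%:R <= y /\ y - 1 <= (Num.truncn y)%:R.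
Proof.
move=> y0; have /andP[h1 h2] := truncn_itv y0; split=> //.
by rewrite -natr1 in h2; lra.
Qed.

(** * Elementary inequalities for the choice of constants *)

Section Arithmetic.
Variable R : realFieldType.
Implicit Types (u x y z del a al eps lam Th n : R).

Lemma end_ge u del a z : 2 <= del * a -> (u + del) * a - 1 <= z ->
  (u + del / 2) * a <= z.
Proof. by move=> h1; apply: le_trans; lra. Qed.

Lemma half_ge y z : 2 <= y -> y - 1 <= z -> y / 2 <= z.
Proof. by move=> ? ?; lra. Qed.

Lemma scale_le al x n y : 0 <= n -> al * x <= y -> x * (n * al) <= y * n.
Proof. by move=> n0 /(ler_wpM2r n0); apply: le_trans; lra. Qed.

Lemma leaves_arith Th a z y : 0 <= a -> z <= Th * a -> 4 * (Th + 1) * a <= y ->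
  2 * z <= y / 2.
Proof. by move=> *; lra. Qed.

Lemma steps_arith Th a eps lam n del x y z : 0 <= n -> 0 <= a -> 0 <= Th * eps ->
  del <= 1 -> x <= Th * a -> y <= del * a -> 4 * (Th + 1) * a <= lam * n ->
  (1 + 2 * Th) * eps <= lam / 2 -> `|z - lam * n| <= eps * n -> 2 * (x + y) <= z.
Proof.
move=> n0 a0 Te d1 xT yd hl he; rewrite ler_norml => /andP[h _].
have en : eps * n <= lam / 2 * n by apply: ler_wpM2r => //; lra.
have da : del * a <= a by apply: ler_piMl.
lra.
Qed.

Lemma quarter_le x y z : 0 < x -> 4 * y / x <= z -> y <= x / 4 * z.
Proof. by move=> x0; rewrite ler_pdivrMr // => h; lra. Qed.

Lemma eighth_le x y z : 0 < x -> 8 * y / x <= z -> 2 * y <= x / 4 * z.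
Proof. by move=> x0; rewrite ler_pdivrMr // => h; lra. Qed.

Lemma quarter_mul_le x y z : 0 <= y -> y * (4 * (z + 1)) <= x -> z * y <= x / 4.
Proof. by move=> *; lra. Qed.

Lemma quarter_div_le x y : 0 < x -> 0 <= y -> y * (x / (4 * (y + 1))) <= x / 4.
Proof.
move=> x0 y0; have y1 : 0 < y + 1 by lra.
have -> : y * (x / (4 * (y + 1))) = x / 4 * (y / (y + 1)) by field; rewrite gt_eqF.
by apply: ler_piMr; [rewrite divr_ge0 // ltW|rewrite ler_pdivrMr // mul1r; lra].
Qed.

Lemma quarters_le x y1 y2 y3 y4 : y1 <= x / 4 -> y2 <= x / 4 -> y3 <= x / 4 ->
  y4 <= x / 4 -> y1 + (y2 + y3) + y4 <= x.
Proof. by move=> *; lra. Qed.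

End Arithmetic.

Lemma expR_prod (R : realType) (I : finType) (P : pred I) (q : I -> R) :
  (forall i, 0 <= q i) ->
  \prod_(i | P i) (1 + 4 * q i) <= expR (4 * \sum_(i | P i) q i).
Proof.
move=> q0; rewrite mulr_sumr expR_sum; apply: ler_prod => i _.
by rewrite addr_ge0 ?mulr_ge0 //= expR_ge1Dx.
Qed.

(** * Asymptotics of the degree sequence *)

Section Asymptotic.
Variables (R : realType) (d : forall n : nat, 'I_n -> nat).
Arguments d : clear implicits.
Variables (p : nat -> R) (lambda eta : R).
Hypothesis p_ge0 : forall k, 0 <= p k.
Hypothesis d_cvg : forall k : nat, (ndeg (d n) k)%:R / n%:R @[n --> \oo] --> p k.
Hypothesis lambdaE : expect_pmf p (fun k => k%:R) = lambda%:E.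
Hypothesis lambda_gt0 : 0 < lambda.
Hypothesis p1_gt0 : 0 < p 1%N.
Hypothesis critical : expect_pmf p (fun k => k%:R * (k%:R - 2)) = 0%E.
Hypothesis alpha_gt0 : forall n : nat, (0 < n)%N -> 0 < alpha R d n.
Hypothesis alpha_large : n%:R `^ 3^-1 * alpha R d n @[n --> \oo] --> +oo.
Hypothesis eta_gt0 : 0 < eta.
Hypothesis d_moment : (fun n : nat => \sum_(i < n) (d n i)%:R `^ (4 + eta) : R)
               =O_\oo (fun n : nat => n%:R : R).

Lemma fourth_moment : exists2 C : R, 0 <= C &
  \forall n \near \oo, \sum_(i < n) ((d n i)%:R : R) ^+ 4 <= C * n%:R.
Proof.
have /eqO_exP[c c0 hc] := d_moment; exists c; first exact: ltW.
near=> n.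
have : `|\sum_(i < n) (d n i)%:R `^ (4 + eta) : R| <= c * `|n%:R : R| by near: n.
rewrite [X in _ <= _ * X]ger0_norm //; apply: le_trans.
apply: le_trans (ler_norm _); apply: ler_sum => i _.
case: (d n i) => [|q]; first by rewrite expr0n powR_ge0.
rewrite -powR_mulrn // ler_powR ?ler1n // lerDl ltW //.
Unshelve. all: by end_near. Qed.

Lemma moment_ex (g : nat -> R) : (forall k, `|g k| <= k%:R ^+ 3) ->
  exists l : R, [/\ expect_pmf p g = l%:E,
   (\sum_(i < n) g (d n i)) / n%:R @[n --> \oo] --> l &
   \sum_(k < K) g k * p k @[K --> \oo] --> l].
Proof.
move=> gP; have [C C0 hC] := fourth_moment.
exact: (moment p_ge0 d_cvg hC gP).
Qed.

Lemma degree_cvg : (\sum_(i < n) (d n i)%:R) / n%:R @[n --> \oo] --> lambda.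
Proof.
have [k|l [lE lc _]] := @moment_ex (fun k => k%:R).
  rewrite ger0_norm //; case: k => [|k]; first by rewrite expr0n.
  by rewrite -[leLHS]expr1 ler_weXn2l // ler1n.
by move: lc; have -> : l = lambda by apply/EFin_inj; rewrite -lE.
Qed.

Let crit (k : nat) : R := k%:R * (k%:R - 2).
Let fall (k : nat) : R := k%:R * (k%:R - 1) * (k%:R - 2).

Lemma nat_cases (P : nat -> Prop) : P 0%N -> P 1%N -> (forall k, P k.+2) -> forall k, P k.
Proof. by move=> ??? [|[|k]]. Qed.

Lemma crit_le k : `|crit k| <= k%:R ^+ 3.
Proof.
rewrite /crit; elim/nat_cases: k => [||k].
- by rewrite mul0r normr0 expr0n.
- by rewrite expr1n mul1r ler_norml; apply/andP; split; lra.
have k0 : 0 <= k%:R :> R by [].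
rewrite -[k.+2]addn2 natrD addrK ger0_norm ?mulr_ge0 ?addr_ge0 //.
rewrite exprSr mulrC; nra.
Qed.

Lemma fall_le k : `|fall k| <= k%:R ^+ 3.
Proof.
rewrite /fall; elim/nat_cases: k => [||k].
- by rewrite !mul0r normr0 expr0n.
- by rewrite subrr mulr0 mul0r normr0 exprn_ge0.
have k0 : 0 <= k%:R :> R by [].
have -> : k.+2%:R = k%:R + 2 :> R by rewrite -[k.+2]addn2 natrD.
rewrite addrK ger0_norm; last by rewrite !mulr_ge0 //; lra.
rewrite exprS expr2 -mulrA; apply: ler_wpM2l; first lra.
apply: ler_pM; lra.
Qed.

Lemma alpha_cvg0 : alpha R d n @[n --> \oo] --> (0 : R).
Proof.
have [l [lE lc _]] := moment_ex crit_le.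
move: lc; have -> : l = 0 by apply/EFin_inj; rewrite -lE critical.
by [].
Qed.

(** Subtracting the null mean of [crit] turns [fall k] into [k * (k - 2) ^ 2], whose term at 1 gives
    [beta >= p 1]. The limit comes from [k ^ 3 = fall k + 3 * crit k + 4 * k]. *)
Lemma third_moment : exists beta : R, [/\ expect_pmf p fall = beta%:E, 0 < beta &
  (\sum_(i < n) (d n i)%:R ^+ 3) / n%:R @[n --> \oo] --> beta + 4 * lambda].
Proof.
have [b [bE bc bs]] := moment_ex fall_le; exists b.
have [l [lE _ ls]] := moment_ex crit_le.
have l0 : l = 0 by apply/EFin_inj; rewrite -lE critical.
split=> //.
  apply: (lt_le_trans p1_gt0).
  have h : \sum_(k < K) fall k * p k - \sum_(k < K) crit k * p k @[K --> \oo] --> b - 0.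
    by rewrite l0 in ls; exact: (cvgB bs ls).
  rewrite subr0 in h; apply: (cvgr_to_ge h); near=> K.
  have K2 : (2 <= K)%N by near: K; exact: nbhs_infty_ge.
  have [K' ->] : exists K', K = K'.+2 by exists K.-2; case: (K) K2 => [|[]].
  rewrite -sumrB (bigD1 (Ordinal (isT : 1 < K'.+2)%N)) //=.
  rewrite /fall /crit; set x := \sum_(i < _ | _) _.
  suff : 0 <= x by lra.
  apply: sumr_ge0 => k _; rewrite -mulrBl mulr_ge0 //.
  have -> : (k : nat)%:R * (k%:R - 1) * (k%:R - 2) - k%:R * (k%:R - 2) =
    k%:R * (k%:R - 2) ^+ 2 :> R by ring.
  by rewrite mulr_ge0 ?sqr_ge0.
have -> : (fun n : nat => (\sum_(i < n) ((d n i)%:R : R) ^+ 3) / n%:R) =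
   (fun n => (\sum_(i < n) fall (d n i)) / n%:R +
      (3 * alpha R d n + 4 * ((\sum_(i < n) (d n i)%:R) / n%:R))).
  apply/funext => n; rewrite /alpha [3 * _]mulrA [4 * _]mulrA -!mulrDl; congr (_ / _).
  rewrite !mulr_sumr -!big_split /=; apply: eq_bigr => i _; rewrite /fall; ring.
have -> : b + 4 * lambda = b + (3 * 0 + 4 * lambda) by rewrite mulr0 add0r.
apply: cvgD => //; apply: cvgD.
  by apply: cvgMl_tmp; exact: alpha_cvg0.
by apply: cvgMl_tmp; exact: degree_cvg.
Unshelve. all: by end_near. Qed.

(** With [z] the cube root of [n] and [y = z * al] large, the first three quantities are
    [z ^ 2 * y], [z * y ^ 2] and [y ^ 3]. The last comparison is meant for [degree_small]. *)
Lemma alpha_big (M : R) : \forall n \near \oo,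
  [/\ M <= n%:R * alpha R d n, M <= n%:R * alpha R d n * alpha R d n,
      M <= n%:R * alpha R d n * alpha R d n ^+ 2 &
      n%:R ^+ 2 <= (n%:R * alpha R d n) ^+ 4].
Proof.
have /cvgryPge/(_ (1 + `|M|)) hM := alpha_large.
near=> n.
have n1 : 1 <= n%:R :> R by rewrite ler1n; near: n; exact: nbhs_infty_gt.
have : 1 + `|M| <= n%:R `^ 3^-1 * alpha R d n by near: n.
set z := n%:R `^ 3^-1; set al := alpha R d n; set y := z * al => hy.
have z1 : 1 <= z by rewrite -(powRr0 n%:R) ler_powR // invr_ge0.
have z3 : n%:R = z ^+ 3.
  by rewrite -powR_mulrn ?powR_ge0 // -powRrM mulVf // powRr1.
have M0 := normr_ge0 M; have MM := ler_norm M.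
have y1 : 1 <= y by lra.
have yM : M <= y by lra.
have y0 : 0 <= y by lra.
have z0 : 0 <= z by lra.
have zk k : 1 <= z ^+ k by apply: exprn_ege1.
have yk k : 1 <= y ^+ k by apply: exprn_ege1.
have E1 : n%:R * al = z ^+ 2 * y by rewrite z3 /y; ring.
have E2 : n%:R * al * al = z * y * y by rewrite z3 /y; ring.
have E3 : n%:R * al * al ^+ 2 = y ^+ 2 * y by rewrite z3 /y; ring.
have yy : M <= y * y by apply: le_trans yM _; rewrite ler_peMl.
split.
- by rewrite E1; apply: le_trans yM _; rewrite ler_peMl.
- by rewrite E2 -mulrA; apply: le_trans yy _; rewrite ler_peMl // mulr_ge0.
- by rewrite E3; apply: le_trans yM _; rewrite ler_peMl.
- rewrite E1; have -> : (z ^+ 2 * y) ^+ 4 = z ^+ 8 * y ^+ 4 by ring.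
  have -> : n%:R ^+ 2 = z ^+ 6 by rewrite z3; ring.
  rewrite -[leLHS]mulr1; apply: ler_pM => //.
    by rewrite exprn_ge0.
  by apply: ler_weXn2l.
Unshelve. all: by end_near. Qed.

(** A larger degree would have a fourth power of at least [e ^+ 4 * n ^+ 2], more than the total
    [C * n]. *)
Lemma degree_small (e : R) : 0 < e -> \forall n \near \oo,
  forall i : 'I_n, (d n i)%:R <= e * (n%:R * alpha R d n).
Proof.
move=> e0; have [C C0 hC] := fourth_moment.
have e4 : 0 < e ^+ 4 by rewrite exprn_gt0.
near=> n => i.
have n0 : 0 < n%:R :> R by rewrite ltr0n; near: n; exact: nbhs_infty_gt.
have h4 : \sum_(i < n) ((d n i)%:R : R) ^+ 4 <= C * n%:R by near: n.
have [_ _ _ h2] : [/\ 1 <= n%:R * alpha R d n, 1 <= n%:R * alpha R d n * alpha R d n,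
      1 <= n%:R * alpha R d n * alpha R d n ^+ 2 &
      n%:R ^+ 2 <= (n%:R * alpha R d n) ^+ 4] by near: n; exact: alpha_big.
have hn : C / e ^+ 4 < n%:R.
  near: n; exists (Num.truncn (C / e ^+ 4)).+1 => // q /= hq.
  by apply: lt_le_trans (truncnS_gt _) _; rewrite ler_nat.
have a0 : 0 <= n%:R * alpha R d n.
  by apply: mulr_ge0 => //; apply/ltW/alpha_gt0; rewrite -(ltr0n R).
rewrite leNgt; apply/negP => lt.
have h1 : (e * (n%:R * alpha R d n)) ^+ 4 <= (d n i)%:R ^+ 4.
  have ea0 := mulr_ge0 (ltW e0) a0.
  by apply: lerXn2r; rewrite ?nnegrE //; apply: ltW.
have h3 : (d n i)%:R ^+ 4 <= \sum_(i < n) ((d n i)%:R : R) ^+ 4.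
  by rewrite (bigD1 i) //= lerDl sumr_ge0 // => j _; apply: exprn_ge0.
have h5 : e ^+ 4 * n%:R ^+ 2 <= C * n%:R.
  apply: le_trans h4; apply: le_trans h3; apply: le_trans h1.
  by rewrite exprMn ler_pM2l.
move: hn; rewrite ltr_pdivrMr // => hn.
have : C * n%:R < n%:R * e ^+ 4 * n%:R by rewrite ltr_pM2r.
have -> : n%:R * e ^+ 4 * n%:R = e ^+ 4 * n%:R ^+ 2 by ring.
by move/lt_le_trans/(_ h5); rewrite ltxx.
Unshelve. all: by end_near. Qed.

Lemma alpha_small (e : R) : 0 < e -> \forall n \near \oo, alpha R d n <= e.
Proof.
move=> e0; have /cvgrPdist_le/(_ e e0) h := alpha_cvg0.
near=> n; have : `|0 - alpha R d n| <= e by near: n.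
by rewrite sub0r normrN; apply: le_trans; apply: ler_norm.
Unshelve. all: by end_near. Qed.

Lemma mean_approx (l : R) (f : nat -> R) (e : R) : f n / n%:R @[n --> \oo] --> l ->
  0 < e -> \forall n \near \oo, `|f n - l * n%:R| <= e * n%:R.
Proof.
move=> /cvgrPdist_le fl e0; have h := fl e e0.
near=> n; have n0 : 0 < n%:R :> R by rewrite ltr0n; near: n; exact: nbhs_infty_gt.
have : `|l - f n / n%:R| <= e by near: n.
rewrite -(ler_pM2r n0) -{2}(ger0_norm (ltW n0)) -normrM mulrBl divfK ?gt_eqF //.
by rewrite distrC.
Unshelve. all: by end_near. Qed.

Section Giant.
Variable beta : R.
Hypothesis beta_gt0 : 0 < beta.
Hypothesis cube_cvg :
  (\sum_(i < n) (d n i)%:R ^+ 3) / n%:R @[n --> \oo] --> beta + 4 * lambda.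
Local Notation th := (2 * lambda / beta).
Local Notation na n := (n%:R * alpha R d n).

Lemma leaf_near : \forall n \near \oo, p 1%N / 2 * n%:R <= (ndeg (d n) 1)%:R.
Proof.
have h := mean_approx (@d_cvg 1%N) (divr_gt0 p1_gt0 (ltr0n R 2)).
near=> n; have : `|(ndeg (d n) 1)%:R - p 1%N * n%:R| <= p 1%N / 2 * n%:R by near: n.
by rewrite ler_norml => /andP[? _]; lra.
Unshelve. all: by end_near. Qed.

(** The order of choices matters: [del] from [e], then [eps] from [del], then [e3], [al0] and [M]
    from [eps] and [x], and only then [n]. Each of the four error terms receives [x / 4]. *)
Lemma nbad_near (k : nat) (e x : R) : 0 < e -> 0 < x -> \forall n \near \oo,
  (nbad (d n) e th (k%:R * p k / lambda) (na n) k)%:R <= x * (nmatch (d n))%:R.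
Proof.
move=> e0 x0; have [c4 c40 hC] := fourth_moment.
(* The size-biased probability of degree [k]. *)
pose r := k%:R * p k / lambda.
have r0 : 0 <= r by rewrite divr_ge0 ?mulr_ge0 // ltW.
pose rho := (beta + 4 * lambda) / lambda.
have kapE : rho - 4 = beta / lambda by rewrite /rho; field; rewrite gt_eqF.
have kap0 : 0 < rho - 4 by rewrite kapE divr_gt0.
have rho4 : 4 < rho by rewrite -subr_gt0.
have thE : 2 / (rho - 4) = th by rewrite kapE; field; rewrite !gt_eqF.
pose Th := 2 / (rho - 4) + 1.
have th0 : 0 <= 2 / (rho - 4) by rewrite divr_ge0 // ltW.
have Th0 : 0 <= Th by rewrite addr_ge0.
(* The first bound covers both precisions asked by [e]; the second is the room needed in
   [stop_subcritical]. *)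
pose del := Num.min (e / (6 + 2 * r)) (3 / 4 / (2 * (rho - 4) + 5)).
have q1 : 0 < 6 + 2 * r by lra.
have q2 : 0 < 2 * (rho - 4) + 5 by lra.
have del0 : 0 < del by rewrite lt_min !divr_gt0.
have del1 : (6 + 2 * r) * del <= e.
  by rewrite mulrC -ler_pdivlMr // ge_min lexx.
have del2 : (2 * (rho - 4) + 5) * del <= 3 / 4.
  by rewrite mulrC -ler_pdivlMr // ge_min lexx orbT.
have rd : 0 <= r * del by rewrite mulr_ge0 // ltW.
have e1 : 6 * del <= e by lra.
have e2 : (4 + 2 * r) * del <= e by lra.
have kd : 0 <= (rho - 4) * del by rewrite mulr_ge0 // ltW.
have del_le1 : del <= 1 by lra.
have thdel : del <= 2 / (rho - 4) by rewrite ler_pdivlMr //; lra.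
pose C1 := drift_const lambda Th rho (1 + Th).
pose Cc := crude_const lambda Th rho C1.
pose Cw := walk_const lambda Th rho C1.
pose Cs := C1 + drift_const lambda Th 1 (1 + Th) + drift_const lambda Th r (1 + Th) + Cc + 3.
have [eps eps0 epsP] := pick_eps [:: 1; (1 + 2 * Th) * (2 / lambda); 1 + Cc; lambda^-1;
  2 * lambda * (2 * Cw + 1) / del; lambda * Cw * (2 / ((rho - 4) * del ^+ 2)); Cs / del].
have eps1 : eps <= 1 by rewrite -[eps]mul1r; apply/ltW/epsP; rewrite !inE eqxx ?orbT.
have eps2 : (1 + 2 * Th) * eps <= lambda / 2.
  have := epsP ((1 + 2 * Th) * (2 / lambda)); rewrite !inE eqxx ?orbT => /(_ isT).
  have -> : (1 + 2 * Th) * (2 / lambda) * eps = (1 + 2 * Th) * eps / (lambda / 2).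
    by field; rewrite gt_eqF.
  by rewrite ltr_pdivrMr ?divr_gt0 // mul1r => /ltW.
have eps3 : (1 + Cc) * eps <= 1 by apply/ltW/epsP; rewrite !inE eqxx ?orbT.
have eps4 : eps <= lambda.
  have := epsP lambda^-1; rewrite !inE eqxx ?orbT => /(_ isT).
  by rewrite mulrC ltr_pdivrMr // mul1r => /ltW.
have eps5 : 2 * lambda * ((2 * Cw + 1) * eps) < del.
  have := epsP (2 * lambda * (2 * Cw + 1) / del); rewrite !inE eqxx ?orbT => /(_ isT).
  by rewrite mulrAC ltr_pdivrMr // mul1r mulrA.
have eps6 : lambda * (Cw * eps) < (rho - 4) * del ^+ 2 / 2.
  have := epsP (lambda * Cw * (2 / ((rho - 4) * del ^+ 2))).
  rewrite !inE eqxx ?orbT => /(_ isT).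
  have -> : lambda * Cw * (2 / ((rho - 4) * del ^+ 2)) * eps =
     lambda * (Cw * eps) / ((rho - 4) * del ^+ 2 / 2).
    by field; rewrite !gt_eqF.
  by rewrite ltr_pdivrMr ?mul1r // divr_gt0 // mulr_gt0 // exprn_gt0.
have eps7 : Cs * eps <= del.
  have := epsP (Cs / del); rewrite !inE eqxx ?orbT => /(_ isT).
  by rewrite mulrAC ltr_pdivrMr // mul1r => /ltW.
pose K1 := 2 * c4 / lambda * Th / eps ^+ 2 + 16 * c4 * lambda / del ^+ 2.
pose K2 := 2 * c4 / lambda * Th / eps ^+ 2.
pose K3 := 2 * c4 / lambda * Th / eps.
have lam_ge0 := ltW lambda_gt0; have eps_ge0 := ltW eps0; have del_ge0 := ltW del0.
have K10 : 0 <= K1 by rewrite /K1; nonneg.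
have K20 : 0 <= K2 by rewrite /K2; nonneg.
have K30 : 0 <= K3 by rewrite /K3; nonneg.
pose e3 := x / (4 * (K2 + 1)).
have e30 : 0 < e3 by rewrite divr_gt0 // mulr_gt0 // ltr_wpDl.
pose al0 := Num.min (Num.min eps (p 1%N / (4 * (Th + 1))))
   (Num.min (lambda / (4 * (Th + 1))) (x / (4 * (K3 + 1)))).
have Th1 : 0 < 4 * (Th + 1) by rewrite mulr_gt0 // ltr_wpDl.
have K31 : 0 < 4 * (K3 + 1) by rewrite mulr_gt0 // ltr_wpDl.
have al00 : 0 < al0 by rewrite !lt_min eps0 !divr_gt0.
pose M := 1 + eps^-1 + 2 / del + 4 * K1 / x + 8 * K2 / x.
have Mi : [/\ 0 <= eps^-1, 0 <= 2 / del, 0 <= 4 * K1 / x & 0 <= 8 * K2 / x].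
  by have x_ge0 := ltW x0; split; nonneg.
have [M1 M2 M3 M4] : [/\ eps^-1 <= M, 2 / del <= M, 4 * K1 / x <= M & 8 * K2 / x <= M].
  by case: Mi => ? ? ? ?; apply: term_le_sum.
have cN := mean_approx degree_cvg eps0.
have cC := mean_approx cube_cvg eps0.
(* The count is multiplied by [k] in [KA]; dividing by [k.+1] rather than [k] includes [k = 0]. *)
have ck := mean_approx (@d_cvg k) (divr_gt0 eps0 (ltr0Sn R k)).
near=> n.
have n1 : (0 < n)%N by near: n; exact: nbhs_infty_gt.
have n0 : 0 < n%:R :> R by rewrite ltr0n.
set al := alpha R d n; set a := n%:R * al.
have alp : 0 < al by apply: alpha_gt0.
have al_le : al <= al0 by rewrite /al; near: n; exact: alpha_small.
have [a1 a2 a3 _] : [/\ M <= a, M <= a * al, M <= a * al ^+ 2 & n%:R ^+ 2 <= a ^+ 4].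
  by rewrite /a /al; near: n; exact: alpha_big.
move: al_le; rewrite !le_min => /andP[/andP[al_eps al_p] /andP[al_lam al_x]].
have a0 : 0 < a by rewrite mulr_gt0.
have one_le : 1 <= eps * (a * al).
  by rewrite mulrC -ler_pdivrMr // mul1r; apply: le_trans M1 a2.
have da : 2 <= del * a.
  by rewrite mulrC -ler_pdivrMr //; apply: le_trans M2 a1.
have NA : `|(\sum_(i < n) d n i)%:R - lambda * n%:R| <= eps * n%:R.
  by rewrite natr_sum; near: n.
have CA : `|\sum_(i < n) ((d n i)%:R : R) ^+ 3 - rho * (lambda * n%:R)| <= eps * n%:R.
  have -> : rho * (lambda * n%:R) = (beta + 4 * lambda) * n%:R.
    by rewrite /rho; field; rewrite gt_eqF.
  by near: n.
have KA : `|(k * ndeg (d n) k)%:R - r * (lambda * n%:R)| <= eps * n%:R.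
  have -> : r * (lambda * n%:R) = k%:R * (p k * n%:R).
    by rewrite /r; field; rewrite gt_eqF.
  have h : `|(ndeg (d n) k)%:R - p k * n%:R| <= eps / k.+1%:R * n%:R by near: n.
  rewrite natrM -mulrBr normrM ger0_norm //.
  apply: le_trans (ler_wpM2l (ler0n R k) h) _; rewrite mulrA ler_pM2r //.
  rewrite mulrCA ler_piMr // ler_pdivrMr ?ltr0n // mul1r ler_nat leqnSn //.
have SA : \sum_(i < n) ((d n i)%:R : R) ^+ 2 = 2 * (\sum_(i < n) d n i)%:R + a.
  have -> : a = \sum_(i < n) (d n i)%:R * ((d n i)%:R - 2).
    by rewrite /a /al /alpha [LHS]mulrC divfK // gt_eqF.
  rewrite natr_sum mulr_sumr -big_split /=.
  by apply: eq_bigr => i _; ring.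
pose T := Num.truncn ((2 / (rho - 4) + del) * a).
pose t2 := Num.truncn ((2 / (rho - 4) - del) * a).
pose J := Num.truncn (del * a).
have [T1 T2] := truncn_bounds (mulr_ge0 (addr_ge0 th0 del_ge0) (ltW a0)).
have thd0 : 0 <= 2 / (rho - 4) - del by rewrite subr_ge0.
have [t21 t22] := truncn_bounds (mulr_ge0 thd0 (ltW a0)).
have [J1 J2] := truncn_bounds (mulr_ge0 del_ge0 (ltW a0)).
have T_ge : (2 / (rho - 4) + del / 2) * a <= T%:R := end_ge da T2.
have J_ge : del * a / 2 <= J%:R := half_ge da J2.
have TTh : T%:R <= Th * a by apply: le_trans T1 _; rewrite ler_pM2r // lerD2l.
have hp : 4 * (Th + 1) * a <= p 1%N * n%:R.
  by apply: scale_le; rewrite ?(ltW n0) // -ler_pdivlMr.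
have hl : 4 * (Th + 1) * a <= lambda * n%:R.
  by apply: scale_le; rewrite ?(ltW n0) // -ler_pdivlMr.
have TL : (2 * T <= ndeg (d n) 1)%N.
  rewrite -(ler_nat R) natrM; apply: (@le_trans _ _ (p 1%N / 2 * n%:R)).
    by rewrite mulrAC; apply: leaves_arith TTh hp; apply: ltW.
  by near: n; exact: leaf_near.
have TJ : (2 * (T + J) <= \sum_(i < n) d n i)%N.
  rewrite -(ler_nat R) natrM natrD.
  exact: (steps_arith (ltW n0) (ltW a0) (mulr_ge0 Th0 eps_ge0) del_le1 TTh J1 hl eps2 NA).
have Dl0 : 0 <= e3 * a by rewrite mulr_ge0 // ltW.
have FA : \sum_(i < n) ((d n i)%:R : R) ^+ 4 <= c4 * n%:R by near: n.
have DA (i : 'I_n) : (d n i)%:R <= e3 * a.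
  by rewrite /a /al; move: i; near: n; exact: degree_small.
have core := core_bound n0 (erefl a) alp al_eps eps1 one_le lambda_gt0 rho4 r0 NA CA KA
  SA eps2 eps3 eps4 eps5 eps6 eps7 del0 del2 t21 t22 T1 T_ge J1 J_ge TJ TL c40 Dl0
  FA DA e1 e2.
rewrite -/r -thE; apply: le_trans core _; rewrite ler_wpM2r //.
have b1 : K1 / (a * al ^+ 2) <= x / 4.
  have aal : 0 < a * al ^+ 2 by rewrite mulr_gt0 // exprn_gt0.
  by rewrite ler_pdivrMr //; apply: quarter_le => //; apply: le_trans M3 a3.
have b2 : K2 * e3 <= x / 4 by apply: quarter_div_le.
have b3 : 2 * K2 / a <= x / 4.
  by rewrite ler_pdivrMr //; apply: eighth_le => //; apply: le_trans M4 a1.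
have b4 : K3 * al <= x / 4.
  by apply: quarter_mul_le; rewrite ?(ltW alp) // -ler_pdivlMr.
have -> : 2 * c4 / lambda * (2 / (rho - 4) + 1) * (e3 * a + 2) / eps ^+ 2 / a =
    K2 * e3 + 2 * K2 / a.
  by rewrite /K2 /Th; field; rewrite !gt_eqF.
exact: quarters_le.
Unshelve. all: by end_near. Qed.

Lemma simple_near : exists2 P : R, 0 < P &
  \forall n \near \oo, (nmatch (d n))%:R <= P * (nsimple (d n))%:R.
Proof.
have [C C0 hC] := fourth_moment.
(* The exponent is 4 times the bound of [qw_sum], with [Q <= C * n] and with [4 / (lambda * n)]
   bounding the inverses of [N - 1] and [N - 3]. *)
exists (expR (4 * (4 * C / lambda + 16 * C ^+ 2 / lambda ^+ 2))); first exact: expR_gt0.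
have lam_ge0 := ltW lambda_gt0.
pose D := 8 / lambda + 64 * C / lambda ^+ 2.
have D0 : 0 < D by rewrite ltr_wpDr ?divr_gt0 // divr_ge0 ?mulr_ge0 ?exprn_ge0.
(* With degrees at most [e2 * n], the conflict bound is at most [4 * (e2 * D) = 4^-1]. *)
pose e2 := (16 * D)^-1.
have e20 : 0 < e2 by rewrite invr_gt0 mulr_gt0.
have cN := mean_approx degree_cvg (divr_gt0 lambda_gt0 (ltr0n R 2)).
near=> n.
have n1 : (0 < n)%N by near: n; exact: nbhs_infty_gt.
have n0 : 0 < n%:R :> R by rewrite ltr0n.
have alp : 0 < alpha R d n by apply: alpha_gt0.
have al1 : alpha R d n <= 1 by near: n; exact: alpha_small.
set N := (\sum_(i < n) d n i)%N; set Q := (\sum_(i < n) d n i ^ 2)%N.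
have NL : lambda * n%:R / 2 <= N%:R.
  have : `|\sum_(i < n) ((d n i)%:R : R) - lambda * n%:R| <= lambda / 2 * n%:R by near: n.
  by rewrite -natr_sum ler_norml => /andP[? _]; lra.
have n12 : 12 <= lambda * n%:R.
  rewrite mulrC -ler_pdivrMr //; near: n.
  exists (Num.truncn (12 / lambda)).+1 => // q /= hq.
  by apply/ltW/(lt_le_trans (truncnS_gt _)); rewrite ler_nat.
have N6 : (6 <= N)%N by rewrite -(ler_nat R); lra.
pose y := 4 / (lambda * n%:R).
have ln0 : 0 < lambda * n%:R by rewrite mulr_gt0.
have y0 : 0 <= y by rewrite divr_ge0 // ltW.
have inv j : (j <= 3)%N -> (N - j)%:R^-1 <= y.
  move=> j3; have jR : j%:R <= 3 :> R by rewrite ler_nat.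
  have jN : (j <= N)%N by apply: leq_trans j3 (leq_trans _ N6).
  have -> : y = (lambda * n%:R / 4)^-1 by rewrite /y; field; rewrite gt_eqF // gt_eqF.
  rewrite lef_pV2 ?posrE ?natrB //; [lra | | ].
    lra.
  by rewrite divr_gt0.
have i10 : 0 <= (N - 1)%:R^-1 :> R by rewrite invr_ge0.
have i30 : 0 <= (N - 3)%:R^-1 :> R by rewrite invr_ge0.
have i1 := inv 1%N isT; have i3 := inv 3%N isT.
have QC : Q%:R <= C * n%:R.
  have hc : \sum_(i < n) ((d n i)%:R : R) ^+ 4 <= C * n%:R by near: n.
  apply: le_trans hc; rewrite natr_sum; apply: ler_sum => i _; rewrite natrX.
  case: (d n i) => [|q]; first by rewrite !expr0n.
  by rewrite ler_weXn2l // ler1n.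
pose Delta := Num.truncn (e2 * n%:R).
have en0 : 0 <= e2 * n%:R by rewrite mulr_ge0 // ltW.
have DeltaR : Delta%:R <= e2 * n%:R by have /andP[] := truncn_itv en0.
have dD i : (d n i <= Delta)%N.
  rewrite truncn_ge_nat //; apply: (@le_trans _ _ (e2 * na n)).
    by move: i; near: n; exact: degree_small.
  by rewrite ler_pM2l // ler_piMr // ltW.
have Cn0 : 0 <= C * n%:R by rewrite mulr_ge0 // ltW.
have lamn : n%:R * y = 4 / lambda by rewrite /y; field; rewrite !gt_eqF.
have cb : 4 * ((2 * Delta)%:R * (N - 1)%:R^-1 +
    (4 * Delta * Q)%:R * ((N - 1)%:R^-1 * (N - 3)%:R^-1)) <= 4^-1 :> R.
  apply: (@le_trans _ _ (4 * ((2 * (e2 * n%:R)) * y +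
      (4 * (e2 * n%:R) * (C * n%:R)) * (y * y)))).
    rewrite ler_pM2l // !natrM; apply: lerD.
      by apply: ler_pM => //; rewrite ?mulr_ge0 // ler_pM2l.
    apply: ler_pM; rewrite ?mulr_ge0 //.
      by apply: ler_pM; rewrite ?mulr_ge0 // ler_pM2l.
    exact: ler_pM.
  have -> : 2 * (e2 * n%:R) * y + 4 * (e2 * n%:R) * (C * n%:R) * (y * y) =
     e2 * (2 * (n%:R * y) + 4 * C * (n%:R * y) ^+ 2) by ring.
  rewrite lamn.
  have -> : 2 * (4 / lambda) + 4 * C * (4 / lambda) ^+ 2 = D.
    by rewrite /D; field; rewrite gt_eqF.
  rewrite /e2; have -> : 4 * ((16 * D)^-1 * D) = 4^-1 by field; rewrite gt_eqF.
  by [].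
have N4 : (4 <= N)%N by apply: leq_trans N6.
have [nm qs] := simple_core dD N4 cb.
apply: le_trans nm _; rewrite ler_wpM2r //.
apply: le_trans (expR_prod _ _) _; first by move=> j; rewrite invr_ge0.
rewrite ler_expR ler_pM2l //; apply: le_trans qs _; rewrite -/N -/Q.
have -> : 4 * C / lambda + 16 * C ^+ 2 / lambda ^+ 2 =
   y * (C * n%:R + (C * n%:R) ^+ 2 * y).
  by rewrite /y; field; rewrite !gt_eqF.
apply: ler_pM; [done|by apply: addr_ge0 => //; apply: mulr_ge0|done|].
apply: lerD => //; rewrite natrX; apply: ler_pM => //.
by apply: lerXn2r; rewrite ?nnegrE.
Unshelve. all: by end_near. Qed.

Definition near_giant (n : nat) (G : mgraph 'I_n) (k : nat) (e : R)
    (C1 C2 : {set 'I_n}) : Prop :=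
  [/\ `|(nvertices C1)%:R - th * na n| <= e * na n,
      `|(nvertices_deg G k C1)%:R - k%:R * p k / lambda * (th * na n)| <= e * na n,
      `|(nedges G C1)%:R - th * na n| <= e * na n,
      (nvertices C2)%:R <= e * na n & (nedges G C2)%:R <= e * na n].

(** Quantifying over the events [E] incompatible with [near_giant] avoids making a boolean of a
    statement about all ways of breaking ties. In the end [E] is the event that one of the five
    quantities deviates. *)
Lemma giant_transfer (T : nat -> finType) (Om : forall n, {set T n})
    (G : forall n, T n -> mgraph 'I_n) :
  (forall (k : nat) (e x : R), 0 < e -> 0 < x -> \forall n \near \oo,
     forall E : pred (T n), (forall w, w \in Om n -> E w ->
       ~ (forall C1 C2, is_largest (components (G n w)) C1 ->
            is_largest (components (G n w) :\ C1)%SET C2 ->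
            near_giant (G n w) k e C1 C2)) ->
     unif_prob R (Om n) E <= x) ->
  giant_component Om G p lambda beta (alpha R d).
Proof.
move=> TR C1 C2 CP nb.
have key k (X : forall n, T n -> R) :
    (forall n w (e : R), near_giant (G n w) k e (C1 n w) (C2 n w) ->
       `|X n w| <= e * na n) -> littleo_p Om X nb.
  move=> XP eps0 e0; apply/cvgrPdist_le => x x0.
  have h := TR k eps0 x e0 x0; near=> n.
  have n0 : 0 < na n.
    have n1 : (0 < n)%N by near: n; exact: nbhs_infty_gt.
    by rewrite mulr_gt0 ?ltr0n // alpha_gt0.
  rewrite sub0r normrN ger0_norm ?divr_ge0 //.
  have hn : forall E : pred (T n), (forall w, w \in Om n -> E w ->
       ~ (forall C1 C2, is_largest (components (G n w)) C1 ->
            is_largest (components (G n w) :\ C1)%SET C2 ->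
            near_giant (G n w) k eps0 C1 C2)) ->
     unif_prob R (Om n) E <= x by near: n.
  apply: hn => w wO; rewrite ltNge => /negP nle bnd; apply: nle.
  have [c1 c2] := CP n w wO; have := XP _ _ _ (bnd _ _ c1 c2).
  by rewrite normrM normfV (gtr0_norm n0) ler_pdivrMr.
have abs0 (y z : R) : 0 <= y -> y <= z -> `|y| <= z by move=> y0; rewrite ger0_norm.
split.
- by apply: (key 0%N) => n w e [].
- move=> k; apply: (key k) => n w e [_ h _ _ _].
  have -> : 2 / beta * k%:R * p k * nb n = k%:R * p k / lambda * (th * na n).
    by rewrite /nb; field; rewrite !gt_eqF.
  exact: h.
- by apply: (key 0%N) => n w e [].
- by apply: (key 0%N) => n w e [_ _ _ h _]; apply: abs0.
- by apply: (key 0%N) => n w e [_ _ _ _ h]; apply: abs0.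
Unshelve. all: by end_near. Qed.

Lemma good_near_giant (e : R) : 0 < e -> exists2 e' : R, 0 < e' &
  \forall n \near \oo, forall (m : {perm half_edge (d n)}) (G : mgraph 'I_n) k,
    m \in fpf (half_edge (d n)) -> models m G ->
    good e' th (k%:R * p k / lambda) (na n) k m ->
    forall C1 C2, is_largest (components G) C1 ->
      is_largest (components G :\ C1)%SET C2 -> near_giant G k e C1 C2.
Proof.
move=> e0; have th0 : 0 < th by rewrite divr_gt0 // mulr_gt0.
(* The half offsets the factor 2 in [good_components]; the quarter ensures [3 * e' < th]. *)
pose e' := Num.min (e / 2) (th / 4).
have e'0 : 0 < e' by rewrite lt_min; apply/andP; split; apply: divr_gt0.
exists e' => //.
have e'e : e' <= e / 2 by rewrite ge_min lexx.
have e'th : 3 * e' < th.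
  have : e' <= th / 4 by rewrite ge_min lexx orbT.
  by move: th0; set t := th; lra.
near=> n => m G k mP mG gm C1 C2 c1 c2.
have [a1 _ _ _] : [/\ e'^-1 <= na n, e'^-1 <= na n * alpha R d n,
   e'^-1 <= na n * alpha R d n ^+ 2 & n%:R ^+ 2 <= (na n) ^+ 4].
  by near: n; exact: alpha_big.
have a0 : 0 < na n by apply: lt_le_trans a1; rewrite invr_gt0.
have ea1 : 1 <= e' * na n by rewrite mulrC -ler_pdivrMr // mul1r.
have [h1 h2 h3 h4 h5] := good_components mP mG a0 ea1 e'th gm c1 c2.
have le2 : 2 * (e' * na n) <= e * na n by rewrite mulrA ler_pM2r //; lra.
have le1 : e' * na n <= e * na n by apply: le_trans le2; lra.
by split; [apply: le_trans h1 le1|apply: le_trans h2 le1|apply: le_trans h3 le1|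
  apply: le_trans h4 le2|apply: le_trans h5 le1].
Unshelve. all: by end_near. Qed.

Lemma giant_matchings : giant_component (fun n => matchings (d n))
  (fun n => @graph_of_matching n (d n)) p lambda beta (alpha R d).
Proof.
apply: giant_transfer => k e x e0 x0.
have [e' e'0 he] := good_near_giant e0; have hb := nbad_near k e'0 x0.
near=> n => E EP.
have bn : (nbad (d n) e' th (k%:R * p k / lambda) (na n) k)%:R <= x * (nmatch (d n))%:R.
  by near: n.
have un : (#|[pred w in matchings (d n) | E w]| <=
    nbad (d n) e' th (k%:R * p k / lambda) (na n) k)%N.
  apply: unif_matchings => m mP Em; apply/negP => gm.
  apply: (EP (blocks m) (blocks_matching mP) Em).
  have hn : forall (m : {perm half_edge (d n)}) (G : mgraph 'I_n) k,
    m \in fpf (half_edge (d n)) -> models m G ->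
    good e' th (k%:R * p k / lambda) (na n) k m ->
    forall C1 C2, is_largest (components G) C1 ->
      is_largest (components G :\ C1)%SET C2 -> near_giant G k e C1 C2 by near: n.
  exact: (hn m _ k mP (models_matching mP) gm).
rewrite /unif_prob card_matchingsT -/(nmatch (d n)).
have [->|m0] := posnP (nmatch (d n)); first by rewrite invr0 mulr0 ltW.
rewrite ler_pdivrMr ?ltr0n //; apply: le_trans bn.
by rewrite ler_nat.
Unshelve. all: by end_near. Qed.

Lemma giant_simple : giant_component (fun n => simple_graphs (d n))
  (fun n => @graph_of_edges n) p lambda beta (alpha R d).
Proof.
apply: giant_transfer => k e x e0 x0.
have [e' e'0 he] := good_near_giant e0; have [P P0 hP] := simple_near.
(* Conditioning on simplicity multiplies probabilities by at most [P], so bad matchings are required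
   to be rarer by that factor. *)
have hb := nbad_near k e'0 (divr_gt0 x0 P0).
near=> n => E EP.
have bn : (nbad (d n) e' th (k%:R * p k / lambda) (na n) k)%:R
    <= x / P * (nmatch (d n))%:R by near: n.
have sn : (nmatch (d n))%:R <= P * (nsimple (d n))%:R by near: n.
have un : (#|[pred w in simple_graphs (d n) | E w]| * #|tag_perms (d n)| <=
    nbad (d n) e' th (k%:R * p k / lambda) (na n) k)%N.
  apply: unif_simple => m mP ms Em; apply/negP => gm.
  apply: (EP (edge_set m) (edge_set_simple mP ms) Em).
  have hn : forall (m : {perm half_edge (d n)}) (G : mgraph 'I_n) k,
    m \in fpf (half_edge (d n)) -> models m G ->
    good e' th (k%:R * p k / lambda) (na n) k m ->
    forall C1 C2, is_largest (components G) C1 ->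
      is_largest (components G :\ C1)%SET C2 -> near_giant G k e C1 C2 by near: n.
  exact: (hn m _ k mP (models_simple mP ms) gm).
rewrite /unif_prob.
have [->|m0] := posnP #|simple_graphs (d n)|; first by rewrite invr0 mulr0 ltW.
rewrite ler_pdivrMr ?ltr0n //.
have g0 : 0 < #|tag_perms (d n)|%:R :> R by rewrite ltr0n card_tag_perms.
rewrite -(ler_pM2r g0) -mulrA -!natrM card_simple.
apply: (@le_trans _ _ (nbad (d n) e' th (k%:R * p k / lambda) (na n) k)%:R).
  by rewrite ler_nat.
apply: le_trans bn _; apply: le_trans (ler_wpM2l _ sn) _.
  by rewrite divr_ge0 // ltW.
by rewrite mulrA divfK // gt_eqF.
Unshelve. all: by end_near. Qed.

End Giant.
End Asymptotic.

Theorem theorem2p4 (R : realType) (d : forall n : nat, 'I_n -> nat)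
    (p : nat -> R) (lambda eta : R)
    (d_even : forall n : nat, ~~ odd (\sum_(i < n) d n i)%N)
    (p_pmf : is_pmf p)
    (d_cvg : forall k : nat,
       (ndeg (d n) k)%:R / n%:R @[n --> \oo] --> p k)
    (lambdaE : expect_pmf p (fun k => k%:R) = lambda%:E)
    (lambda_gt0 : 0 < lambda)
    (d_sqr : (fun n : nat => \sum_(i < n) (d n i)%:R ^+ 2 : R)
               =O_\oo (fun n : nat => n%:R : R))
    (p1_gt0 : 0 < p 1%N)
    (critical : expect_pmf p (fun k => k%:R * (k%:R - 2)) = 0%E)
    (alpha_gt0 : forall n : nat, (0 < n)%N -> 0 < alpha R d n)
    (alpha_large : n%:R `^ 3^-1 * alpha R d n @[n --> \oo] --> +oo)
    (eta_gt0 : 0 < eta)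
    (d_moment : (fun n : nat => \sum_(i < n) (d n i)%:R `^ (4 + eta) : R)
               =O_\oo (fun n : nat => n%:R : R)) :
  exists beta : R,
    [/\ expect_pmf p (fun k => k%:R * (k%:R - 1) * (k%:R - 2)) = beta%:E,
        0 < beta,
        giant_component (fun n => simple_graphs (d n))
          (fun n => @graph_of_edges n) p lambda beta (alpha R d) &
        giant_component (fun n => matchings (d n))
          (fun n => @graph_of_matching n (d n)) p lambda beta (alpha R d)].
Proof.
have [p_ge0 _] := p_pmf.
have [beta [bE b0 bc]] := third_moment p_ge0 d_cvg lambdaE p1_gt0 critical eta_gt0 d_moment.
exists beta; split=> //.
- exact: (giant_simple p_ge0 d_cvg lambdaE lambda_gt0 p1_gt0 critical alpha_gt0
    alpha_large eta_gt0 d_moment b0 bc).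
- exact: (giant_matchings p_ge0 d_cvg lambdaE lambda_gt0 p1_gt0 critical alpha_gt0
    alpha_large eta_gt0 d_moment b0 bc).
Qed.
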